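(* Assume Lang's conjecture in the following form: there is an absolute constant $c_L>0$ such that for every elliptic curve $E/\mathbb{Q}$ and every non-torsion point $P\in E(\mathbb{Q})$, $$\hat{h}(P)\ \ge\ c_L\max\{h(j_E),h(\Delta_E)\}.$$ Then there exist absolute constants $A>1$ and $C>0$ such that for every elliptic curve $E/\mathbb{Q}$ of Mordell–Weil rank $r$ and every sequence $\{P_1,\ldots,P_N\}\subseteq E(\mathbb{Q})$ of rational points in $x$-arithmetic progression, one has $N\le C\,A^r$. Equivalently, $N_x(E)\le C A^r$ for every $E/\mathbb{Q}$ of rank $r$.
   Context: For an elliptic curve $E/\mathbb{Q}$, $j_E$ is its $j$-invariant and $\Delta_E$ its minimal discriminant; $h$ denotes the absolute logarithmic Weil height on $\overline{\mathbb{Q}}$ (so $h(\Delta_E)=\log|\Delta_E|$). For a Weierstrass model of $E$ and $P\in E(\overline{\mathbb{Q}})$, $h(P)=h(x(P))$ and the canonical height is $\hat{h}(P)=\lim_{n\to\infty}h(2^nP)/4^n$ (not normalized by a factor $1/2$). A finite sequence $\{P_1,\dots,P_N\}\subseteq E(\mathbb{Q})$ is in $x$-arithmetic progression if the $x$-coordinates $x(P_1),\dots,x(P_N)$ are $N$ distinct rational numbers forming an arithmetic progression; this notion does not depend on the choice of Weierstrass equation. $N_x(E)$ denotes the maximum length of such a sequence on $E$. *)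

(* Defs.v *)
From mathcomp Require Import all_boot all_algebra.
From Stdlib Require Import Reals.

Set Implicit Arguments.
Unset Strict Implicit.
Unset Printing Implicit Defensive.

Import GRing.Theory Num.Theory.

(* A (general) Weierstrass model over Q:
   y^2 + a1 x y + a3 y = x^3 + a2 x^2 + a4 x + a6. *)
Record wmodel := WModel { wa1 : rat; wa2 : rat; wa3 : rat; wa4 : rat; wa6 : rat }.

Section Weierstrass.
Local Open Scope ring_scope.

Definition wb2 (E : wmodel) : rat := wa1 E ^+ 2 + 4 * wa2 E.
Definition wb4 (E : wmodel) : rat := 2 * wa4 E + wa1 E * wa3 E.
Definition wb6 (E : wmodel) : rat := wa3 E ^+ 2 + 4 * wa6 E.
Definition wb8 (E : wmodel) : rat :=
  wa1 E ^+ 2 * wa6 E + 4 * wa2 E * wa6 E - wa1 E * wa3 E * wa4 E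
  + wa2 E * wa3 E ^+ 2 - wa4 E ^+ 2.
Definition wc4 (E : wmodel) : rat := wb2 E ^+ 2 - 24 * wb4 E.
Definition wdisc (E : wmodel) : rat :=
  - wb2 E ^+ 2 * wb8 E - 8 * wb4 E ^+ 3 - 27 * wb6 E ^+ 2
  + 9 * wb2 E * wb4 E * wb6 E.
Definition wj (E : wmodel) : rat := wc4 E ^+ 3 / wdisc E.

Definition elliptic (E : wmodel) : Prop := wdisc E != 0.

(* Q-isomorphism of Weierstrass models (Silverman, Table III.1.2):
   x = u^2 x' + r, y = u^3 y' + s u^2 x' + t. *)
Definition wiso (E E' : wmodel) : Prop :=
  exists u r s t : rat, u != 0 /\
    u * wa1 E' = wa1 E + 2 * s /\
    u ^+ 2 * wa2 E' = wa2 E - s * wa1 E + 3 * r - s ^+ 2 /\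
    u ^+ 3 * wa3 E' = wa3 E + r * wa1 E + 2 * t /\
    u ^+ 4 * wa4 E' = wa4 E - s * wa3 E + 2 * r * wa2 E
                      - (t + r * s) * wa1 E + 3 * r ^+ 2 - 2 * s * t /\
    u ^+ 6 * wa6 E' = wa6 E + r * wa4 E + r ^+ 2 * wa2 E + r ^+ 3
                      - t * wa3 E - t ^+ 2 - r * t * wa1 E.

Definition integral_model (E : wmodel) : Prop :=
  [/\ denq (wa1 E) = 1, denq (wa2 E) = 1, denq (wa3 E) = 1,
      denq (wa4 E) = 1 & denq (wa6 E) = 1].

Definition is_abs_min_disc (E : wmodel) (D : nat) : Prop :=
  (exists E', integral_model E' /\ wiso E E' /\ absz (numq (wdisc E')) = D) /\
  (forall E', integral_model E' -> wiso E E' -> leq D (absz (numq (wdisc E')))).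

(* Rational points: None is the point at infinity O. *)
Definition point := option (rat * rat).

Definition on_curve (E : wmodel) (P : point) : Prop :=
  match P with
  | None => True
  | Some (x, y) =>
      y ^+ 2 + wa1 E * x * y + wa3 E * y
      = x ^+ 3 + wa2 E * x ^+ 2 + wa4 E * x + wa6 E
  end.

Definition pneg (E : wmodel) (P : point) : point :=
  match P with
  | None => None
  | Some (x, y) => Some (x, - y - wa1 E * x - wa3 E)
  end.

(* Group law (Silverman, Algorithm III.2.3) *)
Definition padd (E : wmodel) (P Q : point) : point :=
  match P, Q with
  | None, _ => Q
  | _, None => P
  | Some (x1, y1), Some (x2, y2) =>
      if (x1 == x2) && (y1 + y2 + wa1 E * x2 + wa3 E == 0) then None
      else
        let lam := if x1 != x2 then (y2 - y1) / (x2 - x1)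
                   else (3 * x1 ^+ 2 + 2 * wa2 E * x1 + wa4 E - wa1 E * y1)
                        / (2 * y1 + wa1 E * x1 + wa3 E) in
        let nu := if x1 != x2 then (y1 * x2 - y2 * x1) / (x2 - x1)
                  else (- x1 ^+ 3 + wa4 E * x1 + 2 * wa6 E - wa3 E * y1)
                       / (2 * y1 + wa1 E * x1 + wa3 E) in
        let x3 := lam ^+ 2 + wa1 E * lam - wa2 E - x1 - x2 in
        Some (x3, - (lam + wa1 E) * x3 - nu - wa3 E)
  end.

Definition pmul (E : wmodel) (n : nat) (P : point) : point :=
  iter n (padd E P) None.

Definition pzmul (E : wmodel) (n : int) (P : point) : point :=
  match n with
  | Posz m => pmul E m P
  | Negz m => pneg E (pmul E m.+1 P)
  end.

Definition non_torsion (E : wmodel) (P : point) : Prop :=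
  forall n : nat, ltn O n -> pmul E n P <> None.

Definition independent (E : wmodel) (r : nat) (Ps : 'I_r -> point) : Prop :=
  (forall i, on_curve E (Ps i)) /\
  forall n : 'I_r -> int,
    \big[padd E/None]_(i < r) pzmul E (n i) (Ps i) = None ->
    forall i, n i = 0.

Definition has_rank (E : wmodel) (r : nat) : Prop :=
  (exists Ps : 'I_r -> point, independent E Ps) /\
  ~ (exists Ps : 'I_r.+1 -> point, independent E Ps).

Definition x_arith_prog (E : wmodel) (N : nat) (Ps : nat -> point) : Prop :=
  (forall i, ltn i N -> on_curve E (Ps i)) /\
  exists a d : rat, d != 0 /\
    forall i, ltn i N -> exists y : rat, Ps i = Some (a + i%:R * d, y).

End Weierstrass.

Definition hQ (x : rat) : R :=
  ln (INR (maxn (absz (numq x)) (absz (denq x)))).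

Definition hpt (P : point) : R :=
  match P with None => 0%R | Some (x, _) => hQ x end.

(* v is the canonical height of P: v = lim h(2^n P) / 4^n (not normalized by 1/2) *)
Definition is_canonical_height (E : wmodel) (P : point) (v : R) : Prop :=
  Un_cv (fun n : nat => (hpt (pmul E (expn 2 n) P) / 4 ^ n)%R) v.

Definition lang_conjecture : Prop :=
  exists cL : R, (0 < cL)%R /\
    forall (E : wmodel), elliptic E ->
    forall (P : point), on_curve E P -> non_torsion E P ->
    forall (v : R) (D : nat), is_canonical_height E P v -> is_abs_min_disc E D ->
      (cL * Rmax (hQ (wj E)) (ln (INR D)) <= v)%R.

(* Main.v *)
(* Proof idea.  Move E to the short model y^2 = x^3 - 27 c4 x - 54 c6 of a minimal integral model;
   with M = max (h(j), log D) the coefficients have height O(M), so the naive and the canonical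
   height differ by O(M), and Lang's conjecture says that the canonical height of a non-torsion
   point is at least cL M.  After restricting a progression to a suitable residue class mod 4 and
   choosing the signs of the points, the difference of any two of them has an x-coordinate which
   (in a coordinate adapted to the progression) has negative 2-adic valuation; doubling lowers
   this valuation by 2, so all differences are non-torsion.

   Points of the progression whose canonical height is O(M) are therefore separated by the minimum
   of a quadratic form, and there are at most 2^(O(r)) of them.  To bound the heights, take a
   window of W = 2^(O(r)) consecutive points, of maximal height H.  A volume argument yields three
   of them, P, P + R1 and P + R2, with R1 and R2 of height at most eps H.  Their x-coordinates
   satisfy a linear relation with coefficients at most W, and eliminating y makes x(P) a root of a
   polynomial of degree 10 whose coefficients have height O(eps H + M + log W).  Hence the first
   term and the common difference of the window have height O(eps H + M + log W), so does H, and
   for small eps this gives H = O(M + log W).  Comparing the first and the last window bounds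
   log N by O(M + log W) as well.  If log W <= M all points have height O(M); otherwise N is at
   most a power of W. *)
Require Import Defs.
From HB Require Import structures.
From mathcomp Require Import all_boot all_order all_algebra.
From Stdlib Require Import Reals Lra Lia Classical.
From Stdlib Require ClassicalEpsilon.
(* MathComp's ring and field, imported next, shadow those of Stdlib, which are needed on R. *)
Ltac Rring := ring.
Ltac Rfield := field.
From mathcomp Require Import ring zify.

Set Implicit Arguments.
Unset Strict Implicit.
Unset Printing Implicit Defensive.

Import Order.TTheory GRing.Theory Num.Theory.
Local Open Scope ring_scope.

(* The keys R and N now denote scopes of Stdlib. *)
Delimit Scope ring_scope with ri.
Delimit Scope nat_scope with nt.

(** * The group law of a short Weierstrass curve *)

(** The bound is uniform in the curve, so [M] must absorb every absolute constant. It can, because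
    [M] is at least log 2: no integral model combines a j-invariant of height 0 with discriminant 1
    or -1. The rank enters as the statement that any r + 1 points satisfy a nontrivial integer
    relation. Counting is therefore done in the group itself, without a basis or a Euclidean space:
    relations reduced modulo 2 leave at most 2^r classes, iteration leaves 2^(r t) classes modulo
    2^t, and dividing by 2^t inside a class shrinks the quadratic form by 4^t. Lang's bound is
    silent about torsion, so distinct terms could a priori be at canonical distance 0; signs may be
    chosen freely because x-coordinates do not see them, and the right choice excludes this. A
    cluster has three points because a progression has two unknowns, the first term and the common
    difference, and one integer relation between three terms eliminates both. Windows are short
    because the coefficients of that relation, of logarithm at most log W, enter the height
    bound. *)

Definition shortW (a b : rat) : wmodel := WModel 0 0 0 a b.

Section GroupLaw.
Variables a b : rat.
Hypothesis nonsing : 4 * a ^+ 3 + 27 * b ^+ 2 != 0.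
Local Notation E := (shortW a b).

Definition cubic (x : rat) : rat := x ^+ 3 + a * x + b.

Lemma on_shortE (x y : rat) : on_curve E (Some (x, y)) <-> y ^+ 2 = cubic x.
Proof. by rewrite /= /cubic !mul0r !addr0 /=. Qed.

Lemma pneg_shortE (x y : rat) : pneg E (Some (x, y)) = Some (x, - y).
Proof. by rewrite /= !mul0r !subr0. Qed.

(* The line [y = l x + c] meets the curve in p, q and r, with multiplicity:
   [cubic - (l X + c)^2 = (X - p.1) (X - q.1) (X - r.1)]. *)
Definition col (p q r : rat * rat) : Prop :=
  exists l c, [/\ p.2 = l * p.1 + c, q.2 = l * q.1 + c & r.2 = l * r.1 + c] /\
   [/\ l ^+ 2 = p.1 + q.1 + r.1,
       a - 2 * l * c = p.1 * q.1 + p.1 * r.1 + q.1 * r.1 &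
       c ^+ 2 - b = p.1 * q.1 * r.1].

Lemma colC p q r : col p q r -> col q p r.
Proof.
case=> l [c [[h1 h2 h3] [h4 h5 h6]]]; exists l, c; split; split => //.
- by rewrite h4; ring.
- by rewrite h5; ring.
by rewrite h6; ring.
Qed.

Lemma col_rot p q r : col p q r -> col q r p.
Proof.
case=> l [c [[h1 h2 h3] [h4 h5 h6]]]; exists l, c; split; split => //.
- by rewrite h4; ring.
- by rewrite h5; ring.
by rewrite h6; ring.
Qed.

Lemma col_neg p q r : col p q r -> col (p.1, - p.2) (q.1, - q.2) (r.1, - r.2).
Proof.
case=> l [c [[h1 h2 h3] [h4 h5 h6]]]; exists (- l), (- c); split; split => //=.
- by rewrite h1; ring.
- by rewrite h2; ring.
- by rewrite h3; ring.
- by rewrite -h4; ring.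
- by rewrite -h5; ring.
by rewrite -h6; ring.
Qed.

Lemma col_on p q r : col p q r -> p.2 ^+ 2 = cubic p.1.
Proof.
case: p q r => [x1 y1] [x2 y2] [x3 y3] [l [c /= [[h1 h2 h3] [h4 h5 h6]]]].
rewrite /cubic h1.
have -> : b = c ^+ 2 - x1 * x2 * x3 by rewrite -h6; ring.
have -> : a = 2 * l * c + (x1 * x2 + x1 * x3 + x2 * x3) by rewrite -h5; ring.
have -> : (l * x1 + c) ^+ 2 = l ^+ 2 * x1 ^+ 2 + 2 * l * c * x1 + c ^+ 2 by ring.
by rewrite h4; ring.
Qed.

(** A double root x would force a = -3 x^2 and b = 2 x^3, for which 4 a^3 + 27 b^2 vanishes. *)
Lemma cubic_simple_root x : cubic x = 0 -> 3 * x ^+ 2 + a <> 0.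
Proof.
rewrite /cubic => h1 h2; move/eqP: nonsing; apply.
have -> : a = - 3 * x ^+ 2 by rewrite -[LHS](subr0) -h2; ring.
have -> : b = 2 * x ^+ 3 by rewrite -[LHS](subr0) -h1 -[a](subr0) -h2; ring.
ring.
Qed.

(** A point counted twice is expressed in [col] by coefficient identities alone; they already
    contain the slope given by implicit differentiation. *)
Lemma col_tangent p r l c : p.2 ^+ 2 = cubic p.1 -> p.2 = l * p.1 + c ->
  l ^+ 2 = p.1 + p.1 + r -> a - 2 * l * c = p.1 * p.1 + p.1 * r + p.1 * r ->
  2 * p.2 * l = 3 * p.1 ^+ 2 + a.
Proof.
case: p => x y /= h0 h1 h2 h3.
have -> : a = x * x + x * r + x * r + 2 * l * c by rewrite -h3; ring.
by rewrite h1 (_ : r = l ^+ 2 - x - x); [ring | rewrite h2; ring].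
Qed.

(** The line y = l X + c is not vertical, so q = -p forces y = 0 and p = q; the tangent identity
    then makes this a singular point. *)
Lemma col_neq_neg p q r : col p q r -> q <> (p.1, - p.2).
Proof.
move=> H; have hp := col_on H; have [hq _] := (col_on (colC H), I).
case: p q r H hp hq => [x1 y1] [x2 y2] [x3 y3].
case=> l [c /= [[h1 h2 h3] [h4 h5 h6]]] hp hq [e1 e2].
have y0 : y1 = 0.
  have : 2 * y1 = y1 - (- y1) by ring.
  by rewrite -e2 {2}h1 h2 e1 subrr; move/eqP; rewrite mulf_eq0 => /orP[]// /eqP.
subst x2 y2; apply: (@cubic_simple_root x1); first by rewrite -hp y0 expr0n.
by rewrite -(@col_tangent (x1, y1) x3 l c) //= y0 mulr0 mul0r.
Qed.

Lemma col_uniq p q r r' : col p q r -> col p q r' -> r = r'.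
Proof.
move=> H H'; have hn := col_neq_neg H; have hp := col_on H; have hq := col_on (colC H).
case: p q r r' H H' hp hq hn => [x1 y1] [x2 y2] [x3 y3] [x4 y4].
case=> l [c /= [[h1 h2 h3] [h4 h5 h6]]].
case=> l' [c' /= [[h1' h2' h3'] [h4' h5' h6']]] hp hq hn.
suff el : l = l'.
  subst l'; have e3 : x3 = x4 by apply: (addrI (x1 + x2)); rewrite -h4 -h4'.
  have e4 : c = c' by apply: (addrI (l * x1)); rewrite -h1 -h1'.
  by rewrite h3 h3' e3 e4.
have [e|ne] := eqVneq x1 x2; last first.
  apply: (mulIf (x := x1 - x2)); first by rewrite subr_eq0.
  have -> : l * (x1 - x2) = (l * x1 + c) - (l * x2 + c) by ring.
  by rewrite -h1 -h2 h1' h2'; ring.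
subst x2; have e2 : y1 = y2 by rewrite h1 h2.
have y0 : 2 * y1 != 0.
  by rewrite mulf_neq0 //; apply/eqP => y0; apply: hn; rewrite -e2 /= y0 oppr0.
apply: (mulfI y0).
by rewrite (@col_tangent (x1, y1) x3 l c) // (@col_tangent (x1, y1) x4 l' c').
Qed.

(** The bridge from the case analysis in [padd] to the symmetric relation [col], from which the
    group axioms are derived. *)
Lemma padd_shortP p q : p.2 ^+ 2 = cubic p.1 -> q.2 ^+ 2 = cubic q.1 ->
  q = (p.1, - p.2) /\ padd E (Some p) (Some q) = None \/
  exists r, col p q r /\ padd E (Some p) (Some q) = Some (r.1, - r.2).
Proof.
case: p q => [x1 y1] [x2 y2]; rewrite /cubic /= => hp hq.
rewrite ?(mul0r, mulr0, addr0, subr0).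
case: ifP => [/andP[/eqP e1 /eqP e2]|h]; [left|right].
  by subst x2; split => //; congr pair; rewrite -[LHS](subr0) -e2; ring.
have [e|ne] := eqVneq x1 x2; rewrite /=.
  subst x2; rewrite eqxx /= in h.
  have e2 : y1 = y2.
    have : (y1 - y2) * (y1 + y2) = 0 by rewrite -[0](subrr (y1 ^+ 2)) {2}hp -hq; ring.
    by move/eqP; rewrite mulf_eq0 h orbF subr_eq0 => /eqP.
  subst y2.
  have y0 : y1 != 0 by apply/negP => /eqP y0; move: h; rewrite y0 addr0 eqxx.
  have y2 : 2 * y1 != 0 by rewrite mulf_neq0.
  set l := (_ / _); set nu := (X in - l * _ - X).
  have el : 2 * y1 * l = 3 * x1 ^+ 2 + a.
    by rewrite /l; field.
  have en : nu = y1 - l * x1.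
    apply: (mulfI y2); rewrite /nu mulrCA mulfV // mulr1.
    have -> : 2 * y1 * (y1 - l * x1) = 2 * y1 ^+ 2 - (2 * y1 * l) * x1 by ring.
    by rewrite hp el; ring.
  clearbody l nu; have ea : a = 2 * y1 * l - 3 * x1 ^+ 2 by rewrite el; ring.
  have eb : b = y1 ^+ 2 - x1 ^+ 3 - a * x1 by rewrite hp; ring.
  exists (l ^+ 2 - x1 - x1, l * (l ^+ 2 - x1 - x1) + nu); split; last by rewrite /=; congr Some; congr pair; ring.
  exists l, nu; rewrite /= en; split; split => //; try ring.
  - by rewrite ea; ring.
  by rewrite eb ea; ring.
have d0 : x2 - x1 != 0 by rewrite subr_eq0 eq_sym.
set l := (_ / _); set nu := (X in - l * _ - X).
have el : (x2 - x1) * l = y2 - y1 by rewrite /l mulrCA mulfV // mulr1.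
have en : nu = y1 - l * x1.
  apply: (mulfI d0); rewrite /nu mulrCA mulfV // mulr1.
  have -> : (x2 - x1) * (y1 - l * x1) = (x2 - x1) * y1 - (x2 - x1) * l * x1 by ring.
  by rewrite el; ring.
have key : l * (y1 + y2) = x1 ^+ 2 + x1 * x2 + x2 ^+ 2 + a.
  apply: (mulfI d0); rewrite mulrA el.
  have -> : (y2 - y1) * (y1 + y2) = y2 ^+ 2 - y1 ^+ 2 by ring.
  by rewrite hp hq; ring.
clearbody l nu.
have {}el : y2 = y1 + l * (x2 - x1) by rewrite mulrC el; ring.
have ea : a = l * (y1 + y1 + l * (x2 - x1)) - (x1 ^+ 2 + x1 * x2 + x2 ^+ 2).
  by rewrite -[in RHS]addrA -el key; ring.
have eb : b = y1 ^+ 2 - x1 ^+ 3 - a * x1 by rewrite hp; ring.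
exists (l ^+ 2 - x1 - x2, l * (l ^+ 2 - x1 - x2) + nu); split; last by rewrite /=; congr Some; congr pair; ring.
exists l, nu; rewrite /= en; split; split => //; try ring.
- by rewrite el; ring.
- by rewrite ea; ring.
by rewrite eb ea; ring.
Qed.
End GroupLaw.

(* The lines through P1, P2 and P3, P4 meet the curve again in opposite points (s, -t) and (s, t).
   The product of their equations, divided by X - s, is Q X - k Y with Q monic quadratic and
   k = l + m; it vanishes at the four points.  If y = n x + e is the line through P1 and P3, then
   Q X - k (n X + e) = (X - x1) (X - x3), and P2, P4 lie on the line of slope k - n below. *)
Lemma exchange_lines (a b l m s t x1 x3 n e : rat) (y1 := l * x1 - t - l * s) (y3 := m * x3 + t - m * s) :
  let x2 := l ^+ 2 - s - x1 in let x4 := m ^+ 2 - s - x3 in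
  let y2 := l * x2 - t - l * s in let y4 := m * x4 + t - m * s in
  let u := n ^+ 2 - x1 - x3 in
  t ^+ 2 = s ^+ 3 + a * s + b ->
  a - 2 * l * (- t - l * s) = x1 * x2 + x1 * s + x2 * s ->
  a - 2 * m * (t - m * s) = x3 * x4 + x3 * s + x4 * s ->
  y1 = n * x1 + e -> y3 = n * x3 + e ->
  a - 2 * n * e = x1 * x3 + x1 * u + x3 * u ->
  e ^+ 2 - b = x1 * x3 * u ->
  l + m != 0 ->
  (x1 = x3 -> 2 * y1 * n = 3 * x1 ^+ 2 + a) ->
  (x1 = x3 -> y1 = y3 /\ y1 != 0) ->
  [/\ y2 = (l + m - n) * x2 + (- (l + m) * u - e),
      y4 = (l + m - n) * x4 + (- (l + m) * u - e),
      (l + m - n) ^+ 2 = x2 + x4 + u,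
      a - 2 * (l + m - n) * (- (l + m) * u - e) = x2 * x4 + x2 * u + x4 * u &
      (- (l + m) * u - e) ^+ 2 - b = x2 * x4 * u].
Proof.
move=> x2 x4 y2 y4 u ht h1 h3 hy1 hy3 hn he k0 htan hy.
pose k := l + m; rewrite -/k.
pose Q X := X ^+ 2 + (l * m + s) * X + (a - (t + l * s) * m + l * (t - m * s) + s * (l * m + s)).
have hb : b = t ^+ 2 - s ^+ 3 - a * s by rewrite ht; ring.
have Qe X : (X ^+ 3 + a * X + b) + (l * X - t - l * s) * (m * X + t - m * s) = (X - s) * Q X.
  by rewrite hb /Q; ring.
pose A X := X ^+ 2 - (l ^+ 2 - s) * X + (a - 2 * l * (- t - l * s) - s * (l ^+ 2 - s)).
pose B X := X ^+ 2 - (m ^+ 2 - s) * X + (a - 2 * m * (t - m * s) - s * (m ^+ 2 - s)).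
have AE X : A X = (X - x1) * (X - x2) by rewrite /A h1 /x2; ring.
have BE X : B X = (X - x3) * (X - x4) by rewrite /B h3 /x4; ring.
have Q1 : Q x1 = k * y1 by rewrite -[LHS](subr0) -[0](mul0r (x1 - x2)) -[0](subrr x1) -AE /Q /k /A /y1; ring.
have Q2 : Q x2 = k * y2 by rewrite -[LHS](subr0) -[0](mulr0 (x2 - x1)) -[X in _ * X](subrr x2) -AE /Q /k /A /y2; ring.
have Q3 : Q x3 = k * y3 by rewrite -[LHS](subr0) -[0](mul0r (x3 - x4)) -[0](subrr x3) -BE /Q /k /B /y3; ring.
have Q4 : Q x4 = k * y4 by rewrite -[LHS](subr0) -[0](mulr0 (x4 - x3)) -[X in _ * X](subrr x4) -BE /Q /k /B /y4; ring.
have NE X : Q X ^+ 2 - k ^+ 2 * (X ^+ 3 + a * X + b) = A X * B X.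
  by rewrite hb /Q /k /A /B; ring.
have K1 : l * m + s - k * n = - (x1 + x3).
  have [e13|n13] := eqVneq x1 x3.
    have [ey y0] := hy e13.
    have dN : 2 * Q x1 * (2 * x1 + (l * m + s)) - k ^+ 2 * (3 * x1 ^+ 2 + a) =
        (2 * x1 - (l ^+ 2 - s)) * B x1 + A x1 * (2 * x1 - (m ^+ 2 - s)).
      by rewrite /Q /k /A /B; ring.
    move: dN; rewrite Q1 BE AE e13 !subrr !mul0r mulr0 addr0 -e13 -(htan e13).
    have -> : 2 * (k * y1) * (2 * x1 + (l * m + s)) - k ^+ 2 * (2 * y1 * n) =
       (2 * k * y1) * (l * m + s - k * n + (x1 + x1)) by ring.
    move/eqP; rewrite mulf_eq0 !mulf_eq0 (negPf y0) (negPf k0) /= => /eqP h.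
    by apply/eqP; rewrite -subr_eq0 opprK h.
  apply: (mulfI (x := x1 - x3)); first by rewrite subr_eq0.
  have -> : (x1 - x3) * (l * m + s - k * n) =
     Q x1 - Q x3 - k * ((n * x1 + e) - (n * x3 + e)) - (x1 - x3) * (x1 + x3) by rewrite /Q; ring.
  by rewrite Q1 Q3 hy1 hy3; ring.
have KE X : Q X = k * (n * X + e) + (X - x1) * (X - x3).
  have -> : Q X = Q x1 + (X - x1) * (X + x1 + (l * m + s - k * n) + k * n) by rewrite /Q; ring.
  by rewrite Q1 K1 hy1; ring.
have he' : b = e ^+ 2 - x1 * x3 * u by rewrite -he; ring.
have ha : a = 2 * n * e + (x1 * x3 + x1 * u + x3 * u) by rewrite -hn; ring.
have fE X : X ^+ 3 + a * X + b = (n * X + e) ^+ 2 + (X - x1) * (X - x3) * (X - u).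
  by rewrite he' ha /u; ring.
have s24 : x2 + x4 = k ^+ 2 - 2 * (k * n) + (x1 + x3).
  have -> : k * n = l * m + s + (x1 + x3) by rewrite -[LHS](subrK (k * n)) -[x1 + x3]opprK -K1; ring.
  by rewrite /x2 /x4 /k; ring.
have hA : a - 2 * l * (- t - l * s) - s * (l ^+ 2 - s) = x1 * x2 by rewrite h1 /x2; ring.
have hB : a - 2 * m * (t - m * s) - s * (m ^+ 2 - s) = x3 * x4 by rewrite h3 /x4; ring.
have q1 : l * m + s = k * n - (x1 + x3) by rewrite -K1; ring.
have q0 : Q 0 = k * e + x1 * x3 by rewrite KE; ring.
have p24 : x2 * x4 = k ^+ 2 * u + 2 * k * e + x1 * x3.
  have -> : x2 * x4 = x1 * x2 + x3 * x4 + (x1 + x2) * (x3 + x4) - x1 * x3 - (x1 + x3) * (x2 + x4) by ring.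
  have -> : x1 * x2 + x3 * x4 + (x1 + x2) * (x3 + x4) = (l * m + s) ^+ 2 + 2 * Q 0.
    by rewrite -hA -hB /x2 /x4 /Q /k; ring.
  by rewrite s24 q1 q0 /u; ring.
have quad X : X ^+ 2 - (x2 + x4) * X + x2 * x4 = (X - x1) * (X - x3) + 2 * k * (n * X + e) - k ^+ 2 * (X - u).
  by rewrite s24 p24; ring.
have d2 : (x2 - x1) * (x2 - x3) = k ^+ 2 * (x2 - u) - 2 * k * (n * x2 + e).
  by move: (quad x2) => /eqP; rewrite -subr_eq0 => /eqP h; rewrite -[LHS]addr0 -h; ring.
have d4 : (x4 - x1) * (x4 - x3) = k ^+ 2 * (x4 - u) - 2 * k * (n * x4 + e).
  by move: (quad x4) => /eqP; rewrite -subr_eq0 => /eqP h; rewrite -[LHS]addr0 -h; ring.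
split.
- by apply: (mulfI k0); rewrite -/k -Q2 KE d2; ring.
- by apply: (mulfI k0); rewrite -/k -Q4 KE d4; ring.
- by rewrite s24 /u; ring.
- have -> : x2 * x4 + x2 * u + x4 * u = x2 * x4 + (x2 + x4) * u by ring.
  by rewrite p24 s24 ha /u; ring.
by rewrite p24 he'; ring.
Qed.

Section GroupAssoc.
Variables a b : rat.
Hypothesis nonsing : 4 * a ^+ 3 + 27 * b ^+ 2 != 0.
Local Notation E := (shortW a b).
Local Notation col := (col a b).

(** Both hypotheses on [r] together say p1 + p2 + p3 + p4 = 0; the conclusion is the same relation
    for the pairing of p1 with p3 and p2 with p4, up to degenerate positions. *)
Lemma col_exchange p1 p2 p3 p4 r u : col p1 p2 (r.1, - r.2) -> col p3 p4 r -> col p1 p3 u ->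
  (exists q, col p2 p4 (q.1, - q.2) /\ col p1 p3 q) \/
  (p3 = (p1.1, - p1.2) /\ p4 = (p2.1, - p2.2)) \/ (p3 = (p2.1, - p2.2) /\ p4 = (p1.1, - p1.2)).
Proof.
move=> H12 H34 H13; have nn := col_neq_neg nonsing H13.
have on1 := col_on H13; have onr := col_on (col_rot (col_rot H34)).
case: p1 p2 p3 p4 r u H12 H34 H13 nn on1 onr => [x1 y1] [x2 y2] [x3 y3] [x4 y4] [s t] [u v].
case=> l [c /= [[h1 h2 h3] [h4 h5 h6]]].
case=> m [d /= [[g1 g2 g3] [g4 g5 g6]]].
case=> n [e /= [[f1 f2 f3] [f4 f5 f6]]] nn on1 onr.
have ec : c = - t - l * s by rewrite h3; ring.
have ed : d = t - m * s by rewrite g3; ring.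
have ex2 : x2 = l ^+ 2 - s - x1 by rewrite h4; ring.
have ex4 : x4 = m ^+ 2 - s - x3 by rewrite g4; ring.
have eu : u = n ^+ 2 - x1 - x3 by rewrite f4; ring.
(* If l + m = 0, the second line is the mirror image of the first, so it meets the curve in the
   opposite points. *)
have [k0|k0] := eqVneq (l + m) 0; [right | left].
  have em : m = - l by apply/eqP; rewrite -addr_eq0 addrC k0.
  have edc : d = - c by rewrite ec ed em; ring.
  have e34 : x3 + x4 = x1 + x2 by rewrite ex2 ex4 em; ring.
  have p34 : x3 * x4 = x1 * x2.
    have e1 : x1 * x2 = a - 2 * l * c - (x1 + x2) * s by rewrite h5; ring.
    have e2 : x3 * x4 = a - 2 * m * d - (x3 + x4) * s by rewrite g5; ring.
    by rewrite e1 e2 em edc e34; ring.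
  have : (x3 - x1) * (x3 - x2) = 0.
    have -> : (x3 - x1) * (x3 - x2) = x3 ^+ 2 - (x1 + x2) * x3 + x1 * x2 by ring.
    by rewrite -p34 -e34; ring.
  move/eqP; rewrite mulf_eq0 !subr_eq0 => /orP[]/eqP e3.
    have e4 : x4 = x2 by apply: (addrI x3); rewrite e34 e3; ring.
    by left; split; congr pair => //; rewrite ?g1 ?g2 ?h1 ?h2 em edc ?e3 ?e4; ring.
  have e4 : x4 = x1 by apply: (addrI x3); rewrite e34 e3; ring.
  by right; split; congr pair => //; rewrite ?g1 ?g2 ?h1 ?h2 em edc ?e3 ?e4; ring.
exists (u, v); split; last by exists n, e.
have hy1 : y1 = l * x1 - t - l * s by rewrite h1 ec; ring.
have hy3 : y3 = m * x3 + t - m * s by rewrite g1 ed; ring.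
have hy13 : x1 = x3 -> y1 = y3 /\ y1 != 0.
  move=> e13; have ey : y1 = y3 by rewrite f1 f2 e13.
  by split => //; apply/eqP => y0; apply: nn; rewrite -ey y0 oppr0 e13.
have [] := @exchange_lines a b l m s t x1 x3 n e.
- by rewrite onr.
- by rewrite -ec -ex2 h5.
- by rewrite -ed -ex4 g5.
- by rewrite -hy1.
- by rewrite -hy3.
- by rewrite -eu f5.
- by rewrite -eu f6.
- by [].
- rewrite -hy1 => e13; subst x3; apply: (@col_tangent a b (x1, y1) u n e) => //=.
- by rewrite -hy1 -hy3.
rewrite -ex2 -ex4 -eu => k1 k2 k3 k4 k5.
exists (l + m - n), (- (l + m) * u - e); split; split => //=.
- by rewrite -k1 h2 ec; ring.
- by rewrite -k2 g2 ed; ring.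
by rewrite f3; ring.
Qed.

Lemma pneg_shortK P : pneg E (pneg E P) = P.
Proof. by case: P => [[x y]|] //; rewrite !pneg_shortE opprK. Qed.

Lemma on_pneg P : on_curve E P -> on_curve E (pneg E P).
Proof. by case: P => [[x y]|] //; rewrite pneg_shortE !on_shortE sqrrN. Qed.

Lemma col_padd p q r : col p q r -> padd E (Some p) (Some q) = Some (r.1, - r.2).
Proof.
move=> H; have [[e _]|[r' [H' ->]]] := padd_shortP (col_on H) (col_on (colC H)).
  by have := col_neq_neg nonsing H.
by rewrite (col_uniq nonsing H H').
Qed.

Lemma padd_pneg p : padd E (Some p) (Some (p.1, - p.2)) = None.
Proof. by case: p => x y /=; rewrite !mul0r !addr0 eqxx subrr eqxx. Qed.

Lemma padd_on P Q : on_curve E P -> on_curve E Q -> on_curve E (padd E P Q).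
Proof.
case: P Q => [[x1 y1]|] [[x2 y2]|] // /on_shortE hp /on_shortE hq.
have [[_ ->]//|[r [H ->]]] := @padd_shortP _ _ (x1, y1) (x2, y2) hp hq.
by rewrite -(pneg_shortE a b); apply/on_pneg; case: r H => ? ? H; apply/on_shortE; apply: col_on (col_rot (col_rot H)).
Qed.

Lemma paddC_short P Q : on_curve E P -> on_curve E Q -> padd E P Q = padd E Q P.
Proof.
case: P Q => [[x1 y1]|] [[x2 y2]|] // /on_shortE hp /on_shortE hq.
have [[[-> ->] ->]|[r [H ->]]] := @padd_shortP _ _ (x1, y1) (x2, y2) hp hq.
  by have := padd_pneg (x1, - y1); rewrite [X in Some X]/= opprK => ->.
by rewrite (col_padd (colC H)).
Qed.

Lemma padd_cancel P Q R : on_curve E P -> on_curve E Q -> padd E P Q = pneg E R ->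
  padd E P R = pneg E Q.
Proof.
move=> hP hQ h; have -> : R = pneg E (padd E P Q) by rewrite h pneg_shortK.
case: P Q hP hQ {h} => [[x1 y1]|] [[x2 y2]|].
- move=> /on_shortE hp /on_shortE hq.
  have [[[-> ->] ->]|[r [H ->]]] := @padd_shortP _ _ (x1, y1) (x2, y2) hp hq.
    by rewrite pneg_shortE opprK.
  rewrite !pneg_shortE opprK -[Some (r.1, r.2)]/(Some _); case: r H => r1 r2 H.
  by rewrite (col_padd (colC (col_rot (col_rot H)))).
- by rewrite pneg_shortE (padd_pneg (x1, y1)).
- by [].
by [].
Qed.

Lemma padd_pneg_pneg P Q : on_curve E P -> on_curve E Q ->
  padd E (pneg E P) (pneg E Q) = pneg E (padd E P Q).
Proof.
case: P Q => [[x1 y1]|] [[x2 y2]|] //; rewrite ?pneg_shortE // => /on_shortE hp /on_shortE hq.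
have [[[-> ->] ->]|[r [H ->]]] := @padd_shortP _ _ (x1, y1) (x2, y2) hp hq.
  by rewrite (padd_pneg (x1, - y1)).
by rewrite (col_padd (col_neg H)) pneg_shortE.
Qed.
End GroupAssoc.

Section GroupStructure.
Variables a b : rat.
Hypothesis nonsing : 4 * a ^+ 3 + 27 * b ^+ 2 != 0.
Local Notation E := (shortW a b).

Lemma pneg_pair p : pneg E (Some p) = Some (p.1, - p.2).
Proof. by case: p => x y; rewrite pneg_shortE. Qed.

Lemma padd0 P : padd E P None = P. Proof. by case: P => [[]|]. Qed.

Lemma padd_inj P Q R : on_curve E P -> on_curve E Q -> on_curve E R ->
  padd E P Q = padd E P R -> Q = R.
Proof.
move=> hP hQ hR e; apply: (can_inj (@pneg_shortK a b)).
rewrite -(@padd_cancel _ _ nonsing P Q (pneg E (padd E P R))) ?pneg_shortK //.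
by apply: padd_cancel; rewrite ?pneg_shortK.
Qed.

(** The vanishing of a sum of four points is independent of how they are paired. Associativity is a
    formal consequence of this and of [padd_cancel]. *)
Lemma padd_exchange P1 P2 P3 P4 :
  on_curve E P1 -> on_curve E P2 -> on_curve E P3 -> on_curve E P4 ->
  padd E P1 P2 = pneg E (padd E P3 P4) -> padd E P1 P3 = pneg E (padd E P2 P4).
Proof.
move=> o1 o2 o3 o4 h; have h' : padd E P3 P4 = pneg E (padd E P1 P2) by rewrite h pneg_shortK.
case: P1 o1 h h' => [p1|] o1 h h'; last first.
  have e : padd E P4 P3 = pneg E P2 by rewrite paddC_short.
  by rewrite (paddC_short nonsing o2 o4) (padd_cancel nonsing o4 o3 e) pneg_shortK.
have [e2|nP2] := eqVneq P2 None.
  subst P2; rewrite padd0 in h'; rewrite (paddC_short nonsing o1 o3).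
  exact: (padd_cancel nonsing o3 o4 h').
case: P3 o3 h h' => [p3|] o3 h h'; last first.
  have e : padd E P2 (Some p1) = pneg E P4 by rewrite (paddC_short nonsing o2 o1).
  by rewrite (padd_cancel nonsing o2 o1 e) pneg_shortK padd0.
case: P4 o4 h h' => [p4|] o4 h h'; first last.
  by rewrite padd0 in h; rewrite padd0 (padd_cancel nonsing o1 o2 h).
case: P2 nP2 o2 h h' => [p2|] // _ o2 h h'.
have on p : on_curve E (Some p) -> p.2 ^+ 2 = cubic a b p.1 by case: p => ? ? /on_shortE.
have [[e2 n12]|[r1 [c1 s1]]] := padd_shortP (on _ o1) (on _ o2).
  have [[e4 n34]|[r2 [_ s2]]] := padd_shortP (on _ o3) (on _ o4); last by rewrite n12 s2 in h.
  rewrite e2 e4 -!pneg_pair padd_pneg_pneg ?pneg_shortK //.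
have [[e4 n34]|[r2 [c2 s2]]] := padd_shortP (on _ o3) (on _ o4); first by rewrite n34 s1 in h.
have [[e3 n13]|[u [c3 s3]]] := padd_shortP (on _ o1) (on _ o3).
  rewrite n13; suff -> : Some p2 = pneg E (Some p4).
    by case: p4 {h h' o4 s2 c2} => x y; have := padd_pneg a b (x, - y); rewrite pneg_shortE [X in Some X]/= opprK => ->.
  apply: (padd_inj o1 o2 (on_pneg o4)); rewrite h e3 -pneg_pair.
  by rewrite -padd_pneg_pneg ?pneg_shortK //; apply: on_pneg.
have er : r1 = (r2.1, - r2.2).
  by move: h; rewrite s1 s2 pneg_shortE opprK => -[]; case: (r1) => ? ? /= -> /(canRL opprK) ->.
rewrite er in c1.
have [[q [cq c']]|[[e3 e4]|[e3 e4]]] := col_exchange nonsing c1 c2 c3.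
- by rewrite (col_padd nonsing c') (col_padd nonsing cq) pneg_shortE opprK.
- by have := col_neq_neg nonsing c3.
rewrite e3 e4 -!pneg_pair -(padd_pneg_pneg nonsing o2 (on_pneg o1)) pneg_shortK.
exact: paddC_short o1 (on_pneg o2).
Qed.

Lemma paddA_short P Q R : on_curve E P -> on_curve E Q -> on_curve E R ->
  padd E P (padd E Q R) = padd E (padd E P Q) R.
Proof.
move=> hP hQ hR; have hPQ := padd_on hP hQ; have hQR := padd_on hQ hR.
set S := RHS; have hS : on_curve E S by exact: padd_on.
have e0 : padd E R (padd E P Q) = pneg E (pneg E S).
  by rewrite pneg_shortK /S; exact: paddC_short.
(* The four points to exchange are Q, P, R and -S, where S = (P + Q) + R. *)
have e : padd E Q P = pneg E (padd E R (pneg E S)).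
  by rewrite (padd_cancel nonsing hR hPQ e0) pneg_shortK; exact: paddC_short.
have e' := padd_exchange hQ hP hR (on_pneg hS) e.
have e1 : padd E P (pneg E S) = pneg E (padd E Q R) by rewrite e' pneg_shortK.
by rewrite (padd_cancel nonsing hP (on_pneg hS) e1) pneg_shortK.
Qed.
End GroupStructure.

(** * The points of a short curve as an abelian group *)

Definition on_curveb (E : wmodel) (P : point) : bool :=
  if P is Some (x, y) then y ^+ 2 + wa1 E * x * y + wa3 E * y
      == x ^+ 3 + wa2 E * x ^+ 2 + wa4 E * x + wa6 E else true.

Lemma on_curveP E P : reflect (on_curve E P) (on_curveb E P).
Proof. by case: P => [[x y]|] /=; [exact: eqP | exact: ReflectT]. Qed.

(* The nonsingularity proof is a phantom argument: the group structure on the type depends on it. *)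
Record ecpt (a b : rat) (ns : 4 * a ^+ 3 + 27 * b ^+ 2 != 0) := ECPt {
  ecval : point;
  ecvalP : on_curveb (shortW a b) ecval }.

Section ECZmod.
Variables (a b : rat) (ns : 4 * a ^+ 3 + 27 * b ^+ 2 != 0).
Local Notation E := (shortW a b).
Local Notation G := (ecpt ns).

HB.instance Definition _ := [isSub for @ecval a b ns].
HB.instance Definition _ := [Choice of G by <:].

Lemma ec_on (P : G) : on_curve E (ecval P). Proof. exact/on_curveP/ecvalP. Qed.

Definition ec_mk P (h : on_curve E P) : G := ECPt ns (introT (on_curveP E P) h).
Definition ec_zero : G := @ec_mk None I.
Definition ec_opp (P : G) : G := ec_mk (on_pneg (ec_on P)).
Definition ec_add (P Q : G) : G := ec_mk (padd_on (ec_on P) (ec_on Q)).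

Lemma ec_addA : associative ec_add.
Proof. by move=> P Q R; apply: val_inj; apply: paddA_short => //; exact: ec_on. Qed.
Lemma ec_addC : commutative ec_add.
Proof. by move=> P Q; apply: val_inj; apply: paddC_short => //; exact: ec_on. Qed.
Lemma ec_add0 : left_id ec_zero ec_add.
Proof. by move=> P; apply: val_inj. Qed.
Lemma ec_addN : left_inverse ec_zero ec_opp ec_add.
Proof.
move=> P; apply: val_inj => /=.
rewrite (paddC_short ns (on_pneg (ec_on P)) (ec_on P)).
by case: (ecval P) => [p|] //; rewrite pneg_pair padd_pneg.
Qed.

HB.instance Definition _ := GRing.isZmodule.Build G ec_addA ec_addC ec_add0 ec_addN.

Lemma ecvalD (P Q : G) : ecval (P + Q) = padd E (ecval P) (ecval Q). Proof. by []. Qed.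
Lemma ecvalN (P : G) : ecval (- P) = pneg E (ecval P). Proof. by []. Qed.
Lemma ecval_inj : injective (@ecval a b ns). Proof. exact: val_inj. Qed.

Lemma ecvalMn (P : G) n : ecval (P *+ n) = pmul E n (ecval P).
Proof. by elim: n => [|n IH]; rewrite ?mulr0n // mulrS ecvalD IH. Qed.

End ECZmod.

(** * Counting points in a group of bounded rank *)

Lemma choice_fun (A B : Type) (P : A -> B -> Prop) :
  (forall x, exists y, P x y) -> exists f, forall x, P x (f x).
Proof.
move=> h; pose f x := ClassicalEpsilon.constructive_indefinite_description _ (h x).
by exists (fun x => proj1_sig (f x)) => x; exact: (proj2_sig (f x)).
Qed.

Section QuadraticCounting.
Local Open Scope R_scope.
Variables (G : zmodType) (q : G -> R) (r : nat) (m : R).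
Hypothesis q_ge0 : forall x, 0 <= q x.
Hypothesis q_par : forall x y : G, q (x + y)%ri + q (x - y)%ri = 2 * q x + 2 * q y.
Hypothesis q_rank : forall f : 'I_r.+1 -> G, exists n : 'I_r.+1 -> int,
  (exists i, n i <> 0%ri) /\ (\sum_(i < r.+1) f i *~ n i)%ri = 0%ri.
Hypothesis m_gt0 : 0 < m.
Hypothesis q_gap : forall x, q x = 0 \/ m <= q x.

Lemma q0 : q 0%ri = 0.
Proof. by have := q_par 0%ri 0%ri; rewrite addr0 subr0; lra. Qed.

Lemma qN x : q (- x)%ri = q x.
Proof. by have := q_par 0%ri x; rewrite add0r sub0r q0; lra. Qed.

Lemma qBC x y : q (x - y)%ri = q (y - x)%ri.
Proof. by rewrite -qN opprB. Qed.

Lemma qD_le x y : q (x + y)%ri <= 2 * q x + 2 * q y.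
Proof. by have := q_par x y; have := q_ge0 (x - y)%ri; lra. Qed.

Lemma qB_le x y : q (x - y)%ri <= 2 * q x + 2 * q y.
Proof. by have := qD_le x (- y)%ri; rewrite qN. Qed.

Lemma qBD_le x y z : q (x - z)%ri <= 2 * q (x - y)%ri + 2 * q (y - z)%ri.
Proof. by have := qD_le (x - y)%ri (y - z)%ri; rewrite addrA subrK. Qed.

Lemma q_double x : q (x *+ 2)%ri = 4 * q x.
Proof. by have := q_par x x; have -> : (x + x = x *+ 2)%ri by []; rewrite subrr q0; lra. Qed.

Lemma q_pow2 t x : q (x *+ expn 2 t)%ri = 4 ^ t * q x.
Proof.
elim: t => [|t IH]; first by rewrite mulr1n /=; lra.
by rewrite expnS mulnC mulrnA q_double IH /=; lra.
Qed.

Lemma q_null_sub x y : q (x - y)%ri = 0 -> q x <= 2 * q y.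
Proof. by move=> h; have := qD_le (x - y)%ri y; rewrite subrK h; lra. Qed.

Lemma q_nullD x y : q x = 0 -> q y = 0 -> q (x + y)%ri = 0.
Proof. by move=> hx hy; have := qD_le x y; have := q_ge0 (x + y)%ri; lra. Qed.

Lemma q_nullN x : q x = 0 -> q (- x)%ri = 0.
Proof. by rewrite qN. Qed.

(** Divisibility by 2 modulo the kernel of [q]. Elements with [q] = 0 stand for torsion, which the
    rank does not control. *)
Definition null2 (x : G) := exists w : G, q (x - w *+ 2)%ri = 0.
Definition sel (f : nat -> G) (e : nat -> bool) s : G := (\sum_(i < s) f i *+ e i)%ri.

(** Linear independence over the field with two elements, in G modulo 2 G and the kernel of [q]. *)
Definition indep2 s (f : nat -> G) :=
  forall e : nat -> bool, null2 (sel f e s) -> forall i, (i < s)%nt -> e i = false.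

(** Halving all entries while they are even decreases the sum of absolute values. It makes an
    integer relation nontrivial modulo 2. *)
Lemma common_pow2 k (n : 'I_k -> int) : (exists i, n i <> 0%ri) ->
  exists t n', (forall i, n i = n' i * (expn 2 t)%:Z)%ri /\ exists i, odd (absz (n' i)).
Proof.
move=> [i0 hi0]; have : (exists i, absz (n i) != 0%nt) by exists i0; rewrite absz_eq0; apply/eqP.
have [N] := ubnP (\sum_i absz (n i))%nt; elim: N n {i0 hi0} => // N IH n hN hn.
have [/existsP[i hi]|/existsPn ev] := boolP [exists i, odd (absz (n i))].
  by exists 0%nt, n; split; [move=> j; rewrite mulr1 | exists i].
pose n' i := divz (n i) 2%ri.
have en i : n i = (n' i * 2)%ri.
  have : n i \in dvdz 2%ri by rewrite dvdzE /= dvdn2.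
  by move=> /divzK; rewrite /n' => ->.
have ea i : absz (n i) = (absz (n' i) * 2)%nt by rewrite en abszM.
have [i hi] := hn.
have [||t [n'' [h1 h2]]] := IH n'.
- have lt1 : (\sum_i absz (n' i) < \sum_i absz (n i))%nt.
    rewrite (bigD1 i) //= [X in (_ < X)%nt](bigD1 i) //=.
    have : (\sum_(j < k | j != i) absz (n' j) <= \sum_(j < k | j != i) absz (n j))%nt.
      by apply: leq_sum => j _; rewrite ea leq_pmulr.
    rewrite ea; move: hi; rewrite ea => hi hle; rewrite -addSn leq_add //.
    by rewrite muln2 -addnn -addn1 leq_add2l; case: (absz _) hi.
  by apply: leq_trans lt1 _.
- by exists i; move: hi; rewrite ea; case: (absz _).
exists t.+1, n''; split => // j.
by rewrite en h1 expnSr PoszM mulrA.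
Qed.

(** A relation among r + 1 elements is 2^t times one with an odd coefficient. The latter combination
    S satisfies 2^t S = 0, hence [q] S = 0, and its reduction modulo 2 contradicts independence. *)
Lemma indep2_le s f : indep2 s f -> (s <= r)%nt.
Proof.
move=> hf; case: leqP => // hs.
have [n [hn hsum]] := q_rank (fun i => f i).
have [t [n' [hn' [i0 hi0]]]] := common_pow2 hn.
(* The default [false] at indices above r lets the same selection be summed over [s] or over [r.+1]
   terms. *)
pose e i := if insub i is Some j then odd (absz (n' (j : 'I_r.+1))) else false.
have ee (j : 'I_r.+1) : e j = odd (absz (n' j)) by rewrite /e valK.
suff : e i0 = false by rewrite ee hi0.
apply: hf; last by apply: leq_trans (ltn_ord i0) _.
pose S : G := (\sum_(i < r.+1) f i *~ n' i)%ri.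
have hS : q S = 0.
  have e0 : (S *+ expn 2 t = 0)%ri.
    rewrite -hsum /S -sumrMnl; apply: eq_bigr => i _.
    by rewrite hn' mulrzA pmulrn.
  have := q_pow2 t S; rewrite e0 q0 => /esym/Rmult_integral [h|//].
  by have := pow_lt 4 t; lra.
have odd_half z : exists w : int, (z = (odd (absz z))%:Z + w *+ 2)%ri.
  case: z => k; first by exists (Posz k./2); rewrite /= -mulr_natr; have := odd_double_half k; lia.
  exists (- Posz (uphalf k.+1))%ri; rewrite NegzE [absz _]/= -mulr_natr.
  by have := odd_double_half k.+1; have := uphalf_half k.+1; lia.
have [w hw] : exists w : G, (S = sel f e r.+1 + w *+ 2)%ri.
  have [g hg] : exists g : 'I_r.+1 -> int, forall i, (n' i = (odd (absz (n' i)))%:Z + g i *+ 2)%ri.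
    by apply: (fin_all_exists (fun i => odd_half (n' i))).
  exists (\sum_(i < r.+1) f i *~ g i)%ri; rewrite -sumrMnl -big_split /=.
  apply: eq_bigr => i _; rewrite ee {1}hg mulrzDr; congr (_ + _)%ri.
  by rewrite -mulr_natr mulrzA pmulrn.
have -> : sel f e s = sel f e r.+1.
  have -> : s = (r.+1 + (s - r.+1))%nt by rewrite subnKC.
  rewrite /sel big_split_ord /= [X in (_ + X)%ri]big1 ?addr0 // => i _.
  by rewrite /e insubF // ltnNge leq_addr.
exists (- w)%ri; rewrite mulNrn opprK -hw; exact: hS.
Qed.

Lemma indep2_spanning : exists s f, (s <= r)%nt /\
  forall x, exists (e : nat -> bool), null2 (x - sel f e s)%ri.
Proof.
apply: NNPP => hno.
suff ex s : exists f, indep2 s f by have [f /indep2_le] := ex r.+1; rewrite ltnn.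
elim: s => [|s [f hf]]; first by exists (fun=> 0%ri) => e _ i; rewrite ltn0.
have [x hx] : exists x, ~ exists (e : nat -> bool), null2 (x - sel f e s)%ri.
  apply: NNPP => h; apply: hno; exists s, f; split; first exact: indep2_le hf.
  by move=> x; apply: NNPP => h'; apply: h; exists x.
exists (fun i => if i == s then x else f i) => e [w].
have -> : sel (fun i => if i == s then x else f i) e s.+1 = (sel f e s + x *+ e s)%ri.
  rewrite /sel big_ord_recr /= eqxx; congr (_ + _)%ri.
  by apply: eq_bigr => i _; rewrite ltn_eqF.
case es : (e s) => h.
  (* Modulo 2 the sum of x and [sel f e s] agrees with their difference; the half shifts by
     [sel f e s]. *)
  case: hx; exists e, (w - sel f e s)%ri.
  have -> // : (x - sel f e s - (w - sel f e s) *+ 2 = sel f e s + x *+ true - w *+ 2)%ri.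
  rewrite mulrnBl mulr1n opprB [(sel f e s *+ 2)%ri]mulr2n !addrA; congr (_ - _)%ri.
  by rewrite addrAC subrK addrC; congr (_ + _)%ri; rewrite addrC.
move=> i; rewrite ltnS leq_eqVlt => /orP[/eqP -> //|]; apply: (hf e).
by exists w; move: h; rewrite mulr0n addr0.
Qed.

(** A concrete form of the quotient G / k G: [c] names the class and [lam] is a division by k
    relative to a representative of the class. Only differences of values of [lam] within one class
    are meaningful, and only modulo the kernel of [q]. *)
Definition sameclass (T : Type) (c : G -> T) (lam : G -> G) k := forall x y, c x = c y ->
  q (x - y - (lam x - lam y) *+ k)%ri = 0.

Lemma classes2 : exists (T : finType) (c : G -> T) lam, (#|T| <= expn 2 r)%nt /\ sameclass c lam 2.
Proof.
have [s [f [hs hspan]]] := indep2_spanning.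
have [e he] := choice_fun hspan.
have [w hw] := choice_fun he.
exists {ffun 'I_s -> bool}, (fun x => [ffun i : 'I_s => e x i]), w; split.
  by rewrite card_ffun card_bool card_ord leq_pexp2l.
move=> x y /ffunP h.
have es : sel f (e x) s = sel f (e y) s.
  by apply: eq_bigr => i _; have := h i; rewrite !ffunE => ->.
have -> : (x - y - (w x - w y) *+ 2 =
    (x - sel f (e x) s - w x *+ 2) - (y - sel f (e y) s - w y *+ 2))%ri.
  have swap a b c d : (a - b - (c - d) = a - c - (b - d) :> G)%ri.
    by rewrite !opprD !opprK addrACA.
  by rewrite es mulrnBl [RHS]swap [(_ - (y - _))%ri]swap subrr subr0.
by rewrite q_nullD ?q_nullN.
Qed.

(** Classes modulo 2^t are read off digit by digit: the class of x modulo 2, then the classes of its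
    quotient [lam1 x]. Each digit has at most 2^r values, whence the exponent r t throughout. *)
Lemma classes_pow2 t : exists (T : finType) (c : G -> T) lam,
  (#|T| <= expn 2 (r * t))%nt /\ sameclass c lam (expn 2 t).
Proof.
elim: t => [|t [T [c [lam [hT hc]]]]].
  exists unit, (fun=> tt), (fun x => x); split; first by rewrite card_unit muln0.
  by move=> x y _; rewrite mulr1n subrr q0.
have [T1 [c1 [lam1 [hT1 hc1]]]] := classes2.
exists (T1 * T)%type, (fun x => (c1 x, c (lam1 x))), (lam \o lam1); split.
  by rewrite card_prod mulnS expnD leq_mul.
move=> x y [h1 h2].
have -> : (x - y - ((lam \o lam1) x - (lam \o lam1) y) *+ expn 2 t.+1 =
  (x - y - (lam1 x - lam1 y) *+ 2) +
  (lam1 x - lam1 y - (lam (lam1 x) - lam (lam1 y)) *+ expn 2 t) *+ 2)%ri.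
  by rewrite [X in (_ = _ + X)%ri]mulrnBl addrA subrK -mulrnA mulnC -expnS.
by rewrite q_nullD ?q_double ?hc ?hc1 //; lra.
Qed.

Lemma pigeonhole (T : finType) (A : Type) (c : A -> T) (s : list A) n :
  (forall v, (size [seq x <- s | c x == v] <= n)%nt) -> (size s <= #|T| * n)%nt.
Proof.
move=> h; have -> : size s = (\sum_(v : T) size [seq x <- s | c x == v])%nt.
  elim: s {h} => [|x s IH] /=; first by rewrite big1.
  rewrite IH (bigD1 (c x)) //= [in RHS](bigD1 (c x)) //= eqxx /= addSn; congr (_ + _).+1%nt.
  by apply: eq_bigr => v; rewrite eq_sym => /negPf ->.
by rewrite -sum_nat_const; apply: leq_sum.
Qed.

(** This is the square of a seminorm distance, so its triangle inequality carries a factor 2. *)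
Definition qd (x y : G) : R := q (x - y)%ri.
Definition apart (h : R) (x y : G) : bool := if Rle_dec h (qd x y) then true else false.

Lemma apartP h x y : reflect (h <= qd x y) (apart h x y).
Proof. by rewrite /apart; case: Rle_dec => H; constructor. Qed.

Lemma qd_le x y : qd x y <= 2 * q x + 2 * q y.
Proof. exact: qB_le. Qed.

Lemma qd_gap x y : qd x y = 0 \/ m <= qd x y.
Proof. exact: q_gap. Qed.

Lemma qd_trans x y z : qd x z <= 2 * qd x y + 2 * qd y z.
Proof. exact: qBD_le. Qed.

Lemma qdC x y : qd x y = qd y x.
Proof. exact: qBC. Qed.

Lemma qd_addl x b b' : qd (x + b)%ri (x + b')%ri = qd b b'.
Proof. by rewrite /qd opprD addrACA subrr add0r. Qed.

Lemma qd_addr x y b : qd (x + b)%ri (y + b)%ri = qd x y.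
Proof. by rewrite [(x + b)%ri]addrC [(y + b)%ri]addrC qd_addl. Qed.

(** Division by 2^k inside a class scales [qd] by 4^-k; the factor 2 pays for the null element by
    which the division is inexact. *)
Lemma qd_same T (c : G -> T) lam k x y : sameclass c lam (expn 2 k) -> c x = c y ->
  qd x y <= 2 * (4 ^ k * qd (lam x) (lam y)) /\ 4 ^ k * qd (lam x) (lam y) <= 2 * qd x y.
Proof.
move=> h /h h0; rewrite /qd -!q_pow2; split; first exact: q_null_sub h0.
by apply: q_null_sub; rewrite qBC.
Qed.

Lemma apart_m x y : qd x y <> 0 -> apart m x y.
Proof. by move=> h; apply/apartP; case: (q_gap (x - y)%ri). Qed.

Lemma pairwise_class (A : eqType) (T : finType) (c : A -> T) (e : rel A) (s : list A) v :
  (forall x y, x \in s -> y \in s -> c x = c y -> e x y = false) -> pairwise e s ->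
  (size [seq x <- s | c x == v] <= 1)%nt.
Proof.
move=> he hs; have hp : pairwise e [seq x <- s | c x == v] by rewrite pairwise_filter.
have hv x : x \in [seq x <- s | c x == v] -> c x = v /\ x \in s.
  by rewrite mem_filter => /andP[/eqP].
case: [seq _ <- _ | _] hp hv => [|x [|y s']] //= /andP[/andP[hxy _] _] hv.
have [hx hxs] := hv x (mem_head _ _).
have [|hy hys] := hv y; first by rewrite !inE eqxx orbT.
by rewrite he // ?hx ?hy in hxy.
Qed.

(** A class modulo 2^t contains at most one element of the list: the quotients of two would be at
    distance at least m by the gap, so 4^t m <= 2 [qd] x y, whereas [qd] is at most 4 H in the
    ball. *)
Lemma packing t H (s : list G) : 8 * H < 4 ^ t * m -> (forall x, x \in s -> q x <= H) ->
  pairwise (apart m) s -> (size s <= expn 2 (r * t))%nt.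
Proof.
move=> hH hs hp; have [T [c [lam [hT hc]]]] := classes_pow2 t.
apply: leq_trans hT; rewrite -[#|T|]muln1; apply: (pigeonhole (c := c)) => v.
apply: pairwise_class hp => x y hx hy hxy; apply/apartP => hm.
have [h1 h2] := qd_same hc hxy.
have h3 := qd_le x y; have h4 := hs x hx; have h5 := hs y hy; have h6 := pow_lt 4 t.
case: (qd_gap (lam x) (lam y)) => h7; first by rewrite h7 in h1; lra.
have : 4 ^ t * m <= 4 ^ t * qd (lam x) (lam y) by apply: Rmult_le_compat_l; lra.
lra.
Qed.

(** Inside a class, dividing by 2^t and recentring at one element maps a ball of radius K h into one
    of radius h. Because nonzero distances are at least m, the quotients remain [apart] at the same
    scale m. *)
Lemma ball_ratio t h K n : 8 * K <= 4 ^ t -> 0 <= h ->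
  (forall s : list G, pairwise (apart m) s -> (forall x, x \in s -> q x <= h) -> (size s <= n)%nt) ->
  forall s : list G, pairwise (apart m) s -> (forall x, x \in s -> q x <= K * h) ->
  (size s <= expn 2 (r * t) * n)%nt.
Proof.
move=> hK hh hn s hp hs; have [T [c [lam [hT hc]]]] := classes_pow2 t.
apply: leq_trans (leq_mul hT (leqnn n)); apply: (pigeonhole (c := c)) => v.
have : pairwise (apart m) [seq x <- s | c x == v] by rewrite pairwise_filter.
have hv x : x \in [seq x <- s | c x == v] -> c x = v /\ x \in s.
  by rewrite mem_filter => /andP[/eqP].
case: [seq _ <- _ | _] hv => [|x0 L] // hv hL.
rewrite -(size_map (fun x => (lam x - lam x0)%ri)); apply: hn.
  rewrite pairwise_map; have [h0 _] := hv x0 (mem_head _ _).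
  have hcl x : x \in x0 :: L -> c x = v by case/hv.
  move: hL hcl; elim: (x0 :: L) => //= y L' IH /andP[/allP hy hL] hcl.
  rewrite IH //; last by move=> x hx; apply: hcl; rewrite inE hx orbT.
  rewrite andbT; apply/allP => x hx; apply: apart_m => hz.
  have hxy : c y = c x by rewrite !hcl ?inE ?eqxx ?hx ?orbT.
  have [h1 _] := qd_same hc hxy.
  move: hz; rewrite qd_addr => hz; rewrite hz in h1.
  by have /apartP := hy x hx; lra.
move=> _ /mapP[x hx ->]; have [hxv hxs] := hv x hx; have [h0 h0s] := hv x0 (mem_head _ _).
have [_ h1] := qd_same hc (etrans hxv (esym h0)).
have h2 := qd_le x x0; have h3 := hs x hxs; have h4 := hs x0 h0s.
have h5 : 4 ^ t * qd (lam x) (lam x0) <= 4 ^ t * h.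
  have h6 : 8 * K * h <= 4 ^ t * h by apply: Rmult_le_compat_r; lra.
  lra.
by apply: Rmult_le_reg_l h5; apply: pow_lt; lra.
Qed.

Lemma max_list (A : Type) (P : list A -> Prop) N : P [::] -> (forall s, P s -> (size s <= N)%nt) ->
  exists s, P s /\ forall s', P s' -> (size s' <= size s)%nt.
Proof.
move=> h0 hN; apply: NNPP => hno.
suff ex n : exists s, P s /\ (n <= size s)%nt.
  by have [s [hs]] := ex N.+1; rewrite leqNgt ltnS hN.
elim: n => [|n [s [hs hn]]]; first by exists [::].
apply: NNPP => h; apply: hno; exists s; split => // s' hs'.
rewrite leqNgt; apply/negP => hlt; apply: h; exists s'; split => //.
by apply: leq_ltn_trans hlt.
Qed.

(* Volume argument: translating a maximal list B of pairwise apart elements of a small ball by the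
   elements of M gives size M * size B pairwise apart elements of a ball of comparable radius. *)
Lemma separated_bound t H sigma (M : list G) : 0 < sigma -> 256 * H + 16 * sigma <= 4 ^ t * sigma ->
  pairwise (apart sigma) M -> (forall x, x \in M -> q x <= H) -> (size M <= expn 2 (r * t))%nt.
Proof.
(* Elements of the small ball are at distance at most 4 h. The factor 2 of the triangle inequality
   makes this 8 h < sigma, so translates by different elements of M cannot meet. *)
move=> hs ht hM hH; pose h := sigma / 16.
pose P (s : list G) := pairwise (apart m) s /\ forall x, x \in s -> q x <= h.
(* Here t1 depends on h / m and serves to make a list of maximal size exist; it cancels from the
   final bound together with the size of B. *)
have [t1 ht1] : exists t1, 8 * h < 4 ^ t1 * m.
  have [t1 ht1] := Pow_x_infinity 4 ltac:(rewrite Rabs_right; lra) (8 * h / m + 1).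
  exists t1; have := ht1 t1 (le_n _); rewrite Rabs_right; last by apply: Rle_ge; apply: pow_le; lra.
  move=> /Rge_le h1; have : (8 * h / m + 1) * m <= 4 ^ t1 * m by apply: Rmult_le_compat_r; lra.
  have -> : (8 * h / m + 1) * m = 8 * h + m by Rfield; lra.
  lra.
have [||B [[hB1 hB2] hmax]] := @max_list G P (expn 2 (r * t1)).
- by split.
- by move=> s [h1 h2]; apply: packing ht1 h2 h1.
have B0 : (0 < size B)%nt.
  by apply: (hmax [:: 0%ri]); split => // x; rewrite inE => /eqP ->; rewrite q0 /h; lra.
rewrite -(leq_pmul2r B0).
(* The translates lie in the ball of radius 2 H + 2 h = K h, and 8 K <= 4^t is the hypothesis on
   t. *)
pose K := 32 * H / sigma + 2.
have eK : K * h = 2 * H + 2 * h by rewrite /K /h; Rfield; lra.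
have hK : 8 * K <= 4 ^ t.
  apply: (Rmult_le_reg_r sigma) => //; have -> : 8 * K * sigma = 256 * H + 16 * sigma by rewrite /K; Rfield; lra.
  lra.
have h0 : 0 <= h by rewrite /h; lra.
rewrite -(size_allpairs (fun x b => x + b)%ri).
apply: (ball_ratio hK h0 _ (s := [seq (x + b)%ri | x <- M, b <- B])) => [s h1 h2||].
- by apply: hmax.
- elim: M hM {hH} => //= x M IH /andP[/allP hx hM].
  rewrite pairwise_cat IH // andbT; apply/andP; split.
    apply/allrelP => _ _ /mapP[b hb ->] /allpairsP[[y b'] /= [hy hb' ->]].
    apply: apart_m => hz; have /apartP hxy := hx y hy.
    pose w := (y + b' - b)%ri; have h2 := qd_trans x w y.
    have e1 : qd x w = 0 by rewrite -(qd_addr x w b) /w subrK.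
    have e2 : qd w y = qd b' b by rewrite /qd /w addrAC [(y + b')%ri]addrC addrK.
    have h3 := qd_le b' b; have h4 := hB2 _ hb; have h5 := hB2 _ hb'.
    rewrite e1 e2 in h2.
    by rewrite /h in h4 h5; lra.
  rewrite pairwise_map; move: hB1; apply: sub_pairwise => b b' /apartP hb.
  by apply/apartP; rewrite qd_addl.
move=> _ /allpairsP[[y b'] /= [hy hb' ->]].
by have := qD_le y b'; have := hH y hy; have := hB2 _ hb'; lra.
Qed.

(** Greedy selection: if two later points are near the first one, these three form a cluster;
    otherwise keeping the first point costs at most one near point, so at least half of the points
    survive. *)
Lemma separated_or_cluster sigma (P : nat -> G) (s : list nat) : 0 < sigma -> uniq s ->
  (exists i j k, [/\ i \in s, j \in s & k \in s] /\ [/\ i <> j, i <> k & j <> k] /\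
     [/\ qd (P i) (P j) <= 4 * sigma, qd (P i) (P k) <= 4 * sigma & qd (P j) (P k) <= 4 * sigma]) \/
  exists M : list nat, [/\ subseq M s, pairwise (apart sigma) (map P M) & (size s <= (size M).*2)%nt].
Proof.
move=> hs; have [n] := ubnP (size s); elim: n s => // n IH [|x s] hn hu; first by right; exists [::].
have {hu} /andP[hx hu] := hu.
pose far := [pred y | apart sigma (P x) (P y)].
have [near2|near1] := ltnP 1 (count (predC far) s).
  left; move: near2; rewrite -size_filter; case eL : (filter (predC far) s) => [|y [|z L]] // _.
  have hy : y \in filter (predC far) s by rewrite eL mem_head.
  have hz : z \in filter (predC far) s by rewrite eL !inE eqxx orbT.
  have : uniq (filter (predC far) s) by rewrite filter_uniq.
  rewrite eL /= inE negb_or => /andP[/andP[/eqP yz _] _].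
  move: hy hz; rewrite !mem_filter /= => /andP[/apartP hy ys] /andP[/apartP hz zs].
  exists x, y, z; rewrite !inE eqxx ys zs !orbT; split=> //; split.
    by split=> // e; move: hx; rewrite e ?ys ?zs.
  have := qd_trans (P y) (P x) (P z); rewrite (qdC (P y) (P x)).
  by split; lra.
have hsz : (size s <= (size (filter far s)).+1)%nt.
  by rewrite -(count_predC far s) size_filter -addn1 leq_add2l.
have [|||[M [hM hp hsM]]] := IH (filter far s).
- by apply: leq_ltn_trans (size_subseq (filter_subseq _ _)) _.
- by rewrite filter_uniq.
- move=> [i [j [k [[hi hj hk] h]]]]; left; exists i, j, k; split => //.
  by move: hi hj hk; rewrite !mem_filter !inE => /andP[_ ->] /andP[_ ->] /andP[_ ->]; rewrite !orbT.
right; exists (x :: M); split.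
- by rewrite /= eqxx; apply: subseq_trans hM (filter_subseq _ _).
- rewrite /= hp andbT; apply/allP => _ /mapP[y /(mem_subseq hM) hy ->].
  by move: hy; rewrite mem_filter => /andP[].
by rewrite /= doubleS !ltnS; apply: leq_trans hsz _; rewrite ltnS.
Qed.

Lemma cluster t H sigma (P : nat -> G) (s : list nat) :
  0 < sigma -> 256 * H + 16 * sigma <= 4 ^ t * sigma ->
  uniq s -> (forall i, i \in s -> q (P i) <= H) -> ((expn 2 (r * t)).*2 < size s)%nt ->
  exists i j k, [/\ i \in s, j \in s & k \in s] /\ [/\ i <> j, i <> k & j <> k] /\
     [/\ qd (P i) (P j) <= 4 * sigma, qd (P i) (P k) <= 4 * sigma & qd (P j) (P k) <= 4 * sigma].
Proof.
move=> hs ht hu hH hsz; have [//|[M [hM hp hsM]]] := separated_or_cluster P hs hu.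
have : (size (map P M) <= expn 2 (r * t))%nt.
  by apply: (separated_bound hs ht hp) => _ /mapP[i /(mem_subseq hM) hi ->]; exact: hH.
by rewrite size_map -leq_double; move: hsz hsM; lia.
Qed.
End QuadraticCounting.

(** * Heights *)

Section PolynomialBounds.
Variables T H : int.
Hypotheses (T1 : 1 <= T) (H1 : 1 <= H).

(** Size bookkeeping for forms: i bounds the degree in the curve coefficients, while the degree j in
    the variables is kept exact, the forms being homogeneous. The inequality is sealed in a
    [Variant] so that the indices can be computed by unification. *)
Variant bd (c i j : nat) (x : int) : Prop := Bd of `|x| <= c%:Z * T ^+ i * H ^+ j.

Lemma bdE c i j x : bd c i j x -> `|x| <= c%:Z * T ^+ i * H ^+ j.
Proof. by case. Qed.

Lemma bdW c c' i i' j x : (c <= c')%nt -> (i <= i')%nt -> bd c i j x -> bd c' i' j x.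
Proof.
move=> hc hi /bdE h; constructor; apply: le_trans h _; have T0 : 0 <= T by apply: le_trans T1.
have H0 : 0 <= H by apply: le_trans H1.
apply: ler_wpM2r; first exact: exprn_ge0.
apply: ler_pM; rewrite ?ler0n ?exprn_ge0 //.
by apply: ler_weXn2l.
Qed.

Lemma bdN c i j x : bd c i j x -> bd c i j (- x).
Proof. by case=> h; constructor; rewrite normrN. Qed.

Lemma bdD c c' i i' j x y : bd c i j x -> bd c' i' j y -> bd (c + c') (maxn i i') j (x + y).
Proof.
move=> hx hy; constructor; apply: le_trans (ler_normD _ _) _.
have [hx'] : bd c (maxn i i') j x by apply: bdW hx; rewrite ?leq_maxl.
have [hy'] : bd c' (maxn i i') j y by apply: bdW hy; rewrite ?leq_maxr.
by rewrite PoszD !mulrDl lerD.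
Qed.

Lemma bdM c c' i i' j j' x y : bd c i j x -> bd c' i' j' y -> bd (c * c') (i + i') (j + j') (x * y).
Proof.
case=> hx [hy]; constructor; rewrite normrM !exprD PoszM.
have -> : c%:Z * c'%:Z * (T ^+ i * T ^+ i') * (H ^+ j * H ^+ j') =
  (c%:Z * T ^+ i * H ^+ j) * (c'%:Z * T ^+ i' * H ^+ j') by ring.
exact: ler_pM.
Qed.

Lemma bdX c i j x k : bd c i j x -> bd (expn c k) (i * k) (j * k) (x ^+ k).
Proof.
move=> hx; elim: k => [|k IH]; first by rewrite !muln0 expn0 expr0; constructor; rewrite normr1.
by rewrite exprS expnS !mulnS; apply: bdM.
Qed.

Lemma bd_nat (n : nat) : bd n 0 0 n%:R.
Proof. by constructor; rewrite !mulr1 pmulrn intz. Qed.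

Lemma bd_coef x : `|x| <= T -> bd 1 1 0 x.
Proof. by move=> h; constructor; rewrite mul1r mulr1. Qed.

Lemma bd_var x : `|x| <= H -> bd 1 0 1 x.
Proof. by move=> h; constructor; rewrite !mul1r. Qed.
End PolynomialBounds.

Lemma bdD_eq (T H : int) c c' i i' j j' x y : 1 <= T -> 1 <= H ->
  bd T H c i j x -> bd T H c' i' j' y -> j = j' -> bd T H (c + c') (maxn i i') j (x + y).
Proof. by move=> T1 H1 h h' e; subst j'; apply: bdD. Qed.

Lemma bd_sharp (T H : int) c c' i i' j j' x : 1 <= T -> 1 <= H ->
  bd T H c i j x -> j = j' -> (c <= c')%nt && (i <= i')%nt -> bd T H c' i' j' x.
Proof. by move=> T1 H1 h <- /andP[hc hi]; apply: bdW h. Qed.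

Ltac bd_step := lazymatch goal with
  | |- bd _ _ _ _ _ (GRing.exp _ _) => eapply bdX
  | |- bd _ _ _ _ _ (GRing.mul _ _) => eapply bdM
  | |- bd _ _ _ _ _ (Algebra.add _ _) => eapply bdD_eq
  | |- bd _ _ _ _ _ (Algebra.opp _) => eapply bdN
  | |- bd _ _ _ _ _ (Algebra.natmul _ _) => eapply bd_nat
  | |- _ => first [eassumption | reflexivity]
  end.
Ltac bd_auto := eapply bd_sharp; [eassumption | eassumption | repeat bd_step | reflexivity | reflexivity].

Section PairBounds.
Variables T H : int.
Hypotheses (T1 : 1 <= T) (H1 : 1 <= H).
Variables a b : int.
Hypotheses (Ta : `|a| <= T) (Tb : `|b| <= T).
Local Notation bd := (bd T H).

Lemma bd_sum_product (p s t z : int) : `|p| <= H -> `|s| <= H -> `|t| <= H -> `|z| <= H ->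
  [/\ bd 12 2 2 ((s - t) ^+ 2), bd 12 2 2 (2 * (s + t) * (a * z + p) + 4 * b * z ^+ 2) &
    bd 12 2 2 ((p - a * z) ^+ 2 - 4 * b * z * (s + t))].
Proof.
move=> /(bd_var T) hp /(bd_var T) hs /(bd_var T) ht /(bd_var T) hz.
have ha := bd_coef H Ta; have hb := bd_coef H Tb.
split.
- bd_auto.
- bd_auto.
bd_auto.
Qed.
End PairBounds.

Definition ht (x : rat) : nat := maxn (absz (numq x)) (absz (denq x)).

Lemma ht_gt0 x : (0 < ht x)%nt.
Proof. by rewrite /ht leq_max !absz_gt0 denq_neq0 orbT. Qed.

Lemma rat_num_den (x : rat) : x * (denq x)%:~R = (numq x)%:~R.
Proof. by rewrite -{1}(divq_num_den x) mulfVK // intr_eq0 denq_neq0. Qed.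

Lemma den_dvd (x : rat) (k n : int) : (numq x * k)%ri = (denq x * n)%ri -> k \in dvdz (denq x).
Proof.
move=> h; have : (denq x * n)%ri \in dvdz (denq x) by rewrite dvdz_mulr.
by rewrite -h Gauss_dvdzr // /coprimez /gcdz; have := coprime_num_den x; rewrite coprime_sym => /eqP ->.
Qed.

Lemma frac_scale (x : rat) (p q : int) : q != 0 -> x * q%:~R = p%:~R ->
  exists k, p = k * numq x /\ q = k * denq x.
Proof.
move=> q0 h; have e : numq x * q = denq x * p.
  by apply: (@intr_inj rat); rewrite !intrM -rat_num_den -h; ring.
have /dvdzP[k ek] := den_dvd e; exists k; split => //.
by apply: (mulfI (denq_neq0 x)); rewrite -e ek; ring.
Qed.

(* Gauss's lemma for the polynomial with roots x and y. *)
Lemma gauss_pair (x y : rat) (W S Q : int) : W != 0 ->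
  W%:~R * (x + y) = S%:~R -> W%:~R * (x * y) = Q%:~R ->
  exists k, [/\ W = k * (denq x * denq y), S = k * (numq x * denq y + numq y * denq x) &
                Q = k * (numq x * numq y)].
Proof.
move=> W0 hS hQ.
have eS : W * (numq x * denq y + numq y * denq x) = S * (denq x * denq y).
  by apply: (@intr_inj rat); rewrite !(intrM, intrD) -!rat_num_den -hS; ring.
have eQ : W * (numq x * numq y) = Q * (denq x * denq y).
  by apply: (@intr_inj rat); rewrite !intrM -!rat_num_den -hQ; ring.
have d1 : W * numq y \in dvdz (denq x).
  by apply: (@den_dvd x _ (Q * denq y)); rewrite mulrCA eQ; ring.
have /dvdzP[w ew] : W \in dvdz (denq x).
  have d2 : W * denq y \in dvdz (denq x).
    apply: (@den_dvd x _ (S * denq y - W * numq y)).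
    have -> : numq x * (W * denq y) = W * (numq x * denq y + numq y * denq x) - W * numq y * denq x by ring.
    by rewrite eS; ring.
  case/dvdzP: d1 => u eu; case/dvdzP: d2 => v ev.
  have : coprimez (numq y) (denq y) by exact: coprime_num_den.
  case/coprimezP=> -[i j] /= hij; apply/dvdzP; exists (i * u + j * v).
  by rewrite -[LHS]mulr1 -hij mulrDr mulrDl -!mulrA -eu -ev; ring.
have dx0 := denq_neq0 x.
have eS' : w * (numq x * denq y + numq y * denq x) = S * denq y.
  by apply: (mulfI dx0); have := eS; rewrite ew => e; rewrite mulrCA mulrA e; ring.
have eQ' : w * (numq x * numq y) = Q * denq y.
  by apply: (mulfI dx0); have := eQ; rewrite ew => e; rewrite mulrCA mulrA e; ring.
have /dvdzP[k ek] : w \in dvdz (denq y).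
  have d1' : w * numq x \in dvdz (denq y).
    by apply: (@den_dvd y _ Q); rewrite [RHS]mulrC -eQ'; ring.
  have d2 : w * denq x \in dvdz (denq y).
    apply: (@den_dvd y _ (S - w * numq x)).
    have -> : numq y * (w * denq x) = w * (numq x * denq y + numq y * denq x) - w * numq x * denq y by ring.
    by rewrite eS'; ring.
  case/dvdzP: d1' => u eu; case/dvdzP: d2 => v ev.
  have : coprimez (numq x) (denq x) by exact: coprime_num_den.
  case/coprimezP=> -[i j] /= hij; apply/dvdzP; exists (i * u + j * v).
  by rewrite -[LHS]mulr1 -hij mulrDr mulrDl -!mulrA -eu -ev; ring.
have dy0 := denq_neq0 y; exists k; split; first by rewrite ew ek; ring.
- by apply: (mulfI dy0); have := eS'; rewrite ek => e; rewrite mulrCA mulrA e; ring.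
by apply: (mulfI dy0); have := eQ'; rewrite ek => e; rewrite mulrCA mulrA e; ring.
Qed.

(** By Gauss's lemma the primitive quadratic with roots x and y has coefficients at most B. The two
    outer products are then bounded at once; the two cross products have product at most B^2, so the
    smaller is at most B and the larger at most 2 B. *)
Lemma ht_pair (x y : rat) (W S Q : int) (B : nat) : W != 0 ->
  W%:~R * (x + y) = S%:~R -> W%:~R * (x * y) = Q%:~R ->
  (absz W <= B)%nt -> (absz S <= B)%nt -> (absz Q <= B)%nt -> (ht x * ht y <= 2 * B)%nt.
Proof.
move=> W0 hS hQ; have [k [eW eS eQ]] := gauss_pair W0 hS hQ.
have k0 : (0 < absz k)%nt by rewrite absz_gt0; apply/eqP => k0; move: W0; rewrite eW k0 mul0r eqxx.
have hk z : (absz (k * z)%ri <= B)%nt -> (absz z <= B)%nt.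
  by apply: leq_trans; rewrite abszM leq_pmull.
rewrite eW eS eQ => /hk hW /hk hS' /hk hQ'; rewrite /ht.
set p := absz (numq x); set q := absz (denq x); set p' := absz (numq y); set q' := absz (denq y).
move: hW hS' hQ'; rewrite !abszM -/p -/q -/p' -/q' => hW hS' hQ'.
have tri (u v : int) : (absz u <= absz v + absz (u + v)%ri)%nt by lia.
have h1 : (p * q' <= p' * q + B)%nt.
  by rewrite /p /q /p' /q' -!abszM; apply: leq_trans (tri _ (numq y * denq x)) _; rewrite leq_add2l.
have h2 : (p' * q <= p * q' + B)%nt.
  by rewrite /p /q /p' /q' -!abszM; apply: leq_trans (tri _ (numq x * denq y)) _; rewrite leq_add2l addrC.
have h3 : (minn (p * q') (p' * q) <= B)%nt.
  rewrite leqNgt; apply/negP; rewrite leq_min => /andP[b1 b2].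
  have : (B * B < (p * q') * (p' * q))%nt by apply: ltn_mul.
  have -> : ((p * q') * (p' * q) = (p * p') * (q * q'))%nt by ring.
  by rewrite ltnNge leq_mul.
rewrite maxnMl !maxnMr !geq_max [(q * p')%nt]mulnC.
by move: (p * p')%nt (q * q')%nt (p * q')%nt (p' * q)%nt hW hQ' h1 h2 h3 => *; lia.
Qed.

(** In the sum and product of x(P + Q) and x(P - Q) the ordinates occur only through their squares,
    so both are rational in the two abscissas. *)
Lemma chord_sum_product (a b : rat) p q r r' : p.1 != q.1 -> col a b p q r -> col a b p (q.1, - q.2) r' ->
  (p.1 - q.1) ^+ 2 * (r.1 + r'.1) = 2 * (p.1 + q.1) * (a + p.1 * q.1) + 4 * b /\
  (p.1 - q.1) ^+ 2 * (r.1 * r'.1) = (p.1 * q.1 - a) ^+ 2 - 4 * b * (p.1 + q.1).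
Proof.
move=> hn h h'; have hp := col_on h; have hq := col_on (colC h).
case: p q r r' hn h h' hp hq => [x1 y1] [x2 y2] [x3 y3] [x4 y4] /= hn.
case=> l [c /= [[h1 h2 h3] [h4 h5 h6]]].
case=> l' [c' /= [[h1' h2' h3'] [h4' h5' h6']]] hp hq.
have e : l * (x1 - x2) = y1 - y2 by rewrite h1 h2; ring.
have e' : l' * (x1 - x2) = y1 + y2 by rewrite -[y2]opprK h1' h2'; ring.
have ex3 : x3 = l ^+ 2 - x1 - x2 by rewrite h4; ring.
have ex4 : x4 = l' ^+ 2 - x1 - x2 by rewrite h4'; ring.
rewrite /cubic in hp hq; rewrite ex3 ex4; split.
  have -> : (x1 - x2) ^+ 2 * (l ^+ 2 - x1 - x2 + (l' ^+ 2 - x1 - x2)) =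
    (l * (x1 - x2)) ^+ 2 + (l' * (x1 - x2)) ^+ 2 - 2 * (x1 + x2) * (x1 - x2) ^+ 2 by ring.
  rewrite e e'; have -> : (y1 - y2) ^+ 2 + (y1 + y2) ^+ 2 = 2 * (y1 ^+ 2 + y2 ^+ 2) by ring.
  by rewrite hp hq; ring.
have d0 : (x1 - x2) ^+ 2 != 0 by rewrite expf_eq0 subr_eq0.
apply: (mulfI d0).
have -> : (x1 - x2) ^+ 2 * ((x1 - x2) ^+ 2 * ((l ^+ 2 - x1 - x2) * (l' ^+ 2 - x1 - x2))) =
  ((l * (x1 - x2)) ^+ 2 - (x1 + x2) * (x1 - x2) ^+ 2) *
  ((l' * (x1 - x2)) ^+ 2 - (x1 + x2) * (x1 - x2) ^+ 2) by ring.
rewrite e e'; set D := (x1 - x2) ^+ 2.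
have -> : ((y1 - y2) ^+ 2 - (x1 + x2) * D) * ((y1 + y2) ^+ 2 - (x1 + x2) * D) =
  (y1 ^+ 2 - y2 ^+ 2) ^+ 2 - (x1 + x2) * D * 2 * (y1 ^+ 2 + y2 ^+ 2) + (x1 + x2) ^+ 2 * D ^+ 2 by ring.
by rewrite hp hq /D; ring.
Qed.

Lemma tangent_x (a b : rat) p r : col a b p p r ->
  4 * cubic a b p.1 * r.1 = p.1 ^+ 4 - 2 * a * p.1 ^+ 2 - 8 * b * p.1 + a ^+ 2.
Proof.
move=> h; have hp := col_on h; case: p r h hp => [x y] [x3 y3] /=.
case=> l [c /= [[h1 h2 h3] [h4 h5 h6]]] hp.
have e := @col_tangent a b (x, y) x3 l c hp h1 h4 h5; rewrite /= in e.
have -> : x3 = l ^+ 2 - x - x by rewrite h4; ring.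
rewrite -hp; have -> : 4 * y ^+ 2 * (l ^+ 2 - x - x) = (2 * y * l) ^+ 2 - 8 * x * y ^+ 2 by ring.
by rewrite e hp /cubic; ring.
Qed.

Lemma expn_Posz k n : Posz (expn k n) = Posz k ^+ n.
Proof. by elim: n => // n IH; rewrite expnS exprS PoszM IH. Qed.

Lemma leq_abszD (y z : int) : (absz (y + z)%ri <= absz y + absz z)%nt.
Proof. lia. Qed.

(** * The naive height under addition and duplication *)

Section NaiveHeight.
Variables A B : int.
Variable T : nat.
Hypotheses (T1 : (0 < T)%nt) (TA : (absz A <= T)%nt) (TB : (absz B <= T)%nt).
Local Notation a := (A%:~R : rat).
Local Notation b := (B%:~R : rat).
Local Notation colAB := (col a b).

Lemma bd_absz (c i j H : nat) x : bd (Posz T) (Posz H) c i j x ->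
  (absz x <= c * expn T i * expn H j)%nt.
Proof.
case; rewrite -abszE => h; rewrite -lez_nat; apply: le_trans h _.
by rewrite !PoszM !expn_Posz.
Qed.

Lemma le_absz x (H : nat) : (absz x <= H)%nt -> `|x| <= Posz H.
Proof. by rewrite -abszE lez_nat. Qed.

Let T1' : 1 <= Posz T. Proof. by rewrite lez_nat. Qed.

Lemma ht_num x : (absz (numq x) <= ht x)%nt. Proof. exact: leq_maxl. Qed.
Lemma ht_den x : (absz (denq x) <= ht x)%nt. Proof. exact: leq_maxr. Qed.

Lemma ht_chord p q r r' : p.1 != q.1 -> colAB p q r -> colAB p (q.1, - q.2) r' ->
  (ht r.1 * ht r'.1 <= 24 * expn T 2 * expn (ht p.1 * ht q.1) 2)%nt.
Proof.
move=> hn h h'; have [e1 e2] := chord_sum_product hn h h'.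
set x1 := p.1 in hn e1 e2 *; set x2 := q.1 in hn e1 e2 *.
pose H := (ht x1 * ht x2)%nt.
have H1 : 1 <= Posz H by rewrite lez_nat muln_gt0 !ht_gt0.
have bp := @le_absz (numq x1 * numq x2) H; have bs := @le_absz (numq x1 * denq x2) H.
have bt := @le_absz (numq x2 * denq x1) H; have bz := @le_absz (denq x1 * denq x2) H.
have [] := bd_sum_product T1' H1 (le_absz TA) (le_absz TB) (bp _) (bs _) (bt _) (bz _).
- by rewrite abszM leq_mul ?ht_num ?ht_den.
- by rewrite abszM leq_mul ?ht_num ?ht_den.
- by rewrite abszM mulnC leq_mul ?ht_num ?ht_den.
- by rewrite abszM leq_mul ?ht_num ?ht_den.
move=> /bd_absz bW /bd_absz bS /bd_absz bQ.
have -> : (24 * expn T 2 * expn H 2 = 2 * (12 * expn T 2 * expn H 2))%nt by rewrite !mulnA.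
apply: ht_pair bW bS bQ.
- rewrite expf_eq0 /= subr_eq0; apply: contra hn => /eqP e.
  by rewrite -(divq_num_den x1) -(divq_num_den x2) eqr_div ?intr_eq0 ?denq_neq0 // -!intrM e.
- rewrite !(rmorphM, rmorphB, rmorphD, rmorphXn, rmorph_nat) /= -!rat_num_den.
  set z1 := (denq x1)%:~R; set z2 := (denq x2)%:~R.
  have -> : (x1 * z1 * z2 - x2 * z2 * z1) ^+ 2 * (r.1 + r'.1) =
    (z1 * z2) ^+ 2 * ((x1 - x2) ^+ 2 * (r.1 + r'.1)) by ring.
  by rewrite e1; ring.
rewrite !(rmorphM, rmorphB, rmorphD, rmorphXn, rmorph_nat) /= -!rat_num_den.
set z1 := (denq x1)%:~R; set z2 := (denq x2)%:~R.
have -> : (x1 * z1 * z2 - x2 * z2 * z1) ^+ 2 * (r.1 * r'.1) =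
  (z1 * z2) ^+ 2 * ((x1 - x2) ^+ 2 * (r.1 * r'.1)) by ring.
by rewrite e2; ring.
Qed.

(* Numerator and denominator of the x-coordinate of 2 P, for x(P) = X / Z. *)
Definition dupF (X Z : int) := X ^+ 4 - 2 * A * X ^+ 2 * Z ^+ 2 - 8 * B * X * Z ^+ 3 + A ^+ 2 * Z ^+ 4.
Definition dupG (X Z : int) := 4 * (X ^+ 3 * Z + A * X * Z ^+ 3 + B * Z ^+ 4).

Lemma dup_eq p r : colAB p p r ->
  r.1 * (dupG (numq p.1) (denq p.1))%:~R = (dupF (numq p.1) (denq p.1))%:~R.
Proof.
move=> h; have := tangent_x h; rewrite /cubic /dupF /dupG => e; set x := p.1 in e *.
rewrite !(rmorphM, rmorphB, rmorphD, rmorphXn, rmorph_nat) /= -!rat_num_den.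
set z := (denq x)%:~R.
have -> : r.1 * (4 * ((x * z) ^+ 3 * z + a * (x * z) * z ^+ 3 + b * z ^+ 4)) =
  z ^+ 4 * (4 * (x ^+ 3 + a * x + b) * r.1) by ring.
by rewrite e; ring.
Qed.

Lemma dupG_neq0 (x : rat) : cubic a b x != 0 -> dupG (numq x) (denq x) != 0.
Proof.
rewrite /cubic /dupG -(intr_eq0 rat).
rewrite !(rmorphM, rmorphB, rmorphD, rmorphXn, rmorph_nat) /= -!rat_num_den.
set z := (denq x)%:~R => h.
have -> : 4 * ((x * z) ^+ 3 * z + a * (x * z) * z ^+ 3 + b * z ^+ 4) =
  4 * (z ^+ 4 * (x ^+ 3 + a * x + b)) by ring.
by apply: mulf_neq0 => //; apply: mulf_neq0 => //; rewrite expf_neq0 // intr_eq0 denq_neq0.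
Qed.

Lemma dup_bounds X Z (H : nat) : (0 < H)%nt -> (absz X <= H)%nt -> (absz Z <= H)%nt ->
  (absz (dupF X Z) <= 12 * expn T 2 * expn H 4)%nt /\ (absz (dupG X Z) <= 12 * expn T 2 * expn H 4)%nt.
Proof.
move=> H0 hX hZ; have H1 : 1 <= Posz H by rewrite lez_nat.
have hA := bd_coef (Posz H) (le_absz TA); have hB := bd_coef (Posz H) (le_absz TB).
have bX := bd_var (Posz T) (le_absz hX); have bZ := bd_var (Posz T) (le_absz hZ).
by split; apply: bd_absz; rewrite /dupF /dupG; bd_auto.
Qed.

Lemma ht_dup_le p r : cubic a b p.1 != 0 -> colAB p p r ->
  (ht r.1 <= 12 * expn T 2 * expn (ht p.1) 4)%nt.
Proof.
move=> hc h; have G0 := dupG_neq0 hc.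
have [k [eF eG]] := frac_scale G0 (dup_eq h).
have [bF bG] := dup_bounds (ht_gt0 p.1) (ht_num p.1) (ht_den p.1).
have k0 : (0 < absz k)%nt by rewrite absz_gt0; apply: contra G0 => /eqP k0; rewrite eG k0 mul0r.
rewrite eF in bF; rewrite eG in bG; rewrite !abszM in bF bG.
rewrite {1}/ht geq_max; apply/andP; split.
  by apply: leq_trans bF; rewrite leq_pmull.
by apply: leq_trans bG; rewrite leq_pmull.
Qed.

(** Two resultant identities express D X^7 and D Z^7, with D = 4 (4 A^3 + 27 B^2), through the
    duplication forms, with cofactors of degree 3. The common factor k is arbitrary, so that the
    statement covers x(2 P) in lowest terms as well as points of order 2. *)
Lemma dup_resultant (x : rat) (k n d : int) (h : nat) : 4 * A ^+ 3 + 27 * B ^+ 2 != 0 ->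
  dupF (numq x) (denq x) = k * n -> dupG (numq x) (denq x) = k * d ->
  (absz n <= h)%nt -> (absz d <= h)%nt -> (expn (ht x) 4 <= 800 * expn T 5 * h)%nt.
Proof.
move=> D0; set X := numq x; set Z := denq x => eF eG hn hd.
pose D := 4 * (4 * A ^+ 3 + 27 * B ^+ 2).
pose f1 := 12 * X ^+ 2 * Z + 16 * A * Z ^+ 3.
pose g1 := 3 * X ^+ 3 - 5 * A * X * Z ^+ 2 - 27 * B * Z ^+ 3.
pose f2 := 4 * (4 * A ^+ 3 + 27 * B ^+ 2) * X ^+ 3 - 4 * A ^+ 2 * B * X ^+ 2 * Z
  + 4 * A * (3 * A ^+ 3 + 22 * B ^+ 2) * X * Z ^+ 2 + 12 * B * (A ^+ 3 + 8 * B ^+ 2) * Z ^+ 3.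
pose g2 := A ^+ 2 * B * X ^+ 3 + A * (5 * A ^+ 3 + 32 * B ^+ 2) * X ^+ 2 * Z
  + 2 * B * (13 * A ^+ 3 + 96 * B ^+ 2) * X * Z ^+ 2 - 3 * A ^+ 2 * (A ^+ 3 + 8 * B ^+ 2) * Z ^+ 3.
have r1 : k * (f1 * n - g1 * d) = D * Z ^+ 7.
  have -> : k * (f1 * n - g1 * d) = f1 * (k * n) - g1 * (k * d) by ring.
  by rewrite -eF -eG /dupF /dupG /f1 /g1 /D; ring.
have r2 : k * (f2 * n + g2 * d) = D * X ^+ 7.
  have -> : k * (f2 * n + g2 * d) = f2 * (k * n) + g2 * (k * d) by ring.
  by rewrite -eF -eG /dupF /dupG /f2 /g2 /D; ring.
have hD : D != 0 by rewrite mulf_neq0.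
(* Cancellation is bounded: k divides D X^7 and D Z^7, hence D, since X and Z are coprime. *)
have [e eD] : exists e, D = k * e.
  have : coprimez (X ^+ 7) (Z ^+ 7).
    by rewrite coprimezXl // coprimezXr // ; exact: coprime_num_den.
  case/coprimezP=> -[u v] /= huv; exists (u * (f2 * n + g2 * d) + v * (f1 * n - g1 * d)).
  rewrite mulrDr ![k * (_ * _)]mulrCA r1 r2 -[LHS]mulr1 -huv; ring.
have k0 : k != 0 by apply: contra hD => /eqP k0; rewrite eD k0 mul0r.
have e0 : (0 < absz e)%nt by rewrite absz_gt0; apply: contra hD => /eqP e0; rewrite eD e0 mulr0.
have s1 : f1 * n - g1 * d = e * Z ^+ 7 by apply: (mulfI k0); rewrite r1 eD -mulrA.
have s2 : f2 * n + g2 * d = e * X ^+ 7 by apply: (mulfI k0); rewrite r2 eD -mulrA.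
have H0 := ht_gt0 x; set H := ht x in H0 *.
have H1 : 1 <= Posz H by rewrite lez_nat.
have hA := bd_coef (Posz H) (le_absz TA); have hB := bd_coef (Posz H) (le_absz TB).
have bX := bd_var (Posz T) (le_absz (ht_num x)); have bZ := bd_var (Posz T) (le_absz (ht_den x)).
rewrite -/X -/Z -/H in bX bZ.
have tri (u v u' v' : int) (c : nat) : (absz u <= c)%nt -> (absz v <= c)%nt ->
    (absz u' <= h)%nt -> (absz v' <= h)%nt -> (absz (u * u' + v * v')%ri <= c * h + c * h)%nt.
  move=> a1 a2 a3 a4; apply: leq_trans (leq_abszD _ _) _.
  by rewrite !abszM leq_add // leq_mul.
pose c := (400 * expn T 5 * expn H 3)%nt.
have bf1 : (absz f1 <= c)%nt by apply: bd_absz; rewrite /f1; bd_auto.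
have bg1 : (absz (- g1) <= c)%nt by rewrite abszN; apply: bd_absz; rewrite /g1; bd_auto.
have bf2 : (absz f2 <= c)%nt by apply: bd_absz; rewrite /f2; bd_auto.
have bg2 : (absz g2 <= c)%nt by apply: bd_absz; rewrite /g2; bd_auto.
have q1 : (expn (absz Z) 7 <= c * h + c * h)%nt.
  apply: leq_trans (tri f1 (- g1) n d c bf1 bg1 hn hd).
  by rewrite mulNr s1 abszM abszX leq_pmull.
have q2 : (expn (absz X) 7 <= c * h + c * h)%nt.
  by apply: leq_trans (tri f2 g2 n d c bf2 bg2 hn hd); rewrite s2 abszM abszX leq_pmull.
have : (expn H 7 <= c * h + c * h)%nt.
  by rewrite /H /ht -/X -/Z; case: (leqP (absz X) (absz Z)).
have -> : (expn H 7 = expn H 3 * expn H 4)%nt by rewrite -expnD.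
have -> : (c * h + c * h = expn H 3 * (800 * expn T 5 * h))%nt by rewrite /c; ring.
by rewrite leq_pmul2l // expn_gt0 H0.
Qed.

Lemma ht_dup_ge p r : 4 * A ^+ 3 + 27 * B ^+ 2 != 0 -> cubic a b p.1 != 0 -> colAB p p r ->
  (expn (ht p.1) 4 <= 800 * expn T 5 * ht r.1)%nt.
Proof.
move=> D0 hc h; have [k [eF eG]] := frac_scale (dupG_neq0 hc) (dup_eq h).
exact: dup_resultant D0 eF eG (ht_num _) (ht_den _).
Qed.

Lemma ht_root (x : rat) : 4 * A ^+ 3 + 27 * B ^+ 2 != 0 -> cubic a b x = 0 ->
  (expn (ht x) 4 <= 800 * expn T 5)%nt.
Proof.
move=> D0 hc; rewrite -[leqRHS]muln1.
(* The double of a point of order 2 is at infinity, represented by n = 1 and d = 0; k is then the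
   whole numerator form. *)
apply: (@dup_resultant x (dupF (numq x) (denq x)) 1 0) => //; first by rewrite mulr1.
rewrite mulr0; apply: (@intr_inj rat); rewrite /dupG.
rewrite !(rmorphM, rmorphB, rmorphD, rmorphXn, rmorph_nat) /= -!rat_num_den.
set z := (denq x)%:~R.
have -> : 4 * ((x * z) ^+ 3 * z + a * (x * z) * z ^+ 3 + b * z ^+ 4) =
  4 * z ^+ 4 * (cubic a b x) by rewrite /cubic; ring.
by rewrite hc mulr0.
Qed.
End NaiveHeight.

Lemma INR_muln m n : INR (m * n)%nt = (INR m * INR n)%R. Proof. exact: mult_INR. Qed.
Lemma INR_expn m n : INR (expn m n) = (INR m ^ n)%R.
Proof. by elim: n => // n IH; rewrite expnS INR_muln IH. Qed.
Lemma INR_gt0 n : (0 < n)%nt -> (0 < INR n)%R. Proof. by move=> h; apply: lt_0_INR; apply/ssrnat.ltP. Qed.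
Lemma INR_le m n : (m <= n)%nt -> (INR m <= INR n)%R. Proof. by move=> h; apply: le_INR; apply/ssrnat.leP. Qed.

Definition lnN (n : nat) : R := ln (INR n).

Lemma lnN_mul m n : (0 < m)%nt -> (0 < n)%nt -> lnN (m * n)%nt = (lnN m + lnN n)%R.
Proof. by move=> hm hn; rewrite /lnN INR_muln ln_mult //; apply: INR_gt0. Qed.

Lemma lnN_exp m n : (0 < m)%nt -> lnN (expn m n) = (INR n * lnN m)%R.
Proof.
move=> hm; elim: n => [|n IH]; first by rewrite /lnN expn0 ln_1 /=; lra.
by rewrite expnS lnN_mul ?expn_gt0 ?hm // IH S_INR; lra.
Qed.

Lemma lnN_prod3 c t i x : (0 < c)%nt -> (0 < t)%nt -> (0 < x)%nt ->
  lnN (c * expn t i * x)%nt = (lnN c + INR i * lnN t + lnN x)%R.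
Proof.
move=> hc h hx; have he : (0 < expn t i)%nt by rewrite expn_gt0 h.
by rewrite lnN_mul ?muln_gt0 ?hc // lnN_mul // lnN_exp.
Qed.

Lemma lnN_le m n : (0 < m)%nt -> (m <= n)%nt -> (lnN m <= lnN n)%R.
Proof.
move=> hm hmn; rewrite /lnN; have := INR_le hmn; have := INR_gt0 hm => h1 h2.
by case: h2 => h2; [left; apply: ln_increasing | rewrite h2; right].
Qed.

Lemma lnN_ge0 m : (0 < m)%nt -> (0 <= lnN m)%R.
Proof. by move=> hm; have := lnN_le (isT : (0 < 1)%nt) hm; rewrite {1}/lnN ln_1. Qed.

Lemma hQE x : hQ x = lnN (ht x). Proof. by []. Qed.

Lemma hQ_ge0 x : (0 <= hQ x)%R. Proof. by apply: lnN_ge0; apply: ht_gt0. Qed.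

Lemma hpt_ge0 P : (0 <= hpt P)%R.
Proof. by case: P => [[x y]|] /=; [exact: hQ_ge0 | lra]. Qed.

Lemma hpt_neg E P : hpt (pneg E P) = hpt P. Proof. by case: P => [[x y]|]. Qed.

Section PointHeight.
Variables (A B : int) (T : nat).
Hypotheses (T1 : (0 < T)%nt) (TA : (absz A <= T)%nt) (TB : (absz B <= T)%nt).
Hypothesis ns : 4 * (A%:~R : rat) ^+ 3 + 27 * (B%:~R : rat) ^+ 2 != 0.
Local Notation a := (A%:~R : rat).
Local Notation b := (B%:~R : rat).
Local Notation G := (ecpt ns).

Definition hp (P : G) : R := hpt (ecval P).
(** The logarithm of the constant 800 T^5 in the lower duplication bound, which dominates the other
    error terms. *)
Definition kappa : R := (5 * lnN T + lnN 800)%R.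

Lemma ns_int : 4 * A ^+ 3 + 27 * B ^+ 2 != 0.
Proof.
apply: contra ns => /eqP e; have := congr1 (fun x : int => x%:~R : rat) e.
by rewrite !(rmorphM, rmorphB, rmorphD, rmorphXn, rmorph_nat) /= => ->.
Qed.

Lemma kappa_ge : (0 <= kappa /\ lnN 24 + 2 * lnN T <= kappa)%R.
Proof.
have h := lnN_ge0 T1; have h1 : (lnN 24 <= lnN 800)%R by apply: lnN_le.
by have h2 : (0 <= lnN 24)%R by [apply: lnN_ge0]; rewrite /kappa; split; lra.
Qed.

Lemma hp0 : hp 0 = 0%R. Proof. by []. Qed.
Lemma hpN P : hp (- P) = hp P. Proof. exact: hpt_neg. Qed.

Lemma hp_double P : (hp (P + P)%ri <= 4 * hp P + kappa /\ 4 * hp P <= hp (P + P)%ri + kappa)%R.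
Proof.
have [k0 k1] := kappa_ge; rewrite /hp ecvalD; have := ec_on P.
case: (ecval P) => [[x y]|]; last by move=> _ /=; lra.
move=> /on_shortE hon.
have [[e ->]|[r [h ->]]] := @padd_shortP _ _ (x, y) (x, y) hon hon.
  have y0 : y = 0.
    case: e => e; have : 2 * y = 0 by rewrite mulr2n mulrDl !mul1r {2}e subrr.
    by move/eqP; rewrite mulf_eq0 => /orP[]// /eqP.
  have hc : cubic a b x = 0 by rewrite -hon y0 expr0n.
  have := ht_root T1 TA TB ns_int hc => /(lnN_le _).
  rewrite expn_gt0 ht_gt0 => /(_ isT); rewrite lnN_exp ?ht_gt0 // lnN_mul ?expn_gt0 ?T1 // lnN_exp //=.
  have := lnN_ge0 (ht_gt0 x); rewrite /kappa in k0 *; rewrite /= !hQE; lra.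
have hc : cubic a b (x, y).1 != 0.
  apply/eqP => hc; have := col_neq_neg ns h; apply => /=.
  move: hon; rewrite hc => /eqP; rewrite expf_eq0 => /andP[_ /eqP ->].
  by rewrite oppr0.
have := ht_dup_le T1 TA TB hc h => /(lnN_le (ht_gt0 _)).
have := ht_dup_ge T1 TA TB ns_int hc h => /(lnN_le _).
rewrite expn_gt0 ht_gt0 => /(_ isT).
rewrite !lnN_prod3 ?expn_gt0 ?ht_gt0 // !lnN_exp ?ht_gt0 // /= !hQE.
have h12 : (lnN 12 <= lnN 24)%R by apply: lnN_le.
have hT := lnN_ge0 T1.
rewrite /kappa in k0 k1 *; lra.
Qed.

Lemma hp_sum_le P Q : (hp (P + Q)%ri + hp (P - Q)%ri <= 2 * hp P + 2 * hp Q + kappa)%R.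
Proof.
have [k0 k1] := kappa_ge.
have same : (hp (P + P)%ri + hp (P - P)%ri <= 2 * hp P + 2 * hp P + kappa)%R.
  by rewrite subrr hp0; have [] := hp_double P; lra.
have [e|neP] := eqVneq Q P; first by rewrite e.
have [e|neN] := eqVneq Q (- P).
  by rewrite e opprK hpN; move: same; lra.
rewrite /hp ecvalD ecvalD ecvalN; have := ec_on P; have := ec_on Q.
have : ecval Q <> ecval P by move/ecval_inj/eqP; rewrite (negPf neP).
have : ecval Q <> pneg (shortW a b) (ecval P) by rewrite -ecvalN => /ecval_inj/eqP; rewrite (negPf neN).
case: (ecval P) => [[x1 y1]|]; case: (ecval Q) => [[x2 y2]|]; last first.
- by rewrite /=; lra.
- by move=> _ _ _ _; rewrite pneg_shortE /=; have := hQ_ge0 x2; lra.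
- by move=> _ _ _ _; rewrite /=; have := hQ_ge0 x1; lra.
rewrite !pneg_shortE => n1 n2 /on_shortE hq /on_shortE hp'.
have hx : x1 != x2.
  apply/eqP => e; have : (y2 - y1) * (y2 + y1) = 0.
    have -> : (y2 - y1) * (y2 + y1) = y2 ^+ 2 - y1 ^+ 2 by ring.
    by rewrite hq hp' e subrr.
  move/eqP; rewrite mulf_eq0 subr_eq0 addr_eq0 => /orP[]/eqP e'.
    by apply: n2; rewrite e e'.
  by apply: n1; rewrite e e'.
have hq' : (x2, - y2).2 ^+ 2 = cubic a b (x2, - y2).1 by rewrite /= sqrrN.
have [[[e _] _]|[r [h ->]]] := @padd_shortP _ _ (x1, y1) (x2, y2) hp' hq.
  by rewrite e eqxx in hx.
have [[[e _] _]|[r' [h' ->]]] := @padd_shortP _ _ (x1, y1) (x2, - y2) hp' hq'.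
  by rewrite e eqxx in hx.
have := ht_chord T1 TA TB (p := (x1, y1)) (q := (x2, y2)) hx h h' => /(lnN_le _).
rewrite muln_gt0 !ht_gt0 => /(_ isT).
rewrite lnN_prod3 ?expn_gt0 ?muln_gt0 ?ht_gt0 // lnN_exp ?muln_gt0 ?ht_gt0 //.
rewrite !lnN_mul ?ht_gt0 // /= !hQE.
lra.
Qed.

(** The lower bound follows from the upper one applied to P + Q and P - Q, whose sum and difference
    are 2 P and 2 Q, combined with the lower bound for duplication. *)
Lemma hp_par P Q : (Rabs (hp (P + Q)%ri + hp (P - Q)%ri - 2 * hp P - 2 * hp Q) <= 2 * kappa)%R.
Proof.
have [k0 _] := kappa_ge.
have h1 := hp_sum_le P Q; have h2 := hp_sum_le (P + Q) (P - Q).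
have e1 : (P + Q) + (P - Q) = P + P by rewrite addrACA subrr addr0.
have e2 : (P + Q) - (P - Q) = Q + Q by rewrite opprB [P + Q]addrC addrACA subrr addr0.
rewrite e1 e2 in h2; have [_ h3] := hp_double P; have [_ h4] := hp_double Q.
by apply: Rabs_le; split; lra.
Qed.
End PointHeight.

(** * Tate's limit construction of the canonical height *)

Section CanonicalHeight.
Local Open Scope R_scope.
Variables (G : zmodType) (h : G -> R) (c : R).
Hypothesis h_ge0 : forall x, 0 <= h x.
Hypothesis h_par : forall x y : G, Rabs (h (x + y)%ri + h (x - y)%ri - 2 * h x - 2 * h y) <= c.
Hypothesis h0 : h 0%ri = 0.

Definition tateseq (x : G) n := h (x *+ expn 2 n)%ri / 4 ^ n.

Lemma c_ge0 : 0 <= c.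
Proof. exact: Rle_trans (Rabs_pos _) (h_par 0%ri 0%ri). Qed.

Lemma h_double x : Rabs (h (x *+ 2)%ri - 4 * h x) <= c.
Proof.
have := h_par x x; rewrite subrr h0 -[(x + x)%ri]/(x *+ 2)%ri.
by have -> : h (x *+ 2)%ri + 0 - 2 * h x - 2 * h x = h (x *+ 2)%ri - 4 * h x by Rring.
Qed.

Lemma tate_step x n : Rabs (tateseq x n.+1 - tateseq x n) <= c / 4 ^ n.+1.
Proof.
have p0 : 0 < 4 ^ n.+1 by apply: pow_lt; lra.
have := h_double (x *+ expn 2 n)%ri; rewrite /tateseq -mulrnA -expnSr => hd.
have p1 : 0 < 4 ^ n by apply: pow_lt; lra.
have -> : h (x *+ expn 2 n.+1)%ri / 4 ^ n.+1 - h (x *+ expn 2 n)%ri / 4 ^ n =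
  (h (x *+ expn 2 n.+1)%ri - 4 * h (x *+ expn 2 n)%ri) / 4 ^ n.+1 by rewrite /=; Rfield; lra.
rewrite Rabs_mult (Rabs_right (/ _)); last by apply: Rle_ge; left; apply: Rinv_0_lt_compat.
by apply: Rmult_le_compat_r => //; left; apply: Rinv_0_lt_compat.
Qed.

Lemma tate_diff x n k : Rabs (tateseq x (n + k) - tateseq x n) <= c / 4 ^ n.
Proof.
have c0 := c_ge0.
(* This sharper form telescopes: a step costs c / 4^(n+k+1), while the right-hand side grows by
   three times that. *)
suff : Rabs (tateseq x (n + k) - tateseq x n) <= c / 4 ^ n - c / 4 ^ (n + k).
  have p : 0 < 4 ^ (n + k) by apply: pow_lt; lra.
  have : 0 <= c / 4 ^ (n + k) by apply: Rmult_le_pos => //; left; apply: Rinv_0_lt_compat.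
  lra.
elim: k => [|k IH].
  by rewrite addn0 Rminus_diag Rminus_diag Rabs_R0; lra.
rewrite addnS; have h1 := tate_step x (n + k).
have h2 := Rabs_triang (tateseq x (n + k).+1 - tateseq x (n + k)) (tateseq x (n + k) - tateseq x n).
have e : tateseq x (n + k).+1 - tateseq x (n + k) + (tateseq x (n + k) - tateseq x n) =
  tateseq x (n + k).+1 - tateseq x n by Rring.
rewrite e in h2; have p : 0 < 4 ^ (n + k) by apply: pow_lt; lra.
have e4 : c / 4 ^ (n + k) = 4 * (c / 4 ^ (n + k).+1) by rewrite /=; Rfield; lra.
have : 0 <= c / 4 ^ (n + k).+1.
  by apply: Rmult_le_pos => //; left; apply: Rinv_0_lt_compat; apply: pow_lt; lra.
lra.
Qed.

Lemma inv4_small e : 0 < e -> exists N, forall n, (N <= n)%nt -> c / 4 ^ n < e.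
Proof.
move=> e0; have c0 := c_ge0.
have [N hN] := Pow_x_infinity 4 ltac:(rewrite Rabs_right; lra) (c / e + 1).
exists N => n hn; have := hN n (ssrnat.leP hn).
have p : 0 < 4 ^ n by apply: pow_lt; lra.
rewrite Rabs_right; last lra.
move=> /Rge_le h1; have h2 : (c / e + 1) * e <= 4 ^ n * e by apply: Rmult_le_compat_r; lra.
have e1 : (c / e + 1) * e = c + e by Rfield; lra.
apply: (Rmult_lt_reg_r (4 ^ n)) => //.
have -> : c / 4 ^ n * 4 ^ n = c by Rfield; lra.
lra.
Qed.

Lemma tate_cv x : exists v, Un_cv (tateseq x) v.
Proof.
have hC : Cauchy_crit (tateseq x).
  move=> e e0; have [N hN] := @inv4_small (e / 2) ltac:(lra).
  exists N => n k hn hk; rewrite /R_dist.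
  have {}hn : (N <= n)%nt by apply/ssrnat.leP. have {}hk : (N <= k)%nt by apply/ssrnat.leP.
  have h1 := tate_diff x N (n - N); have h2 := tate_diff x N (k - N).
  rewrite subnKC // in h1; rewrite subnKC // in h2.
  have h3 := hN N (leqnn _).
  have := Rabs_triang (tateseq x n - tateseq x N) (- (tateseq x k - tateseq x N)).
  rewrite Rabs_Ropp.
  have -> : tateseq x n - tateseq x N + - (tateseq x k - tateseq x N) = tateseq x n - tateseq x k by Rring.
  lra.
by have [v hv] := R_complete _ hC; exists v.
Qed.

Lemma canonical_height_exists : exists q : G -> R,
  [/\ forall x, Un_cv (tateseq x) (q x), forall x, 0 <= q x, forall x, Rabs (q x - h x) <= c &
   forall x y : G, q (x + y)%ri + q (x - y)%ri = 2 * q x + 2 * q y].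
Proof.
have [q hq] := choice_fun tate_cv; exists q; split => //.
- move=> x; apply: Rnot_lt_le => hlt; have [N hN] := hq x (- q x) ltac:(lra).
  have := hN N (le_n _); rewrite /R_dist; have : 0 <= tateseq x N.
    by apply: Rmult_le_pos => //; left; apply: Rinv_0_lt_compat; apply: pow_lt; lra.
  by move=> h1; rewrite Rabs_right; lra.
- move=> x; apply: Rnot_lt_le => hlt.
  have [N hN] := hq x (Rabs (q x - h x) - c) ltac:(lra).
  have := hN N (le_n _); rewrite /R_dist => h1.
  have := tate_diff x 0 N; rewrite add0n /= => h2.
  have e0 : tateseq x 0 = h x by rewrite /tateseq /= mulr1n; Rfield.
  have := Rabs_triang (q x - tateseq x N) (tateseq x N - h x).
  have -> : q x - tateseq x N + (tateseq x N - h x) = q x - h x by Rring.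
  rewrite (Rabs_minus_sym (q x) (tateseq x N)); rewrite e0 /= in h2; lra.
move=> x y; pose d n := tateseq (x + y)%ri n + tateseq (x - y)%ri n - (2 * tateseq x n + 2 * tateseq y n).
have cv2 z : Un_cv (fun n => 2 * tateseq z n) (2 * q z).
  by apply: (CV_mult (fun=> 2)) (hq z) => e e0; exists 0%nt => n _; rewrite R_dist_eq.
have hd : Un_cv d (q (x + y)%ri + q (x - y)%ri - (2 * q x + 2 * q y)).
  by apply: CV_minus; apply: CV_plus.
have hd0 : Un_cv d 0.
  move=> e e0; have [N hN] := inv4_small e0; exists N => n /ssrnat.leP hn.
  have p : 0 < 4 ^ n by apply: pow_lt; lra.
  rewrite /R_dist Rminus_0_r; apply: Rle_lt_trans (hN n hn).
  have -> : d n = (h (x *+ expn 2 n + y *+ expn 2 n)%ri + h (x *+ expn 2 n - y *+ expn 2 n)%ri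
       - 2 * h (x *+ expn 2 n)%ri - 2 * h (y *+ expn 2 n)%ri) / 4 ^ n.
    have eD : ((x + y) *+ expn 2 n = x *+ expn 2 n + y *+ expn 2 n)%ri by rewrite mulrnDl.
    have eB : ((x - y) *+ expn 2 n = x *+ expn 2 n - y *+ expn 2 n)%ri by rewrite mulrnBl.
    by rewrite /d /tateseq eD eB; Rfield; lra.
  rewrite Rabs_mult (Rabs_right (/ _)); last by apply: Rle_ge; left; apply: Rinv_0_lt_compat.
  by apply: Rmult_le_compat_r => //; left; apply: Rinv_0_lt_compat.
by have := UL_sequence _ _ _ hd hd0; lra.
Qed.
End CanonicalHeight.

(** * Differences of points in progression are non-torsion *)

Definition oddz (n : int) : Prop := exists k : int, n = 2 * k + 1.

Lemma oddzM m n : oddz m -> oddz n -> oddz (m * n).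
Proof. by case=> k -> [l ->]; exists (2 * k * l + k + l); ring. Qed.

Lemma oddzX m k : oddz m -> oddz (m ^+ k).
Proof. by move=> h; elim: k => [|k IH]; [exists 0 | rewrite exprS; apply: oddzM]. Qed.

Lemma oddz_add2 m k : oddz m -> oddz (m + 2 * k).
Proof. by case=> l ->; exists (l + k); ring. Qed.

Lemma oddz_neq0 m : oddz m -> m != 0.
Proof. by case=> k ->; lia. Qed.

Lemma oddzP (n : int) : odd (absz n) -> oddz n.
Proof.
move=> h; exists (divz n 2); have e := divz_eq n 2.
have h0 : 0 <= modz n 2 by rewrite modz_ge0.
have h1 : modz n 2 < 2 by rewrite ltz_pmod.
have [r0|r1] : modz n 2 = 0 \/ modz n 2 = 1 by move: (modz n 2) h0 h1 => r; lia.
  by move: h; rewrite e r0 addr0 abszM oddM andbF.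
by rewrite {1}e r1 mulrC.
Qed.

Lemma odd_part (d : int) : d != 0 -> exists f o, oddz o /\ d = 2 ^+ f * o.
Proof.
move=> d0; have [|t [n' [h [i hi]]]] := @common_pow2 1 (fun=> d); first by exists ord0; apply/eqP.
by exists t, (n' i); split; [exact: oddzP | rewrite (h i) mulrC expn_Posz].
Qed.

(* [xi] has 2-adic valuation [- k]. *)
Definition val2neg (k : nat) (xi : rat) : Prop :=
  exists m n : int, [/\ oddz m, oddz n & xi * (2 ^+ k * n%:~R) = m%:~R].

Lemma val2neg_uniq k k' xi : val2neg k xi -> val2neg k' xi -> k = k'.
Proof.
suff wl j j' : (j < j')%nt -> val2neg j xi -> val2neg j' xi -> False.
  move=> h h'; case: (ltngtP k k') => // hlt; first by case: (wl k k').
  by case: (wl k' k).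
move=> hlt [m [n [hm hn e]]] [m' [n' [hm' hn' e']]].
have : m' * n = 2 ^+ (j' - j) * (n' * m).
  apply: (@intr_inj rat); rewrite !intrM -e -e' rmorphXn /=.
  have -> : 2 ^+ j' = 2 ^+ (j' - j) * 2 ^+ j :> rat by rewrite -exprD subnK // ltnW.
  by ring.
have -> : (j' - j = (j' - j).-1.+1)%nt by lia.
by rewrite exprS; case: (oddzM hm' hn) => u ->; lia.
Qed.

Section Doubling2Adic.
Variables (al mu a b : rat) (p2 p1 p0 : int).
Hypothesis mu0 : mu != 0.
Hypothesis h2 : 3 * al = mu * p2%:~R.
Hypothesis h1 : 3 * al ^+ 2 + a = mu ^+ 2 * p1%:~R.
Hypothesis h0 : cubic a b al = mu ^+ 3 * p0%:~R.

(** The section hypotheses say that the Taylor coefficients at [al], rescaled by [mu], are integers: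
    in the coordinate [xi] the curve is a quadratic twist of a monic integral cubic, and duplication
    of abscissas ignores the twist. *)
Lemma cubic_xi (xi : rat) : cubic a b (al + mu * xi) =
  mu ^+ 3 * (xi ^+ 3 + p2%:~R * xi ^+ 2 + p1%:~R * xi + p0%:~R).
Proof.
move: h1 h0 h2; move: (p2%:~R : rat) (p1%:~R : rat) (p0%:~R : rat) => q2 q1 q0 e1 e0 e2.
have ea : a = mu ^+ 2 * q1 - 3 * al ^+ 2 by rewrite -e1; ring.
have eb : b = mu ^+ 3 * q0 - al ^+ 3 - a * al by rewrite -e0 /cubic; ring.
have el : al = mu * q2 / 3 by rewrite -e2; field.
by rewrite /cubic eb ea el; field.
Qed.

Lemma val2neg_cubic k xi : val2neg k.+1 xi -> cubic a b (al + mu * xi) != 0.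
Proof.
case=> m [n [hm hn e]]; rewrite cubic_xi mulf_neq0 ?expf_neq0 //.
pose z : int := 2 * (2 ^+ k * n).
have ez : xi * z%:~R = m%:~R by rewrite -e /z !intrM !rmorphXn exprS /= mulrA.
pose u := m ^+ 3 + 2 * ((2 ^+ k * n) * (p2 * m ^+ 2 + p1 * m * z + p0 * z ^+ 2)).
have hu : oddz u by apply: oddz_add2; apply: oddzX.
have eu : u = m ^+ 3 + z * (p2 * m ^+ 2 + p1 * m * z + p0 * z ^+ 2) by rewrite /u mulrA.
clearbody z u; apply/negP => /eqP h; case/negP: (oddz_neq0 hu); rewrite -(intr_eq0 rat); apply/eqP.
rewrite eu !(rmorphM, rmorphB, rmorphD, rmorphXn, rmorph_nat) /= -ez.
by rewrite -[RHS](mul0r (z%:~R ^+ 3)) -h; ring.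
Qed.

Lemma double_xi (xi xi' : rat) :
  4 * cubic a b (al + mu * xi) * (al + mu * xi') =
    (al + mu * xi) ^+ 4 - 2 * a * (al + mu * xi) ^+ 2 - 8 * b * (al + mu * xi) + a ^+ 2 ->
  4 * (xi ^+ 3 + p2%:~R * xi ^+ 2 + p1%:~R * xi + p0%:~R) * xi' =
   xi ^+ 4 - 2 * p1%:~R * xi ^+ 2 - 8 * p0%:~R * xi + p1%:~R ^+ 2 - 4 * p0%:~R * p2%:~R.
Proof.
rewrite cubic_xi.
move: h1 h0 h2; move: (p2%:~R : rat) (p1%:~R : rat) (p0%:~R : rat) => q2 q1 q0 e1 e0 e2.
have ea : a = mu ^+ 2 * q1 - 3 * al ^+ 2 by rewrite -e1; ring.
have eb : b = mu ^+ 3 * q0 - al ^+ 3 - a * al by rewrite -e0 /cubic; ring.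
have el : al = mu * q2 / 3 by rewrite -e2; field.
move=> e; have m4 : mu ^+ 4 != 0 by rewrite expf_neq0.
apply: (mulfI m4).
have -> : mu ^+ 4 * (4 * (xi ^+ 3 + q2 * xi ^+ 2 + q1 * xi + q0) * xi') =
  4 * (mu ^+ 3 * (xi ^+ 3 + q2 * xi ^+ 2 + q1 * xi + q0)) * (al + mu * xi') -
  4 * al * mu ^+ 3 * (xi ^+ 3 + q2 * xi ^+ 2 + q1 * xi + q0) by ring.
by rewrite e eb ea el; field.
Qed.

(** At negative valuation xi^4 dominates the numerator and xi^3 the cubic in the denominator; the
    remaining factor 4 lowers the valuation by 2. *)
Lemma val2neg_double k xi xi' : val2neg k.+1 xi ->
  4 * cubic a b (al + mu * xi) * (al + mu * xi') =
    (al + mu * xi) ^+ 4 - 2 * a * (al + mu * xi) ^+ 2 - 8 * b * (al + mu * xi) + a ^+ 2 ->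
  val2neg k.+3 xi'.
Proof.
case=> m [n [hm hn e]] /double_xi.
pose z : int := 2 ^+ k.+1 * n.
have ez : xi * z%:~R = m%:~R by rewrite -e /z intrM rmorphXn.
have ez2 : z = 2 * (2 ^+ k * n) by rewrite /z exprS mulrA.
pose u := m ^+ 3 + p2 * m ^+ 2 * z + p1 * m * z ^+ 2 + p0 * z ^+ 3.
pose M := m ^+ 4 - 2 * p1 * m ^+ 2 * z ^+ 2 - 8 * p0 * m * z ^+ 3 + (p1 ^+ 2 - 4 * p0 * p2) * z ^+ 4.
have hu : oddz u.
  have -> : u = m ^+ 3 + 2 * ((2 ^+ k * n) * (p2 * m ^+ 2 + p1 * m * z + p0 * z ^+ 2)).
    by rewrite /u [2 * _]mulrA -ez2; ring.
  by apply: oddz_add2; apply: oddzX.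
have hM : oddz M.
  have -> : M = m ^+ 4 + 2 * ((2 ^+ k * n) * (- 2 * p1 * m ^+ 2 * z - 8 * p0 * m * z ^+ 2 +
     (p1 ^+ 2 - 4 * p0 * p2) * z ^+ 3)).
    by rewrite /M [2 * (2 ^+ k * n * _)]mulrA -ez2; ring.
  by apply: oddz_add2; apply: oddzX.
move=> h; exists M, (n * u); split => //; first exact: oddzM.
have -> : 2 ^+ k.+3 * (n * u)%:~R = 4 * (z%:~R * u%:~R) :> rat.
  by rewrite /z !intrM !rmorphXn /= !exprS; ring.
clearbody z.
have -> : xi' * (4 * (z%:~R * u%:~R)) =
   4 * (xi ^+ 3 + p2%:~R * xi ^+ 2 + p1%:~R * xi + p0%:~R) * xi' * z%:~R ^+ 4.
  by rewrite /u !(rmorphM, rmorphB, rmorphD, rmorphXn, rmorph_nat) /= -ez; ring.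
rewrite h /M !(rmorphM, rmorphB, rmorphD, rmorphXn, rmorph_nat) /= -ez; ring.
Qed.
End Doubling2Adic.

(** Powers of 2 repeat modulo n, so torsion can be detected by looking at iterated doublings
    alone. *)
Lemma torsion_pow2 (G : zmodType) (x : G) n : (0 < n)%nt -> (x *+ n)%ri = 0%ri ->
  exists i j, (i < j)%nt /\ (x *+ expn 2 i = x *+ expn 2 j)%ri.
Proof.
move=> hn hx; pose f (i : 'I_n.+1) : 'I_n := Ordinal (ltn_pmod (expn 2 i) hn).
have /injectivePn[i [j hij hf]] : ~~ injectiveb f.
  by apply/negP => /injectiveP/leq_card; rewrite !card_ord ltnn.
have e k : (x *+ expn 2 k = x *+ (expn 2 k %% n))%ri.
  by rewrite {1}(divn_eq (expn 2 k) n) mulrnDr mulnC mulrnA hx mul0rn add0r.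
have eij : (x *+ expn 2 i = x *+ expn 2 j)%ri.
  by rewrite e [RHS]e; have := congr1 val hf => /= ->.
case: (ltngtP i j) => h; first by exists i, j.
  by exists j, i; split.
by case/eqP: hij; apply: val_inj.
Qed.

Section NonTorsion2Adic.
Variables (al mu a b : rat) (p2 p1 p0 : int).
Hypothesis mu0 : mu != 0.
Hypothesis h2 : 3 * al = mu * p2%:~R.
Hypothesis h1 : 3 * al ^+ 2 + a = mu ^+ 2 * p1%:~R.
Hypothesis h0 : cubic a b al = mu ^+ 3 * p0%:~R.
Hypothesis ns : 4 * a ^+ 3 + 27 * b ^+ 2 != 0.
Local Notation G := (ecpt ns).

Definition xval2neg k (P : G) : Prop := exists xi y, ecval P = Some (al + mu * xi, y) /\ val2neg k xi.

Lemma xval2neg_double k P : xval2neg k.+1 P -> xval2neg k.+3 (P + P).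
Proof.
case=> xi [y [e hxi]]; have := ec_on P; rewrite e => /on_shortE hon.
have hc := val2neg_cubic mu0 h2 h1 h0 hxi.
have [[e2 _]|[r [h er]]] := @padd_shortP _ _ (al + mu * xi, y) (al + mu * xi, y) hon hon.
  case: e2 => e2; move: hc; rewrite -hon; suff -> : y = 0 by rewrite expr0n.
  have : 2 * y = 0 by rewrite mulr2n mulrDl !mul1r {2}e2 subrr.
  by move/eqP; rewrite mulf_eq0 => /orP[]// /eqP.
exists ((r.1 - al) / mu), (- r.2); split.
  by rewrite ecvalD e er mulrCA mulfV // mulr1 addrC subrK.
apply: (val2neg_double mu0 h2 h1 h0 hxi).
by have := tangent_x h => /= <-; congr (_ * _); rewrite mulrCA mulfV // mulr1 addrC subrK.
Qed.

Lemma xval2neg_pow2 k P j : xval2neg k.+1 P -> xval2neg (k + j.*2).+1 (P *+ expn 2 j).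
Proof.
elim: j => [|j IH] h; first by rewrite addn0 mulr1n.
have -> : expn 2 j.+1 = (expn 2 j + expn 2 j)%nt by rewrite expnS mul2n addnn.
by rewrite mulrnDr doubleS !addnS; apply: xval2neg_double; apply: IH.
Qed.

Lemma xval2neg_nontorsion k P n : xval2neg k.+1 P -> (0 < n)%nt -> P *+ n <> 0.
Proof.
move=> h hn /(torsion_pow2 hn)[i [j [hij e]]].
have [xi [y [e1 v1]]] := xval2neg_pow2 i h; have [xi' [y' [e2 v2]]] := xval2neg_pow2 j h.
move: e2; rewrite -e e1 => -[/addrI/(mulfI mu0) exi _].
by rewrite exi in v1; have := val2neg_uniq v1 v2; lia.
Qed.
End NonTorsion2Adic.

Lemma int_parity (x : int) : (exists k, x = 2 * k) \/ oddz x.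
Proof.
case ho : (odd (absz x)); [right; exact: oddzP | left; exists (divz x 2)].
have : x \in dvdz 2 by rewrite dvdzE /= dvdn2 ho.
by move=> /divzK <-; rewrite mulzK // mulrC.
Qed.

Lemma even_not_oddz k : oddz (2 * k) -> False.
Proof. by case=> l; lia. Qed.

(** If all four values were divisible by 4, so would be their differences 6 n3, 6 n3 + 2 n2 and n3 +
    n2 + n1, and then every coefficient would be even. *)
Lemma primitive_cubic_value (n3 n2 n1 n0 : int) : oddz n3 \/ oddz n2 \/ oddz n1 \/ oddz n0 ->
  exists2 c, (c < 4)%nt & exists e o, [/\ (e < 2)%nt, oddz o &
    n3 * c%:Z ^+ 3 + n2 * c%:Z ^+ 2 + n1 * c%:Z + n0 = 2 ^+ e * o].
Proof.
move=> hodd; pose g (c : nat) := n3 * c%:Z ^+ 3 + n2 * c%:Z ^+ 2 + n1 * c%:Z + n0.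
have split4 (x : int) : (exists k, x = 4 * k) \/ exists e o, [/\ (e < 2)%nt, oddz o & x = 2 ^+ e * o].
  case: (int_parity x) => [[k ek]|ho]; last by right; exists 0%nt, x; rewrite mul1r.
  case: (int_parity k) => [[l el]|ho]; first by left; exists l; rewrite ek el; ring.
  by right; exists 1%nt, k; rewrite ek.
case: (split4 (g 0%nt)) => [[k0 e0]|h]; last by exists 0%nt.
case: (split4 (g 1%nt)) => [[k1 e1]|h]; last by exists 1%nt.
case: (split4 (g 2%nt)) => [[k2 e2]|h]; last by exists 2%nt.
case: (split4 (g 3%nt)) => [[k3 e3]|h]; last by exists 3%nt.
exfalso; rewrite /g in e0 e1 e2 e3.
have a0 : n0 = 4 * k0 by move: e0; rewrite !mulr0 !add0r.
have a1 : n3 + n2 + n1 + n0 = 4 * k1 by rewrite -e1; ring.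
have a2 : 8 * n3 + 4 * n2 + 2 * n1 + n0 = 4 * k2 by rewrite -e2; ring.
have a3 : 27 * n3 + 9 * n2 + 3 * n1 + n0 = 4 * k3 by rewrite -e3; ring.
clear e0 e1 e2 e3 g.
by case: hodd => [|[|[|]]] [k]; lia.
Qed.

(** Only the 2-part of the content is removed; a common odd factor does no harm to parity
    arguments. *)
Lemma primitive_scaling (gA gB gC gD : rat) : gA != 0 -> exists (la : rat) (n3 n2 n1 n0 : int),
  [/\ la != 0, oddz n3 \/ oddz n2 \/ oddz n1 \/ oddz n0 &
    [/\ gA = la * n3%:~R, gB = la * n2%:~R, gC = la * n1%:~R & gD = la * n0%:~R]].
Proof.
move=> hA; pose L := denq gA * denq gB * denq gC * denq gD.
have L0 : (L%:~R : rat) != 0 by rewrite intr_eq0 !mulf_neq0 ?denq_neq0.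
pose f (i : 'I_4) := nth 0 [:: numq gA * (denq gB * denq gC * denq gD);
  numq gB * (denq gA * denq gC * denq gD); numq gC * (denq gA * denq gB * denq gD);
  numq gD * (denq gA * denq gB * denq gC)] i.
have [|t [n [hn [i hi]]]] := @common_pow2 4 f.
  by exists ord0; apply/eqP; rewrite /f /= !mulf_neq0 ?denq_neq0 ?numq_eq0.
exists (2 ^+ t / L%:~R), (n (inord 0)), (n (inord 1)), (n (inord 2)), (n (inord 3)).
have en k (hk : (k < 4)%nt) : 2 ^+ t / L%:~R * (n (inord k))%:~R = (f (inord k))%:~R / L%:~R :> rat.
  by rewrite hn expn_Posz intrM ?rmorphXn /=; ring.
split; first by rewrite mulf_neq0 ?expf_neq0 ?invr_eq0.
  have := oddzP hi; have -> : i = inord i by apply: val_inj; rewrite /= inordK.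
  by case: i {hi} => -[|[|[|[|]]]] //= _; tauto.
by split; rewrite en // /f inordK //= intrM -rat_num_den /L; apply: (mulIf L0);
  rewrite mulfVK // /L !intrM; ring.
Qed.

(** Numerator and denominator of w are both odd, hence congruent modulo 4 up to sign. Choosing the
    sign of w will mean choosing between a point and its negative. *)
Lemma square_ratio (u v : int) (w : rat) : oddz u -> oddz v -> w ^+ 2 * u%:~R = v%:~R ->
  exists m n s, [/\ oddz n, m = n + 4 * s & w * n%:~R = m%:~R \/ - w * n%:~R = m%:~R].
Proof.
move=> hu hv hw; set m := numq w; set n := denq w.
have e : m ^+ 2 * u = n ^+ 2 * v.
  have em : m%:~R = w * n%:~R := esym (rat_num_den w).
  by apply: (@intr_inj rat); rewrite !intrM ?rmorphXn /= -hw em; ring.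
have hcop : coprime (absz m) (absz n) by exact: coprime_num_den.
have both : (exists k, m = 2 * k) -> (exists k, n = 2 * k) -> False.
  move=> [k ek] [l el]; move: hcop; rewrite ek el !abszM /coprime -muln_gcdr => /eqP.
  by move: (gcdn _ _) => g; lia.
have hm : oddz m.
  case: (int_parity m) => // -[k ek]; exfalso; case: (int_parity n) => [h|h].
    by apply: both => //; exists k.
  apply: (@even_not_oddz (k * m * u)); have := oddzM (oddzX 2 h) hv.
  by rewrite -e [m ^+ 2]expr2 {1}ek => h'; have -> : 2 * (k * m * u) = 2 * k * m * u by ring.
have hn : oddz n.
  case: (int_parity n) => // -[k ek]; exfalso.
  apply: (@even_not_oddz (k * n * v)); have := oddzM (oddzX 2 hm) hu.
  by rewrite e [n ^+ 2]expr2 {1}ek => h'; have -> : 2 * (k * n * v) = 2 * k * n * v by ring.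
have [p ep] := hm; have [q eq] := hn.
have ew : w * n%:~R = m%:~R by rewrite rat_num_den.
case: (int_parity (p - q)) => -[s es].
  by exists m, n, s; split=> //; [rewrite ep eq; lia | left].
exists (- m), n, (- (s + q + 1)); split => //; first by rewrite ep eq; lia.
by right; rewrite mulNr ew rmorphN.
Qed.

Section ProgressionDifferences.
Variables (al de a b la : rat) (n3 n2 n1 n0 : int).
Hypothesis (de0 : de != 0) (la0 : la != 0).
Hypothesis e3 : de ^+ 3 = la * n3%:~R.
Hypothesis e2 : 3 * al * de ^+ 2 = la * n2%:~R.
Hypothesis e1 : (3 * al ^+ 2 + a) * de = la * n1%:~R.
Hypothesis e0 : cubic a b al = la * n0%:~R.
Hypothesis ns : 4 * a ^+ 3 + 27 * b ^+ 2 != 0.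
Let g (t : int) : int := n3 * t ^+ 3 + n2 * t ^+ 2 + n1 * t + n0.

Lemma cubic_progression (t : int) : cubic a b (al + t%:~R * de) = la * (g t)%:~R.
Proof.
rewrite /g !(intrD, intrM) ?rmorphXn /=.
have -> : la * (n3%:~R * t%:~R ^+ 3 + n2%:~R * t%:~R ^+ 2 + n1%:~R * t%:~R + n0%:~R) =
  la * n3%:~R * t%:~R ^+ 3 + la * n2%:~R * t%:~R ^+ 2 + la * n1%:~R * t%:~R + la * n0%:~R :> rat by ring.
by rewrite -e3 -e2 -e1 -e0 /cubic; ring.
Qed.

Variables (c : nat) (e : nat) (o : int).
Hypotheses (he : (e < 2)%nt) (ho : oddz o) (hg : g c%:Z = 2 ^+ e * o).

(** A multiple of 4 cannot disturb an exact 2-power 2^e with e < 2; this is why residue classes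
    modulo 4 are used. *)
Lemma value_mod4 (k : int) : exists2 o', oddz o' & g (c%:Z + 4 * k) = 2 ^+ e * o'.
Proof.
have [S hS] : exists S, g (c%:Z + 4 * k) = g c%:Z + 4 * S.
  by rewrite /g; exists (n3 * k * (3 * c%:Z ^+ 2 + 12 * c%:Z * k + 16 * k ^+ 2) +
    n2 * k * (2 * c%:Z + 4 * k) + n1 * k); ring.
rewrite hS hg; case: e he => [|[|]] // _.
  by exists (o + 2 * (2 * S)); [exact: oddz_add2 | ring].
by exists (o + 2 * S); [exact: oddz_add2 | ring].
Qed.

(** The sign makes y' / yc congruent to 1 modulo 4, so the sum of two ordinates so chosen is 2 yc
    times a quotient of odd integers. *)
Lemma signed_root (yc y : rat) (k : int) : yc ^+ 2 = la * (g c%:Z)%:~R ->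
  y ^+ 2 = la * (g (c%:Z + 4 * k))%:~R ->
  exists y' m n s, [/\ y' ^+ 2 = y ^+ 2, oddz n, m = n + 4 * s & y' * n%:~R = yc * m%:~R].
Proof.
move=> hyc hy; have [o' ho' eo'] := value_mod4 k.
have yc0 : yc != 0.
  have : yc ^+ 2 != 0.
    by rewrite hyc hg; apply: mulf_neq0 => //; rewrite intr_eq0; apply: mulf_neq0; [exact: expf_neq0 | exact: oddz_neq0].
  by apply: contra => /eqP ->; rewrite expr0n.
have hw : (y / yc) ^+ 2 * o%:~R = o'%:~R.
  have p0 : la * (2 ^+ e) != 0 by rewrite mulf_neq0 ?expf_neq0.
  apply: (mulfI p0); rewrite expr_div_n.
  have -> : la * 2 ^+ e * (y ^+ 2 / yc ^+ 2 * o%:~R) = (y ^+ 2 / yc ^+ 2) * (la * (g c%:Z)%:~R).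
    by rewrite hg intrM ?rmorphXn /=; ring.
  by rewrite -hyc mulfVK ?expf_neq0 // hy eo' intrM ?rmorphXn /=; ring.
have [m [n [s [hn hm hwn]]]] := square_ratio ho ho' hw.
case: hwn => h; [exists y | exists (- y)]; exists m, n, s; split; rewrite ?sqrrN //.
  by rewrite -h; field.
by rewrite -h; field.
Qed.

(** The chord for P - Q has slope (y + y') / (x1 - x2), with y + y' equal to 2 yc times an odd
    fraction and x1 - x2 = 4 (k - l) de. In the coordinate [xi] its square has valuation e - 2 - 2
    v(k - l) < 0, and the other terms of the addition formula contribute the integer [Z]. *)
Lemma difference_nontorsion (P Q : ecpt ns) (k l : int) (yc y y' : rat) (m n s m' n' s' : int) :
  k != l -> yc ^+ 2 = la * (g c%:Z)%:~R ->
  ecval P = Some (al + (c%:Z + 4 * k)%:~R * de, y) -> ecval Q = Some (al + (c%:Z + 4 * l)%:~R * de, y') ->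
  oddz n -> m = n + 4 * s -> y * n%:~R = yc * m%:~R ->
  oddz n' -> m' = n' + 4 * s' -> y' * n'%:~R = yc * m'%:~R ->
  forall j, (0 < j)%nt -> (P - Q) *+ j <> 0.
Proof.
move=> hkl hyc eP eQ hn hm hy hn' hm' hy' j hj.
(* The term of index t then has [xi] = n3 t, the substitution that turns n3^2 g into a monic
   integral cubic. *)
pose mu := la / de ^+ 2.
have d2 : de ^+ 2 != 0 by rewrite expf_neq0.
have mu0 : mu != 0 by rewrite mulf_neq0 ?invr_eq0.
have h2 : 3 * al = mu * n2%:~R by apply: (mulIf d2); rewrite e2 /mu; field.
have h1 : 3 * al ^+ 2 + a = mu ^+ 2 * (n3 * n1)%:~R.
  rewrite intrM; have -> : mu ^+ 2 * (n3%:~R * n1%:~R) = (la * n3%:~R) * (la * n1%:~R) / de ^+ 4.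
    by rewrite /mu; field.
  by rewrite -e3 -e1; field.
have h0 : cubic a b al = mu ^+ 3 * (n3 ^+ 2 * n0)%:~R.
  rewrite intrM ?rmorphXn /=.
  have -> : mu ^+ 3 * (n3%:~R ^+ 2 * n0%:~R) = (la * n3%:~R) ^+ 2 * (la * n0%:~R) / de ^+ 6.
    by rewrite /mu; field.
  by rewrite -e3 -e0; field.
suff [t ht] : exists t, xval2neg al mu t.+1 (P - Q).
  exact: (xval2neg_nontorsion mu0 h2 h1 h0 ht hj).
have hd : k - l != 0 by rewrite subr_eq0.
have [f [o1 [ho1 ed]]] := odd_part hd.
set i1 := (c%:Z + 4 * k) in eP; set i2 := (c%:Z + 4 * l) in eQ.
have ei : i1 - i2 = 4 * (k - l) by rewrite /i1 /i2; ring.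
clearbody i1 i2.
set x1 := al + i1%:~R * de in eP; set x2 := al + i2%:~R * de in eQ.
have ex : x1 - x2 = 4 * (k - l)%:~R * de.
  have -> : x1 - x2 = (i1 - i2)%:~R * de by rewrite /x1 /x2 intrB; ring.
  by rewrite ei intrM.
have x12 : x1 - x2 != 0 by rewrite ex !mulf_neq0 // intr_eq0.
have := ec_on P; rewrite eP => /on_shortE hP; have := ec_on (- Q); rewrite ecvalN eQ pneg_shortE => /on_shortE hQ.
have [[[e12 _] _]|[r [hr er]]] := @padd_shortP _ _ (x1, y) (x2, - y') hP hQ.
  by move: x12; rewrite e12 /= subrr eqxx.
have [t ht] : exists t, val2neg t.+1 ((r.1 - al) / mu); last first.
  exists t, ((r.1 - al) / mu), (- r.2); split => //.
  by rewrite ecvalD ecvalN eP eQ pneg_shortE er mulrCA mulfV // mulr1 addrC subrK.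
case: hr => lam [cc /= [[g1 g2 g3] [g4 g5 g6]]].
have elam : lam * (x1 - x2) = y + y' by rewrite -[y']opprK g1 g2; ring.
have er1 : r.1 = lam ^+ 2 - x1 - x2 by rewrite g4; ring.
pose u := n * n' + 2 * (s * n' + s' * n).
have hu : oddz u by apply: oddz_add2; apply: oddzM.
have eu : (y + y') * (n * n')%:~R = yc * (2 * u)%:~R.
  have -> : (y + y') * (n * n')%:~R = y * n%:~R * n'%:~R + y' * n'%:~R * n%:~R by rewrite intrM; ring.
  by rewrite hy hy' hm hm' /u !(intrD, intrM); ring.
pose Z := n2 + n3 * (i1 + i2).
have key : (r.1 - al) / mu * (4 * (k - l)%:~R ^+ 2 * (n * n')%:~R ^+ 2) =
   (g c%:Z)%:~R * u%:~R ^+ 2 - Z%:~R * (4 * (k - l)%:~R ^+ 2 * (n * n')%:~R ^+ 2).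
  have la4 : 4 * la != 0 by rewrite mulf_neq0.
  apply: (mulfI la4); rewrite er1.
  have -> : 4 * la * ((lam ^+ 2 - x1 - x2 - al) / mu * (4 * (k - l)%:~R ^+ 2 * (n * n')%:~R ^+ 2)) =
     (lam * (4 * (k - l)%:~R * de) * (n * n')%:~R) ^+ 2
     - (x1 + x2 + al) * de ^+ 2 * (16 * (k - l)%:~R ^+ 2 * (n * n')%:~R ^+ 2).
    by rewrite /mu; field; rewrite la0 de0.
  rewrite -ex elam eu.
  have -> : (x1 + x2 + al) * de ^+ 2 = la * Z%:~R.
    rewrite /x1 /x2 /Z !(intrD, intrM).
    have -> : la * (n2%:~R + n3%:~R * (i1%:~R + i2%:~R)) = la * n2%:~R + la * n3%:~R * (i1%:~R + i2%:~R) by ring.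
    by rewrite -e2 -e3; ring.
  have -> : (yc * (2 * u)%:~R) ^+ 2 = 4 * yc ^+ 2 * u%:~R ^+ 2 by rewrite intrM; ring.
  by rewrite hyc; ring.
pose V := (o1 * (n * n')) ^+ 2.
have hV : oddz V by apply: oddzX; apply: oddzM => //; apply: oddzM.
have eV : (k - l)%:~R ^+ 2 * (n * n')%:~R ^+ 2 = 2 ^+ f ^+ 2 * V%:~R :> rat.
  by rewrite ed /V !(intrM, rmorphXn) /=; ring.
have e4 : 4 * (k - l)%:~R ^+ 2 * (n * n')%:~R ^+ 2 = 4 * (2 ^+ f ^+ 2 * V%:~R) :> rat by rewrite -eV mulrA.
rewrite e4 hg in key; clearbody V u Z.
move: he key; case: (e) => [|[|]] // _ key.
  exists (f + f).+1, (o * u ^+ 2 + 2 * (- (Z * (2 * 2 ^+ f ^+ 2 * V)))), V; split => //.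
    by apply: oddz_add2; apply: oddzM => //; apply: oddzX.
  have -> : 2 ^+ (f + f).+2 * V%:~R = 4 * (2 ^+ f ^+ 2 * V%:~R) :> rat.
    by rewrite !exprS exprD; ring.
  by rewrite key !(rmorphD, rmorphN, rmorphM, rmorphXn) /=; ring.
exists (f + f)%nt, (o * u ^+ 2 + 2 * (- (Z * (2 ^+ f ^+ 2 * V)))), V; split => //.
  by apply: oddz_add2; apply: oddzM => //; apply: oddzX.
have two0 : (2 : rat) != 0 by [].
apply: (mulfI two0).
have -> : 2 * ((r.1 - al) / mu * (2 ^+ (f + f).+1 * V%:~R)) =
  (r.1 - al) / mu * (4 * (2 ^+ f ^+ 2 * V%:~R)) by rewrite !exprS exprD; ring.
by rewrite key !(rmorphD, rmorphN, rmorphM, rmorphXn) /=; ring.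
Qed.
End ProgressionDifferences.

Lemma progression_subsequence (a b al de : rat) (ns : 4 * a ^+ 3 + 27 * b ^+ 2 != 0) (N : nat) :
  de != 0 -> (forall i, (i < N)%nt -> exists y, y ^+ 2 = cubic a b (al + i%:R * de)) ->
  exists2 c, (c < 4)%nt & exists Q : nat -> ecpt ns,
    (forall k, (c + 4 * k < N)%nt -> exists y, ecval (Q k) = Some (al + (c + 4 * k)%:R * de, y)) /\
    forall k l j, (c + 4 * k < N)%nt -> (c + 4 * l < N)%nt -> k != l -> (0 < j)%nt -> (Q k - Q l) *+ j <> 0.
Proof.
move=> de0 hP.
have d30 : de ^+ 3 != 0 by rewrite expf_neq0.
have [la [n3 [n2 [n1 [n0 [la0 hodd [e3 e2 e1 e0]]]]]]] :=
  primitive_scaling (3 * al * de ^+ 2) ((3 * al ^+ 2 + a) * de) (cubic a b al) d30.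
have [c hc [e [o [he ho hg]]]] := primitive_cubic_value hodd.
exists c => //.
have cubE := cubic_progression e3 e2 e1 e0.
have [hcN|hcN] := ltnP c N; last first.
  by exists (fun=> 0); split => [k|k l j] h; have := leq_ltn_trans (leq_addr _ _) h; rewrite ltnNge hcN.
have [yc hyc] := hP c hcN; rewrite pmulrn cubE in hyc.
have ec k : (c + 4 * k)%nt%:R = (c%:Z + 4 * k%:Z)%:~R :> rat by rewrite pmulrn PoszD PoszM.
pose good k (P : ecpt ns) := exists y m n s, [/\ ecval P = Some (al + (c%:Z + 4 * k%:Z)%:~R * de, y), oddz n,
  m = n + 4 * s & y * n%:~R = yc * m%:~R].
have ex k : exists P : ecpt ns, (c + 4 * k < N)%nt -> good k P.
  have [hk|hk] := ltnP (c + 4 * k) N; last by exists 0.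
  have [y hy] := hP _ hk.
  rewrite ec cubE in hy.
  have [y' [m [n [s [hy' hn hm hyn]]]]] := signed_root la0 he ho hg hyc hy.
  have hon : on_curve (shortW a b) (Some (al + (c%:Z + 4 * k%:Z)%:~R * de, y')).
    by apply/on_shortE; rewrite hy' hy cubE.
  by exists (ec_mk ns hon) => _; exists y', m, n, s.
have [Q hQ] := choice_fun ex; exists Q; split => [k hk|k l j hk hl hkl hj].
  have [y [m [n [s [h _ _ _]]]]] := hQ k hk; exists y.
  by rewrite h ec.
have [y [m [n [s [h h1 h2 h3]]]]] := hQ k hk; have [y' [m' [n' [s' [h' h1' h2' h3']]]]] := hQ l hl.
have hkl' : Posz k != Posz l by [].
exact: (difference_nontorsion de0 la0 e3 e2 e1 e0 he ho hg hkl' hyc h h' h1 h2 h3 h1' h2' h3' hj).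
Qed.

(** * Heights of points in linear relation *)

Lemma den_dvd_lead (p : {poly int}) (x : rat) : root (map_poly intr p) x ->
  lead_coef p \in dvdz (denq x).
Proof.
have [->|p0] := eqVneq p 0; first by rewrite lead_coef0 dvdz0.
move=> /rootP; have szp : (size p = (size p).-1.+1)%nt by rewrite prednK // size_poly_gt0.
rewrite horner_coef size_map_inj_poly ?rmorph0 //; last exact: intr_inj.
set n := (size p).-1 in szp *; rewrite szp big_ord_recr /= => h.
have hd : (denq x)%:~R != 0 :> rat by rewrite intr_eq0 denq_neq0.
have e : lead_coef p * numq x ^+ n = denq x * (- \sum_(i < n) p`_i * numq x ^+ i * denq x ^+ (n - i.+1)).
  apply: (@intr_inj rat); rewrite [in RHS]intrM rmorphN /= rmorph_sum /=.
  rewrite intrM rmorphXn /= -rat_num_den /lead_coef -/n.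
  have := congr1 (fun z => z * (denq x)%:~R ^+ n) h; rewrite mul0r mulrDl.
  move/eqP; rewrite addrC addr_eq0 coef_map /= => /eqP; rewrite exprMn mulrA => ->.
  rewrite mulrN mulr_suml mulr_sumr; congr (- _); apply: eq_bigr => i _.
  rewrite coef_map /= !intrM !rmorphXn /= -rat_num_den exprMn.
  have -> : (denq x)%:~R ^+ n = (denq x)%:~R * (denq x)%:~R ^+ i * (denq x)%:~R ^+ (n - i.+1) :> rat.
    by rewrite -exprS -exprD subnKC.
  by ring.
have : lead_coef p * numq x ^+ n \in dvdz (denq x) by rewrite e dvdz_mulr.
rewrite Gauss_dvdzl // coprimezXr //.
by rewrite coprimez_sym; exact: coprime_num_den.
Qed.

(** The rational root theorem bounds the denominator by the leading coefficient; applied to the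
    reversed polynomial and 1/x it bounds the numerator. *)
Lemma ht_root_le (p : {poly int}) (x : rat) (B : nat) : p != 0 -> root (map_poly intr p) x ->
  (forall i, (absz (p`_i)%ri <= B)%nt) -> (ht x <= B)%nt.
Proof.
move=> p0 hr hB; have lead_le (q : {poly int}) z : q != 0 -> root (map_poly intr q) z ->
    (absz (denq z) <= absz (lead_coef q))%nt.
  move=> q0 /den_dvd_lead; rewrite dvdzE; apply: dvdn_leq.
  by rewrite absz_gt0 lead_coef_eq0.
have hden : (absz (denq x) <= B)%nt by apply: leq_trans (lead_le _ _ p0 hr) (hB _).
have [x0|x0] := eqVneq x 0.
  by rewrite x0 in hden *; rewrite /ht geq_max hden.
have [n szp] : exists n, size p = n.+1 by exists (size p).-1; rewrite prednK // size_poly_gt0.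
pose q := \poly_(i < n.+1) p`_(n - i).
have q0 : q != 0.
  apply/eqP => /(congr1 (fun r : {poly int} => r`_0)); rewrite coef_poly coef0 subn0 /=.
  have -> : p`_n = lead_coef p by rewrite /lead_coef szp.
  by move/eqP; rewrite lead_coef_eq0 (negPf p0).
have hq : root (map_poly intr q) x^-1.
  rewrite /root; have szq : (size (map_poly intr q : {poly rat}) <= n.+1)%nt.
    by apply: leq_trans (size_poly _ _) (size_poly _ _).
  rewrite (horner_coef_wide _ szq) (reindex_inj rev_ord_inj) /=.
  move: hr; rewrite /root horner_coef size_map_inj_poly ?rmorph0 //; last exact: intr_inj.
  rewrite szp => /eqP h; apply/eqP.
  transitivity ((\sum_(i < n.+1) (map_poly intr p)`_i * x ^+ i) * x^-1 ^+ n); last by rewrite h mul0r.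
  rewrite mulr_suml; apply: eq_bigr => i _.
  have hi : (i <= n)%nt by rewrite -ltnS.
  rewrite !coef_map /= coef_poly subSS ltnS leq_subr subKn // -mulrA; congr (_ * _).
  have -> : x^-1 ^+ n = x^-1 ^+ i * x^-1 ^+ (n - i) by rewrite -exprD subnKC.
  by rewrite mulrA -exprMn mulfV // expr1n mul1r.
have hnum : (absz (denq x^-1) <= B)%nt.
  apply: leq_trans (lead_le _ _ q0 hq) _; rewrite /lead_coef coef_poly; case: ifP => // _.
rewrite /ht geq_max hden andbT; apply: leq_trans hnum.
have nx0 : numq x != 0 by rewrite numq_eq0.
have [|k [ed en]] := @frac_scale x^-1 (denq x) (numq x) nx0.
  by rewrite -rat_num_den mulrA mulVf // mul1r.
have : (absz k %| 1)%nt.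
  rewrite -(eqP (coprime_num_den x)) dvdn_gcd {1}en ed !abszM.
  by rewrite !dvdn_mulr.
by rewrite dvdn1 => /eqP hk; rewrite en abszM hk mul1n.
Qed.

Lemma hQ_root (p : {poly rat}) (x : rat) (d : nat) (K : R) : p != 0 -> root p x -> (size p <= d)%nt ->
  (forall i, hQ (p`_i)%ri <= K)%R -> (hQ x <= INR d * K)%R.
Proof.
move=> p0 hr hd hK.
pose L := \prod_(j < d) denq p`_j.
pose c (i : 'I_d) := numq p`_i * \prod_(j < d | j != i) denq p`_j.
pose q : {poly int} := \poly_(i < d) (if insub i is Some j then c j else 0).
have L0 : (L%:~R : rat) != 0.
  by rewrite intr_eq0; apply/prodf_neq0 => j _; exact: denq_neq0.
have hc (i : 'I_d) : (c i)%:~R = L%:~R * p`_i :> rat.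
  by rewrite /c /L [in RHS](bigD1 i) //= !intrM -rat_num_den; ring.
have eq : map_poly intr q = L%:~R *: p.
  apply/polyP => i; rewrite coef_map coefZ coef_poly /=.
  case: ltnP => hi; first by rewrite (insubT (fun k => k < d)%nt hi) hc.
  by rewrite nth_default ?mulr0 //; apply: leq_trans hd hi.
pose B := (\prod_(j < d) ht p`_j)%nt.
have hB i : (absz (q`_i)%ri <= B)%nt.
  rewrite coef_poly; case: ltnP => // hi; rewrite (insubT (fun k => k < d)%nt hi).
  set j := Sub _ _; rewrite /c abszM /B [X in (_ <= X)%nt](bigD1 j) //= leq_mul ?leq_maxl //.
  have -> : absz (\prod_(k < d | k != j) denq p`_k) = (\prod_(k < d | k != j) absz (denq p`_k))%nt.
    by apply: (big_morph absz) => // u v; exact: abszM.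
  by apply: leq_prod => k _; exact: leq_maxr.
have q0 : q != 0.
  apply: contra p0 => /eqP q0; move: eq; rewrite q0 rmorph0 => /esym/eqP.
  by rewrite scaler_eq0 (negPf L0).
have hx : (ht x <= B)%nt.
  by apply: ht_root_le q0 _ hB; rewrite eq /root hornerZ (eqP hr) mulr0.
rewrite hQE; apply: Rle_trans (lnN_le (ht_gt0 x) hx) _; rewrite /B.
elim: d {L c q L0 hc eq B hB q0 hx hd} => [|n IH]; first by rewrite big_ord0 /lnN ln_1 /=; lra.
rewrite big_ord_recr [X in lnN X]/= lnN_mul ?ht_gt0 //; last by apply: prodn_gt0 => j; exact: ht_gt0.
rewrite S_INR; apply: Rle_trans (Rplus_le_compat _ _ _ _ IH (hK n)) _; lra.
Qed.

Lemma ht_int (z : int) : ht z%:~R = maxn (absz z) 1.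
Proof. by rewrite /ht numq_int denq_int. Qed.

Lemma ht_frac_le (x : rat) (p q : int) : q != 0 -> x * q%:~R = p%:~R ->
  (ht x <= maxn (absz p) (absz q))%nt.
Proof.
move=> q0 /(frac_scale q0)[k [ep eq]].
have k0 : (0 < absz k)%nt by rewrite absz_gt0; apply: contra q0 => /eqP k0; rewrite eq k0 mul0r.
by rewrite ep eq !abszM -maxnMr leq_pmull.
Qed.

Lemma ht_mul x y : (ht (x * y) <= ht x * ht y)%nt.
Proof.
apply: leq_trans (@ht_frac_le (x * y) (numq x * numq y) (denq x * denq y) _ _) _.
- by rewrite mulf_neq0 ?denq_neq0.
- by rewrite !intrM -!rat_num_den; ring.
by rewrite !abszM geq_max !leq_mul ?ht_num ?ht_den.
Qed.

Lemma ht_add x y : (ht (x + y) <= 2 * (ht x * ht y))%nt.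
Proof.
apply: leq_trans (@ht_frac_le (x + y) (numq x * denq y + numq y * denq x) (denq x * denq y) _ _) _.
- by rewrite mulf_neq0 ?denq_neq0.
- by rewrite intrD !intrM -!rat_num_den; ring.
rewrite geq_max; apply/andP; split.
  apply: leq_trans (leq_abszD _ _) _; rewrite mul2n -addnn !abszM.
  by apply: leq_add; [|rewrite mulnC]; apply: leq_mul; rewrite ?ht_num ?ht_den.
by rewrite abszM mul2n -addnn (leq_trans (leq_mul (ht_den x) (ht_den y))) // leq_addr.
Qed.

Lemma ht_opp x : ht (- x) = ht x.
Proof. by rewrite /ht numqN denqN abszN. Qed.

Lemma ln2_le1 : (lnN 2 <= 1)%R.
Proof.
rewrite /lnN -[X in (_ <= X)%R]ln_exp; have := exp_ineq1 1 ltac:(lra) => h.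
by left; apply: ln_increasing => /=; lra.
Qed.

Lemma hQ_mul x y : (hQ (x * y)%ri <= hQ x + hQ y)%R.
Proof.
rewrite !hQE -lnN_mul ?ht_gt0 //; apply: lnN_le; [exact: ht_gt0 | exact: ht_mul].
Qed.

Lemma hQ_add x y : (hQ (x + y)%ri <= hQ x + hQ y + 1)%R.
Proof.
have := lnN_le (ht_gt0 _) (ht_add x y); rewrite !lnN_mul ?muln_gt0 ?ht_gt0 // !hQE.
by have := ln2_le1; lra.
Qed.

Lemma hQ_opp x : hQ (- x)%ri = hQ x. Proof. by rewrite !hQE ht_opp. Qed.

Lemma hQ0 : hQ 0%ri = 0%R. Proof. exact: ln_1. Qed.
Lemma hQ1 : hQ 1%ri = 0%R. Proof. exact: ln_1. Qed.

Lemma hQ_inv x : hQ (x^-1)%ri = hQ x.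
Proof.
have [->|x0] := eqVneq x 0; first by rewrite invr0.
suff le1 (z : rat) : z != 0 -> (hQ (z^-1)%ri <= hQ z)%R.
  by apply: Rle_antisym; [exact: le1 | rewrite -{1}(invrK x); apply: le1; rewrite invr_eq0].
move=> z0; rewrite !hQE; apply: lnN_le; first exact: ht_gt0.
apply: leq_trans (@ht_frac_le z^-1 (denq z) (numq z) _ _) _; first by rewrite numq_eq0.
  by rewrite -rat_num_den mulrA mulVf // mul1r.
by rewrite maxnC.
Qed.

Section PolyHeight.
Variable X : R.
Hypothesis X1 : (1 <= X)%R.

(** The factor k depends on the shape of the polynomial and not on its coefficients, which makes the
    later height bounds uniform in X. *)
Definition polyht (d : nat) (k : R) (p : {poly rat}) : Prop :=
  (size p <= d.+1)%nt /\ forall i, (hQ (p`_i)%ri <= k * X)%R.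

Lemma polyht_const c k : (hQ c <= k * X)%R -> (0 <= k)%R -> polyht 0 k c%:P.
Proof.
move=> h k0; split; first exact: size_polyC_leq1.
move=> i; rewrite coefC; case: eqP => _ //; rewrite hQ0.
by apply: Rmult_le_pos; lra.
Qed.

Lemma polyht_X : polyht 1 0 'X.
Proof.
split; first by rewrite size_polyX.
by move=> i; rewrite coefX; case: eqP => _; rewrite ?hQ0 ?hQ1; lra.
Qed.

Lemma polyht_opp d k p : polyht d k p -> polyht d k (- p).
Proof. by case=> h1 h2; split; rewrite ?size_polyN // => i; rewrite coefN hQ_opp. Qed.

Lemma polyht_add d d' k k' p p' : polyht d k p -> polyht d' k' p' ->
  polyht (maxn d d') (k + k' + 1) (p + p').
Proof.
move=> [h1 h2] [h1' h2']; split.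
  apply: leq_trans (size_polyD _ _) _; rewrite geq_max; apply/andP; split.
    by apply: leq_trans h1 _; rewrite ltnS leq_maxl.
  by apply: leq_trans h1' _; rewrite ltnS leq_maxr.
move=> i; rewrite coefD; apply: Rle_trans (hQ_add _ _) _.
by apply: Rle_trans (Rplus_le_compat_r 1 _ _ (Rplus_le_compat _ _ _ _ (h2 i) (h2' i))) _; lra.
Qed.

Lemma hQ_sum n (t : nat -> rat) (B : R) : (0 <= B)%R -> (forall i, hQ (t i) <= B)%R ->
  (hQ (\sum_(i < n) t i)%ri <= INR n * (B + 1))%R.
Proof.
move=> B0 hB; elim: n => [|n IH]; first by rewrite big_ord0 hQ0 /=; lra.
rewrite big_ord_recr S_INR; apply: Rle_trans (hQ_add _ _) _.
by have := hB n => h; apply: Rle_trans (Rplus_le_compat_r 1 _ _ (Rplus_le_compat _ _ _ _ IH h)) _; lra.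
Qed.

Lemma polyht_mul d d' k k' p p' : polyht d k p -> polyht d' k' p' ->
  polyht (d + d') (INR (d + d').+1 * (k + k' + 1)) (p * p').
Proof.
move=> [h1 h2] [h1' h2'].
have hk : (0 <= k * X)%R by apply: Rle_trans (hQ_ge0 _) (h2 0%nt).
have hk' : (0 <= k' * X)%R by apply: Rle_trans (hQ_ge0 _) (h2' 0%nt).
have hs : (size (p * p')%ri <= (d + d').+1)%nt.
  by apply: leq_trans (size_polyMleq _ _) _; move: h1 h1'; lia.
split=> // i; have [hi|hi] := leqP (d + d').+1 i.
  rewrite nth_default ?hQ0; last by apply: leq_trans hs hi.
  have : (0 <= INR (d + d').+1)%R by apply: pos_INR.
  by move=> h0; rewrite Rmult_assoc; apply: Rmult_le_pos => //; lra.
rewrite coefM; apply: Rle_trans (@hQ_sum i.+1 (fun j => p`_j * p'`_(i - j)) (k * X + k' * X)%R _ _) _.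
- lra.
- by move=> j; apply: Rle_trans (hQ_mul _ _) _; apply: Rplus_le_compat.
rewrite Rmult_assoc; apply: Rmult_le_compat; [exact: pos_INR | lra | exact: INR_le | lra].
Qed.

End PolyHeight.

Ltac polyht_step X1 := lazymatch goal with
  | |- polyht _ _ _ (_ - _) => eapply polyht_add
  | |- polyht _ _ _ (_ + _) => eapply polyht_add
  | |- polyht _ _ _ (- _) => eapply polyht_opp
  | |- polyht _ _ _ (_ * _) => eapply (polyht_mul X1)
  | |- polyht _ _ _ 'X => eapply polyht_X
  | |- _ => eassumption
  end.

(* x(P + (u, v)) = (addnum u x - 2 v y) / (x - u)^2 for P = (x, y). *)
Definition addnum (a b u x : rat) := u * x ^+ 2 + (u ^+ 2 + a) * x + (a * u + 2 * b).

Section RootPolynomial.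
Variables (a b u1 v1 u2 v2 n1 n2 n3 : rat).

Definition pole2 (u : rat) : {poly rat} := ('X - u%:P) * ('X - u%:P).
Definition addnum_poly (u : rat) : {poly rat} :=
  u%:P * ('X * 'X) + (u%:P * u%:P + a%:P) * 'X + (a%:P * u%:P + 2%:P * b%:P).
Definition relA1 : {poly rat} := n1%:P * ('X * (pole2 u1 * pole2 u2)).
Definition relA2 : {poly rat} :=
  n2%:P * (pole2 u2 * addnum_poly u1) + n3%:P * (pole2 u1 * addnum_poly u2).
Definition relB : {poly rat} := 2%:P * (n2%:P * (v1%:P * pole2 u2) + n3%:P * (v2%:P * pole2 u1)).
Definition cubic_poly : {poly rat} := 'X * ('X * 'X) + a%:P * 'X + b%:P.
(** The linear relation between x(P), x(P + R1) and x(P + R2), cleared of its poles, reads A - y B =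
    0 with A = [relA1] + [relA2]; this is the norm A^2 - y^2 B^2 with y^2 replaced by the cubic. *)
Definition relpoly : {poly rat} := (relA1 + relA2) * (relA1 + relA2) - cubic_poly * (relB * relB).

Lemma size_pole2 u : size (pole2 u) = 3.
Proof. by rewrite /pole2 size_mul ?polyXsubC_eq0 // size_XsubC. Qed.

(* The leading coefficient of relpoly is [n1 ^ 2]. *)
Lemma relpoly_neq0 : n1 != 0 -> relpoly != 0.
Proof.
move=> hn; have pole0 u : pole2 u != 0 by rewrite -size_poly_eq0 size_pole2.
have s1 : size relA1 = 6.
  rewrite /relA1 size_Cmul // ['X * _]mulrC size_mulX; last by apply: mulf_neq0.
  by rewrite size_mul ?pole0 // !size_pole2.
have sX2 : (size ('X * 'X : {poly rat})%ri <= 3)%nt by rewrite size_mulX ?polyX_eq0 // size_polyX.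
have sC (c : rat) p : (size (c%:P * p)%ri <= size p)%nt.
  apply: leq_trans (size_polyMleq _ _) _; have := size_polyC_leq1 c.
  by case: (size c%:P) => [|[|]] //= _; rewrite leq_pred.
have sD (p q : {poly rat}) n : (size p <= n)%nt -> (size q <= n)%nt -> (size (p + q)%ri <= n)%nt.
  by move=> hp hq; apply: leq_trans (size_polyD _ _) _; rewrite geq_max hp.
have sM (p q : {poly rat}) m n : (size p <= m.+1)%nt -> (size q <= n.+1)%nt -> (size (p * q)%ri <= (m + n).+1)%nt.
  by move=> hp hq; apply: leq_trans (size_polyMleq _ _) _; lia.
have sF u : (size (addnum_poly u) <= 3)%nt.
  apply: (sD _ _ _); [apply: (sD _ _ _)|].
  - exact: leq_trans (sC _ _) sX2.
  - rewrite -polyCM -polyCD; apply: leq_trans (sC _ _) _; rewrite size_polyX.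
    by [].
  by rewrite -!polyCM -polyCD; apply: leq_trans (size_polyC_leq1 _) _.
have s2 : (size relA2 < size relA1)%nt.
  by rewrite s1; apply: (sD _ _ _); apply: leq_trans (sC _ _) _; apply: (sM _ _ 2 2)%nt; rewrite ?size_pole2 ?sF.
have sA : size (relA1 + relA2) = 6 by rewrite size_polyDl.
have sB : (size relB <= 3)%nt.
  by apply: leq_trans (sC _ _) _; apply: (sD _ _ _); do 2 (apply: leq_trans (sC _ _) _); rewrite size_pole2.
have scub : (size cubic_poly <= 4)%nt.
  apply: (sD _ _ _); [apply: (sD _ _ _)|]; first by apply: (sM _ _ 1 2)%nt; rewrite ?size_polyX.
    by apply: leq_trans (sC _ _) _; rewrite size_polyX.
  by apply: leq_trans (size_polyC_leq1 _) _.
have sR : (size (cubic_poly * (relB * relB))%ri <= 8)%nt by apply: (sM _ _ 3 4)%nt => //; apply: (sM _ _ 2 2)%nt.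
have A0 : relA1 + relA2 != 0 by rewrite -size_poly_eq0 sA.
have sAA : size ((relA1 + relA2) * (relA1 + relA2)) = 11 by rewrite size_mul // sA.
by rewrite -size_poly_eq0 /relpoly size_polyDl ?sAA // size_polyN; apply: leq_ltn_trans sR _.
Qed.

Lemma relpoly_root x y : y ^+ 2 = cubic a b x ->
  n1 * x * ((x - u1) ^+ 2 * (x - u2) ^+ 2) +
  n2 * (x - u2) ^+ 2 * (addnum a b u1 x - 2 * v1 * y) +
  n3 * (x - u1) ^+ 2 * (addnum a b u2 x - 2 * v2 * y) = 0 -> root relpoly x.
Proof.
move=> hy hrel.
have eP u : (pole2 u).[x] = (x - u) ^+ 2 by rewrite /pole2 hornerM hornerXsubC.
have eF u : (addnum_poly u).[x] = addnum a b u x.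
  by rewrite /addnum_poly !(hornerD, hornerM, hornerX, hornerC).
have eC : cubic_poly.[x] = y ^+ 2.
  by rewrite /cubic_poly !(hornerD, hornerM, hornerX, hornerC) hy.
have e : (relA1 + relA2).[x] = y * relB.[x].
  rewrite /relA1 /relA2 /relB !(hornerN, hornerD, hornerM, hornerX, hornerC).
  by apply/eqP; rewrite -subr_eq0 -hrel; apply/eqP; rewrite /addnum; ring.
rewrite /root /relpoly hornerD hornerN [X in X + _]hornerM e !hornerM eC.
by apply/eqP; ring.
Qed.
End RootPolynomial.

Lemma relpoly_ht : exists d k, forall (X : R) (a b u1 v1 u2 v2 n1 n2 n3 : rat), (1 <= X)%R ->
  [/\ (hQ a <= X)%R, (hQ b <= X)%R & [/\ (hQ n1 <= X)%R, (hQ n2 <= X)%R & (hQ n3 <= X)%R]] ->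
  [/\ (hQ u1 <= X)%R, (hQ v1 <= X)%R, (hQ u2 <= X)%R & (hQ v2 <= X)%R] ->
  polyht X d k (relpoly a b u1 v1 u2 v2 n1 n2 n3).
Proof.
(* Degree and factor are left open and get filled in by the rules for [polyht] following the
   structure of [relpoly]. *)
eexists; eexists => X a b u1 v1 u2 v2 n1 n2 n3 X1 [ha hb [hn1 hn2 hn3]] [hu1 hv1 hu2 hv2].
have cst c : (hQ c <= X)%R -> polyht X 0 1 c%:P.
  by move=> hc; apply: (polyht_const X1); lra.
have pa := cst _ ha; have pb := cst _ hb; have pn1 := cst _ hn1; have pn2 := cst _ hn2.
have pn3 := cst _ hn3; have pu1 := cst _ hu1; have pu2 := cst _ hu2; have pv1 := cst _ hv1.
have pv2 := cst _ hv2.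
have p2 : polyht X 0 1 2%:P by apply: cst; have := ln2_le1; rewrite hQE -[ht 2]/2%nt; lra.
rewrite /relpoly /relA1 /relA2 /relB /cubic_poly /addnum_poly /pole2.
repeat polyht_step X1.
Qed.

Lemma three_term_root_height : exists K : R, forall (X : R) (a b u1 v1 u2 v2 x y n1 n2 n3 : rat),
  (1 <= X)%R -> n1 != 0 -> y ^+ 2 = cubic a b x ->
  n1 * x * ((x - u1) ^+ 2 * (x - u2) ^+ 2) +
  n2 * (x - u2) ^+ 2 * (addnum a b u1 x - 2 * v1 * y) +
  n3 * (x - u1) ^+ 2 * (addnum a b u2 x - 2 * v2 * y) = 0 ->
  [/\ (hQ a <= X)%R, (hQ b <= X)%R & [/\ (hQ n1 <= X)%R, (hQ n2 <= X)%R & (hQ n3 <= X)%R]] ->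
  [/\ (hQ u1 <= X)%R, (hQ v1 <= X)%R, (hQ u2 <= X)%R & (hQ v2 <= X)%R] -> (hQ x <= K * X)%R.
Proof.
have [d [k hk]] := relpoly_ht; exists (INR d.+1 * k)%R => X a b u1 v1 u2 v2 x y n1 n2 n3 X1 hn hy hrel h h'.
have [hs hc] := hk X a b u1 v1 u2 v2 n1 n2 n3 X1 h h'.
rewrite Rmult_assoc; apply: hQ_root hs hc; first exact: relpoly_neq0.
exact: relpoly_root hy hrel.
Qed.

Lemma hQ_natz (z : int) (W : nat) : (0 < W)%nt -> (absz z <= W)%nt -> (hQ z%:~R <= lnN W)%R.
Proof. by move=> hW hz; rewrite hQE ht_int; apply: lnN_le; rewrite ?geq_max ?hz // leq_max orbT. Qed.

Lemma hQ_sub x y : (hQ (x - y)%ri <= hQ x + hQ y + 1)%R.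
Proof. by have := hQ_add x (- y); rewrite hQ_opp. Qed.

Lemma hQ_div x y : (hQ (x / y)%ri <= hQ x + hQ y)%R.
Proof. by have := hQ_mul x y^-1; rewrite hQ_inv. Qed.

Lemma hQ_add_le x y A B : (hQ x <= A)%R -> (hQ y <= B)%R -> (hQ (x + y)%ri <= A + B + 1)%R.
Proof. by move=> hx hy; apply: Rle_trans (hQ_add _ _) _; lra. Qed.

Lemma hQ_sub_le x y A B : (hQ x <= A)%R -> (hQ y <= B)%R -> (hQ (x - y)%ri <= A + B + 1)%R.
Proof. by move=> hx hy; apply: Rle_trans (hQ_sub _ _) _; lra. Qed.

Lemma hQ_mul_le x y A B : (hQ x <= A)%R -> (hQ y <= B)%R -> (hQ (x * y)%ri <= A + B)%R.
Proof. by move=> hx hy; apply: Rle_trans (hQ_mul _ _) _; lra. Qed.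

Lemma hQ_div_le x y A B : (hQ x <= A)%R -> (hQ y <= B)%R -> (hQ (x / y)%ri <= A + B)%R.
Proof. by move=> hx hy; apply: Rle_trans (hQ_div _ _) _; lra. Qed.

Lemma hQ_sqrt_cubic (a b u v : rat) (Y : R) : (1 <= Y)%R -> (hQ a <= Y)%R -> (hQ b <= Y)%R ->
  (hQ u <= Y)%R -> v ^+ 2 = cubic a b u -> (hQ v <= 30 * Y)%R.
Proof.
move=> Y1 ha hb hu hv.
have hc : (hQ (cubic a b u) <= 8 * Y)%R.
  rewrite /cubic !exprS expr0 mulr1.
  have h1 := hQ_mul_le hu (hQ_mul_le hu hu).
  have := hQ_add_le (hQ_add_le h1 (hQ_mul_le ha hu)) hb => h2.
  by apply: Rle_trans h2 _; lra.
pose p : {poly rat} := 'X^2 - (cubic a b u)%:P.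
have sp : size p = 3.
  rewrite /p size_polyDl ?size_polyXn // size_polyN; apply: leq_ltn_trans (size_polyC_leq1 _) _.
  by [].
apply: Rle_trans (@hQ_root p v 3 (8 * Y + 1) _ _ _ _) _.
- by rewrite -size_poly_eq0 sp.
- by rewrite /root /p !hornerE hv subrr.
- by rewrite sp.
- move=> i; rewrite /p coefB coefXn coefC; apply: Rle_trans (hQ_sub _ _) _.
  case: (i == 2%nt); case: eqP => _ /=; rewrite ?hQ0 ?hQ1; lra.
by rewrite /=; lra.
Qed.

Lemma addnum_point (a b : rat) p q r : p.1 != q.1 -> col a b p q r ->
  (p.1 - q.1) ^+ 2 * r.1 = addnum a b q.1 p.1 - 2 * q.2 * p.2.
Proof.
move=> hn h; have hp := col_on h; have hq := col_on (colC h).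
case: p q r hn h hp hq => [x y] [u v] [x3 y3] /= hn.
case=> l [c /= [[h1 h2 h3] [h4 h5 h6]]] hp hq.
have e : l * (x - u) = y - v by rewrite h1 h2; ring.
have -> : x3 = l ^+ 2 - x - u by rewrite h4; ring.
have -> : (x - u) ^+ 2 * (l ^+ 2 - x - u) = (l * (x - u)) ^+ 2 - (x + u) * (x - u) ^+ 2 by ring.
rewrite e; have -> : (y - v) ^+ 2 = y ^+ 2 + v ^+ 2 - 2 * v * y by ring.
by rewrite hp hq /cubic /addnum; ring.
Qed.

(** Isolated as a property of [K] so that the constant is fixed before the curve, the points and
    [Y]. *)
Definition triple_bound (K : R) : Prop := forall (A B : int)
  (ns : 4 * (A%:~R : rat) ^+ 3 + 27 * (B%:~R : rat) ^+ 2 != 0) (Y : R) (P1 P2 P3 : ecpt ns)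
  (x1 y1 x2 y2 x3 y3 n1 n2 n3 : rat),
  ecval P1 = Some (x1, y1) -> ecval P2 = Some (x2, y2) -> ecval P3 = Some (x3, y3) ->
  P2 <> P1 -> P3 <> P1 -> n1 != 0 -> n1 * x1 + n2 * x2 + n3 * x3 = 0 -> (1 <= Y)%R ->
  (hp (P2 - P1)%ri <= Y)%R -> (hp (P3 - P1)%ri <= Y)%R ->
  (hQ A%:~R <= Y)%R -> (hQ B%:~R <= Y)%R -> [/\ (hQ n1 <= Y)%R, (hQ n2 <= Y)%R & (hQ n3 <= Y)%R] ->
  (hQ x1 <= K * Y)%R.

Lemma triple_bound_exists : exists K, (1 <= K)%R /\ triple_bound K.
Proof.
have [K hK] := three_term_root_height; exists (Rabs K * 30 + 1)%R; split.
  by have := Rabs_pos K; lra.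
move=> A B ns Y P1 P2 P3 x1 y1 x2 y2 x3 y3 n1 n2 n3 e1 e2 e3 d2 d3 hn hrel Y1 h2 h3 hA hB [hn1 hn2 hn3].
have Kle : (K * (30 * Y) <= (Rabs K * 30 + 1) * Y)%R.
  have : (K * (30 * Y) <= Rabs K * (30 * Y))%R by apply: Rmult_le_compat_r; [lra | exact: Rle_abs].
  by lra.
have KY : (Y <= (Rabs K * 30 + 1) * Y)%R.
  have : (0 <= Rabs K * (30 * Y))%R by apply: Rmult_le_pos; [exact: Rabs_pos | lra].
  by lra.
have on1 : y1 ^+ 2 = cubic A%:~R B%:~R x1 by have := ec_on P1; rewrite e1 => /on_shortE.
have aff (P : ecpt ns) x y : ecval P = Some (x, y) -> P <> P1 ->
    exists u v, [/\ ecval (P - P1) = Some (u, v), v ^+ 2 = cubic A%:~R B%:~R u &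
      x1 != u -> (x1 - u) ^+ 2 * x = addnum A%:~R B%:~R u x1 - 2 * v * y1].
  move=> eP hP; case eR : (ecval (P - P1)) => [[u v]|]; last first.
    by case: hP; apply/eqP; rewrite -subr_eq0; apply/eqP; apply: ecval_inj; rewrite eR.
  exists u, v; have onR : v ^+ 2 = cubic A%:~R B%:~R u by have := ec_on (P - P1); rewrite eR => /on_shortE.
  split=> // hx; have eS : ecval (P1 + (P - P1)) = Some (x, y) by rewrite addrC subrK.
  move: eS; rewrite ecvalD e1 eR.
  have [[[e _] _]|[r [hr ->]]] := @padd_shortP _ _ (x1, y1) (u, v) on1 onR.
    by rewrite /= in e; rewrite e eqxx in hx.
  by case=> <- _; exact: (@addnum_point _ _ (x1, y1) (u, v) r hx hr).
have [u [v [eu hv hu]]] := aff P2 x2 y2 e2 d2.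
have [u' [v' [eu' hv' hu']]] := aff P3 x3 y3 e3 d3.
have bu : (hQ u <= Y)%R by move: h2; rewrite /hp eu.
have bu' : (hQ u' <= Y)%R by move: h3; rewrite /hp eu'.
(* At the pole of the addition formula x1 is itself the abscissa of a difference, hence already
   bounded by [Y]. *)
have [e|ne] := eqVneq x1 u; first by rewrite e; lra.
have [e|ne'] := eqVneq x1 u'; first by rewrite e; lra.
apply: Rle_trans Kle.
apply: (hK (30 * Y)%R A%:~R B%:~R u v u' v' x1 y1 n1 n2 n3) => //; try lra.
- rewrite -(hu ne) -(hu' ne').
  have -> : n1 * x1 * ((x1 - u) ^+ 2 * (x1 - u') ^+ 2) + n2 * (x1 - u') ^+ 2 * ((x1 - u) ^+ 2 * x2) +
    n3 * (x1 - u) ^+ 2 * ((x1 - u') ^+ 2 * x3) =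
    (n1 * x1 + n2 * x2 + n3 * x3) * ((x1 - u) ^+ 2 * (x1 - u') ^+ 2) by ring.
  by rewrite hrel mul0r.
- by split; [lra | lra | split; lra].
by split; try lra; [apply: hQ_sqrt_cubic hv => //; lra | apply: hQ_sqrt_cubic hv' => //; lra].
Qed.

(** * Progressions on a short model *)

Lemma seq_max (f : nat -> R) (s n : nat) : (0 < n)%nt ->
  exists2 k, (k < n)%nt & forall j, (j < n)%nt -> (f (s + j)%nt <= f (s + k)%nt)%R.
Proof.
elim: n => // -[|n] IH _; first by exists 0%nt => // -[|j] //; lra.
have [//|k hk hmax] := IH; case: (Rle_dec (f (s + n.+1)%nt) (f (s + k)%nt)) => h.
  exists k; first exact: leqW; move=> j; rewrite ltnS leq_eqVlt => /orP[/eqP -> //|]; exact: hmax.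
exists n.+1 => // j; rewrite ltnS leq_eqVlt => /orP[/eqP -> |hj]; first by lra.
by have := hmax j hj; lra.
Qed.

Lemma lnN2 : lnN 2 = ln 2.
Proof. by rewrite /lnN; congr ln; rewrite /=; lra. Qed.

Section WindowBound.
Variables (cL c1 K : R).
Hypotheses (cL0 : (0 < cL)%R) (c11 : (1 <= c1)%R) (K1 : (1 <= K)%R) (HK : triple_bound K).

Variables (A B : int) (T : nat).
Hypotheses (T1 : (0 < T)%nt) (TA : (absz A <= T)%nt) (TB : (absz B <= T)%nt).
Hypothesis ns : 4 * (A%:~R : rat) ^+ 3 + 27 * (B%:~R : rat) ^+ 2 != 0.
Local Notation G := (ecpt ns).
Variables (r : nat) (M : R) (q : G -> R).
Hypothesis M2 : (lnN 2 <= M)%R.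
Hypothesis TM : (lnN T <= c1 * M)%R.
Hypothesis q_ge0 : forall x, (0 <= q x)%R.
Hypothesis q_par : forall x y : G, (q (x + y)%ri + q (x - y)%ri = 2 * q x + 2 * q y)%R.
Hypothesis q_rank : forall f : 'I_r.+1 -> G, exists n : 'I_r.+1 -> int,
  (exists i, n i <> 0) /\ \sum_(i < r.+1) f i *~ n i = 0.
Hypothesis q_hp : forall x, (Rabs (q x - hp x) <= 2 * kappa T)%R.
Hypothesis q_gap : forall x : G, (forall j, (0 < j)%nt -> x *+ j <> 0) -> (cL * M <= q x)%R.

Variables (al de : rat) (n : nat) (Q : nat -> G).
Hypothesis de0 : de != 0.
Hypothesis xQ : forall k, (k < n)%nt -> exists y, ecval (Q k) = Some (al + k%:R * de, y).
Hypothesis sepQ : forall k l j, (k < n)%nt -> (l < n)%nt -> k != l -> (0 < j)%nt -> (Q k - Q l) *+ j <> 0.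

(** In the bound [c2 * M] for [kappa], the part 5 c1 comes from T^5 and 10 from 800 <= 2^10. *)
Definition c2 : R := (5 * c1 + 10)%R.
Definition c3 : R := (2 * c2 + c1 + 2)%R.
(** Once a cluster is bounded by [Y], every canonical height in its window is at most [K2 * Y]; [K3]
    results from solving the ensuing inequality for [Y]. *)
Definition K2 : R := (5 * K + 9)%R.
Definition K3 : R := (2 * (3 * K + 4) * c3)%R.

Lemma M_half : (1 / 2 <= M)%R.
Proof.
by have := ln_lt_2; have := M2; rewrite lnN2; lra.
Qed.

Lemma kappa_le : (0 <= kappa T /\ kappa T <= c2 * M)%R.
Proof.
have [k0 _] := kappa_ge T1; split=> //.
have : (lnN 800 <= 10 * lnN 2)%R.
  have := lnN_le (isT : (0 < 800)%nt) (isT : (800 <= expn 2 10)%nt).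
  by rewrite lnN_exp // (_ : INR 10 = 10%R) //=; lra.
by rewrite /kappa /c2; move: (lnN 800) => z hz; lra.
Qed.

Lemma m_gt0 : (0 < cL * M)%R.
Proof. by apply: Rmult_lt_0_compat => //; have := M_half; lra. Qed.

(** On a torsion point two iterated doublings coincide, so [q] is multiplied by two different powers
    of 4 with the same result and vanishes. *)
Lemma q_gap_or x : q x = 0%R \/ (cL * M <= q x)%R.
Proof.
have [[j [hj ej]]|h] := classic (exists j, (0 < j)%nt /\ x *+ j = 0); [left | right].
  have [i [k [hik e]]] := torsion_pow2 hj ej.
  have := q_pow2 q_par i x; rewrite e (q_pow2 q_par k x) => e2.
  have : (4 ^ k = 4 ^ i * 4 ^ (k - i))%R by rewrite -pow_add; congr (4 ^ _)%R; lia.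
  move=> e3; rewrite e3 in e2; have p1 : (0 < 4 ^ i)%R by apply: pow_lt; lra.
  have p2 : (1 < 4 ^ (k - i))%R by apply: Rlt_pow_R1; [lra | lia].
  have : (4 ^ i * ((4 ^ (k - i) - 1) * q x) = 0)%R by lra.
  by move=> /Rmult_integral[|/Rmult_integral[|]]; lra.
by apply: q_gap => j hj e; apply: h; exists j.
Qed.

Lemma qd_ge k l : (k < n)%nt -> (l < n)%nt -> k != l -> (cL * M <= qd q (Q k) (Q l))%R.
Proof. by move=> hk hl hkl; apply: q_gap => j; exact: sepQ. Qed.

Lemma hp_le x : (hp x <= q x + 2 * c2 * M)%R.
Proof.
have [k0 k1] := kappa_le; have := q_hp x => h.
by have := Rle_abs (- (q x - hp x)); rewrite Rabs_Ropp; lra.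
Qed.

Lemma q_le x : (q x <= hp x + 2 * c2 * M)%R.
Proof.
have [k0 k1] := kappa_le; have := q_hp x => h.
by have := Rle_abs (q x - hp x); lra.
Qed.

Lemma coef_ht : (hQ A%:~R <= c1 * M /\ hQ B%:~R <= c1 * M)%R.
Proof. by split; apply: Rle_trans TM; apply: hQ_natz. Qed.

Variables (t W : nat).
Hypothesis tK : (2048 * K2 + 16 <= 4 ^ t)%R.
Hypothesis eW : W = ((expn 2 (r * t)).*2).+1.

Lemma W3 : (2 < W)%nt.
Proof. by rewrite eW ltnS -addnn (@leq_add 1 1) // expn_gt0. Qed.

Lemma lnW0 : (0 <= lnN W)%R. Proof. by apply: lnN_ge0; have := W3; lia. Qed.

(** The coefficients k - j, i - k, j - i sum to 0, and so do their products with i, j, k; the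
    relation therefore kills both the first term and the common difference. *)
Lemma cluster_point (Y : R) i j k : (i < n)%nt -> (j < n)%nt -> (k < n)%nt ->
  i <> j -> i <> k -> j <> k -> (i <= j + W)%nt -> (j <= i + W)%nt -> (i <= k + W)%nt -> (k <= i + W)%nt ->
  (j <= k + W)%nt -> (k <= j + W)%nt -> (1 <= Y)%R -> (c1 * M <= Y)%R -> (lnN W <= Y)%R ->
  (qd q (Q i) (Q j) + 2 * c2 * M <= Y)%R -> (qd q (Q i) (Q k) + 2 * c2 * M <= Y)%R ->
  (hQ (al + i%:R * de)%ri <= K * Y)%R.
Proof.
move=> hi hj hk ij ik jk b1 b2 b3 b4 b5 b6 Y1 YM YW d1 d2.
have [y1 e1] := xQ hi; have [y2 e2] := xQ hj; have [y3 e3] := xQ hk.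
have hd (i' j' : nat) : (i' < n)%nt -> (j' < n)%nt -> i' <> j' -> Q j' <> Q i'.
  move=> hi' hj' h e; have := @sepQ j' i' 1 hj' hi'; rewrite e subrr mul0rn => h'.
  by apply: h' => //; apply/eqP => h''; apply: h.
have hW (u v : nat) : (u <= v + W)%nt -> (v <= u + W)%nt -> (hQ (u%:Z - v%:Z)%:~R <= Y)%R.
  move=> h1 h2; apply: Rle_trans YW; apply: hQ_natz; first by have := W3; lia.
  by lia.
have hqd i' j' : (hp (Q j' - Q i')%ri <= qd q (Q i') (Q j') + 2 * c2 * M)%R.
  by rewrite (qdC q_par); exact: hp_le.
have [hA hB] := coef_ht.
apply: (HK e1 e2 e3 (n1 := (k%:Z - j%:Z)%:~R) (n2 := (i%:Z - k%:Z)%:~R) (n3 := (j%:Z - i%:Z)%:~R)).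
- exact: hd.
- exact: hd.
- by rewrite intr_eq0 subr_eq0; apply/eqP => -[] h; apply: jk.
- by rewrite !intrB -!pmulrn; ring.
- by [].
- by apply: Rle_trans (hqd _ _) _.
- by apply: Rle_trans (hqd _ _) _.
- lra.
- lra.
by split; apply: hW.
Qed.

Lemma window_height s : (s + W <= n)%nt ->
  (hQ (al + s%:R * de)%ri <= K3 * (M + lnN W) /\ hQ de <= K3 * (M + lnN W))%R.
Proof.
move=> hs; have hW3 := W3; have W0 := lnW0; have Mh := M_half.
have [k0 hk0 hmax] := @seq_max (fun k => q (Q k)) s W ltac:(lia).
set H := q (Q (s + k0)%nt) in hmax.
have m0 := m_gt0.
have H0 : (0 < H)%R.
  have h01 : (cL * M <= qd q (Q (s + 0)%nt) (Q (s + 1)%nt))%R by apply: qd_ge; lia.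
  have := qd_le q_ge0 q_par (Q (s + 0)%nt) (Q (s + 1)%nt).
  have h0 := hmax 0%nt ltac:(lia); have h1 := hmax 1%nt ltac:(lia); lra.
have K20 : (0 < K2)%R by rewrite /K2; lra.
(* With this choice [K2] times the cluster size 4 sigma is H / 2, which the final inequality H <=
   [K2 * Y] absorbs. It also turns 256 H + 16 sigma into (2048 [K2] + 16) sigma, the condition
   [tK]. *)
pose sigma := (H / (8 * K2))%R.
have eH : (H = 8 * K2 * sigma)%R by rewrite /sigma; Rfield; lra.
have s0 : (0 < sigma)%R by apply: Rdiv_lt_0_compat; lra.
have [||||i [j [k [[hi hj hk] [[ij ik jk] [dij dik djk]]]]]] :=
  @cluster G q r (cL * M)%R q_ge0 q_par q_rank m0 q_gap_or t H sigma Q (iota s W) s0.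
- have : ((2048 * K2 + 16) * sigma <= 4 ^ t * sigma)%R by apply: Rmult_le_compat_r; lra.
  by rewrite eH; lra.
- exact: iota_uniq.
- move=> i; rewrite mem_iota => /andP[h1 h2]; have := hmax (i - s)%nt ltac:(lia).
  by rewrite subnKC.
- by rewrite size_iota eW.
move: hi hj hk; rewrite !mem_iota => /andP[i1 i2] /andP[j1 j2] /andP[k1 k2].
pose Y := (4 * sigma + c3 * M + lnN W)%R.
have c20 : (15 <= c2)%R by rewrite /c2; lra.
have c2M : (15 * M <= c2 * M)%R by apply: Rmult_le_compat_r; lra.
have c1M : (0 <= c1 * M)%R by apply: Rmult_le_pos; lra.
have ec3 : (c3 * M = 2 * c2 * M + c1 * M + 2 * M)%R by rewrite /c3; Rring.
have Y2 : (2 <= Y)%R by rewrite /Y; lra.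
have Y1 : (1 <= Y)%R by lra.
have YM : (c1 * M <= Y)%R by rewrite /Y; lra.
have YW : (lnN W <= Y)%R by rewrite /Y; lra.
have Yd : (4 * sigma + 2 * c2 * M <= Y)%R by rewrite /Y; lra.
have hi : (hQ (al + i%:R * de)%ri <= K * Y)%R.
  apply: (@cluster_point Y i j k) => //; try lia.
    exact: Rle_trans (Rplus_le_compat_r _ _ _ dij) Yd.
  exact: Rle_trans (Rplus_le_compat_r _ _ _ dik) Yd.
have hj : (hQ (al + j%:R * de)%ri <= K * Y)%R.
  apply: (@cluster_point Y j i k) => //; try lia.
    by rewrite (qdC q_par); exact: Rle_trans (Rplus_le_compat_r _ _ _ dij) Yd.
  exact: Rle_trans (Rplus_le_compat_r _ _ _ djk) Yd.
have hz (u v : nat) : (u <= v + W)%nt -> (v <= u + W)%nt -> (hQ (u%:Z - v%:Z)%:~R <= lnN W)%R.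
  by move=> h1 h2; apply: hQ_natz; lia.
have KY : (1 * Y <= K * Y)%R by apply: Rmult_le_compat_r; lra.
have hde : (hQ de <= 2 * (K * Y) + 1 + lnN W)%R.
  have -> : de = ((al + i%:R * de) - (al + j%:R * de)) / (i%:Z - j%:Z)%:~R.
    rewrite intrB -!pmulrn; field; rewrite subr_eq0 eqr_nat; apply/eqP; exact: ij.
  have := hQ_div_le (hQ_sub_le hi hj) (hz i j ltac:(lia) ltac:(lia)).
  by move=> h; apply: Rle_trans h _; lra.
have hx u : (s <= u)%nt -> (u < s + W)%nt -> (hQ (al + u%:R * de)%ri <= 3 * (K * Y) + 3 * Y + 2)%R.
  move=> u1 u2; have -> : al + u%:R * de = (al + i%:R * de) + (u%:Z - i%:Z)%:~R * de.
    by rewrite intrB -!pmulrn; ring.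
  have := hQ_add_le hi (hQ_mul_le (hz u i ltac:(lia) ltac:(lia)) hde).
  by move=> h; apply: Rle_trans h _; lra.
have hH : (H <= K2 * Y)%R.
  have [y ey] := @xQ (s + k0)%nt ltac:(lia).
  have := q_le (Q (s + k0)%nt); rewrite -/H /hp ey /=.
  have := hx (s + k0)%nt (leq_addr _ _) ltac:(by rewrite ltn_add2l).
  by rewrite /K2; lra.
have sK : (K2 * (4 * sigma) <= K2 * (c3 * M + lnN W))%R.
  by move: hH; rewrite {1}eH /Y; lra.
have sK' : (4 * sigma <= c3 * M + lnN W)%R by apply: Rmult_le_reg_l sK.
have YY : (Y <= 2 * c3 * (M + lnN W))%R.
  have : (1 * lnN W <= c3 * lnN W)%R by apply: Rmult_le_compat_r; rewrite /c3; lra.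
  by rewrite /Y; lra.
have fin : ((3 * K + 4) * Y <= K3 * (M + lnN W))%R.
  have -> : (K3 * (M + lnN W) = (3 * K + 4) * (2 * c3 * (M + lnN W)))%R by rewrite /K3; Rring.
  by apply: Rmult_le_compat_l; lra.
split; last by lra.
have hsW : (s < s + W)%nt by lia.
by apply: Rle_trans (hx s (leqnn _) hsW) _; lra.
Qed.

Variables (t2 e : nat).
Hypothesis t2K : (16 * (8 * K3 + 2 * c2) < 4 ^ t2 * cL)%R.
Hypothesis eK : (8 * K3 <= INR e)%R.

Lemma progression_count : (n <= expn 2 (r * t2) + 2 * expn W e + 2 * W)%nt.
Proof.
have hW3 := W3; have W0 := lnW0; have Mh := M_half.
have [hn|hn] := leqP (2 * W) n; last by apply: leq_trans (ltnW hn) (leq_addl _ _).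
have c20 : (15 <= c2)%R by rewrite /c2; lra.
have K31 : (1 <= K3)%R.
  rewrite /K3 /c3; have : (1 * 1 <= (2 * (3 * K + 4)) * (2 * c2 + c1 + 2))%R by apply: Rmult_le_compat; lra.
  lra.
have lnWM : (1 / 2 <= lnN W)%R.
  have := lnN_le (isT : (0 < 2)%nt) (ltnW hW3); have := ln_lt_2.
  by rewrite lnN2; lra.
pose D := (K3 * (M + lnN W))%R.
have D1 : (1 <= D)%R by have : (1 * 1 <= D)%R by [apply: Rmult_le_compat; lra]; lra.
have [hx0 hde] := @window_height 0 ltac:(lia).
have [hx1 _] := @window_height (n - W) ltac:(lia).
rewrite -/D in hx0 hx1 hde.
have nW0 : (0 < n - W)%nt by lia.
have hnW : (lnN (n - W) <= 3 * D + 1)%R.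
  have -> : lnN (n - W) = hQ ((n - W)%nt%:Z)%:~R by rewrite hQE ht_int; congr lnN; lia.
  have -> : (n - W)%nt%:Z%:~R = ((al + (n - W)%nt%:R * de) - (al + 0%:R * de)) / de :> rat.
    by rewrite -pmulrn; field.
  by apply: Rle_trans (hQ_div_le (hQ_sub_le hx1 hx0) hde) _; lra.
have [MW|WM] := Rle_lt_dec (lnN W) M.
  rewrite -addnA; apply: leq_trans (leq_addr _ _).
  (* With log W at most M everything is a multiple of M: D <= 2 K3 M, each term has height at most 5
     D + 3, and passing to the canonical height adds 2 c2 M. The condition [t2K] is what [packing]
     asks for at this radius. *)
  have hq k : (k < n)%nt -> (q (Q k) <= 2 * (8 * K3 + 2 * c2) * M)%R.
    move=> hk; have [y ey] := xQ hk; have hk1 : (hQ (k%:Z)%:~R <= 3 * D + 2)%R.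
      have k2 : (k <= 2 * (n - W))%nt by lia.
      apply: Rle_trans (@hQ_natz k (2 * (n - W))%nt _ k2) _; first by rewrite muln_gt0.
      by rewrite lnN_mul //; have := ln2_le1; lra.
    have hk2 : (hQ (al + k%:R * de)%ri <= 5 * D + 3)%R.
      have -> : al + k%:R * de = (al + 0%:R * de) + (k%:Z)%:~R * de by rewrite -pmulrn; ring.
      by apply: Rle_trans (hQ_add_le hx0 (hQ_mul_le hk1 hde)) _; lra.
    have := q_le (Q k); rewrite /hp ey /= => h.
    have hD : (D <= K3 * (2 * M))%R by apply: Rmult_le_compat_l; lra.
    have hM0 : (0 <= c2 * M)%R by apply: Rmult_le_pos; lra.
    by lra.
  rewrite -(size_iota 0 n) -(size_map Q).
  apply: (@packing G q r (cL * M)%R q_ge0 q_par q_rank m_gt0 q_gap_or t2 (2 * (8 * K3 + 2 * c2) * M)%R).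
  - have M0 : (0 < M)%R by lra.
    have : (16 * (8 * K3 + 2 * c2) * M < 4 ^ t2 * cL * M)%R by apply: Rmult_lt_compat_r.
    by lra.
  - by move=> _ /mapP[k hk ->]; apply: hq; move: hk; rewrite mem_iota.
  rewrite pairwise_map; have : all (fun k => k < n)%nt (iota 0 n) by apply/allP => k; rewrite mem_iota.
  have := iota_uniq 0 n; elim: (iota 0 n) => //= k s IH /andP[hk hu] /andP[kn /allP hs].
  rewrite IH //; last by apply/allP.
  rewrite andbT; apply/allP => l hl; apply/apartP; apply: qd_ge => //; first exact: hs.
  by apply: contra hk => /eqP ->.
(* Now D <= 2 K3 log W, so 3 D + 1 <= 8 K3 log W; this dictates the exponent e. *)
have h1 : (n - W <= expn W e)%nt.
  rewrite leqNgt; apply/negP => hlt.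
  have h2 : (INR e * lnN W < lnN (n - W))%R.
    rewrite -lnN_exp; last by lia.
    rewrite /lnN; apply: ln_increasing; first by apply: INR_gt0; rewrite expn_gt0; lia.
    by apply: lt_INR; apply/ssrnat.ltP.
  have h3 : (8 * K3 * lnN W <= INR e * lnN W)%R by apply: Rmult_le_compat_r.
  have h4 : (D <= K3 * (2 * lnN W))%R by apply: Rmult_le_compat_l; lra.
  by lra.
by lia.
Qed.
End WindowBound.

(** * Reduction to a short model *)

Lemma wiso_sym E E' : wiso E E' -> wiso E' E.
Proof.
case=> u [r [s [t [u0 [h1 [h2 [h3 [h4 h6]]]]]]]].
exists u^-1, (- r / u ^+ 2), (- s / u), ((r * s - t) / u ^+ 3).
have e1 : wa1 E = u * wa1 E' - 2 * s by rewrite h1; ring.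
have e2 : wa2 E = u ^+ 2 * wa2 E' + s * wa1 E - 3 * r + s ^+ 2 by rewrite h2; ring.
have e3 : wa3 E = u ^+ 3 * wa3 E' - r * wa1 E - 2 * t by rewrite h3; ring.
have e4 : wa4 E = u ^+ 4 * wa4 E' + s * wa3 E - 2 * r * wa2 E + (t + r * s) * wa1 E - 3 * r ^+ 2 + 2 * s * t.
  by rewrite h4; ring.
have e6 : wa6 E = u ^+ 6 * wa6 E' - r * wa4 E - r ^+ 2 * wa2 E - r ^+ 3 + t * wa3 E + t ^+ 2 + r * t * wa1 E.
  by rewrite h6; ring.
split; first by rewrite invr_eq0.
rewrite e6 e4 e3 e2 e1; split; [|split; [|split; [|split]]]; field; exact: u0.
Qed.

Lemma wiso_trans E1 E2 E3 : wiso E1 E2 -> wiso E2 E3 -> wiso E1 E3.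
Proof.
case=> u [r [s [t [u0 [h1 [h2 [h3 [h4 h6]]]]]]]].
case=> v [r' [s' [t' [v0 [g1 [g2 [g3 [g4 g6]]]]]]]].
exists (u * v), (u ^+ 2 * r' + r), (u * s' + s), (u ^+ 3 * t' + s * u ^+ 2 * r' + t).
have e1 : wa1 E1 = u * wa1 E2 - 2 * s by rewrite h1; ring.
have e2 : wa2 E1 = u ^+ 2 * wa2 E2 + s * wa1 E1 - 3 * r + s ^+ 2 by rewrite h2; ring.
have e3 : wa3 E1 = u ^+ 3 * wa3 E2 - r * wa1 E1 - 2 * t by rewrite h3; ring.
have e4 : wa4 E1 = u ^+ 4 * wa4 E2 + s * wa3 E1 - 2 * r * wa2 E1 + (t + r * s) * wa1 E1 - 3 * r ^+ 2 + 2 * s * t.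
  by rewrite h4; ring.
have e6 : wa6 E1 = u ^+ 6 * wa6 E2 - r * wa4 E1 - r ^+ 2 * wa2 E1 - r ^+ 3 + t * wa3 E1 + t ^+ 2 + r * t * wa1 E1.
  by rewrite h6; ring.
have f u' k x y : u' ^+ k * x = y -> (u * u') ^+ k * x = u ^+ k * y by move=> <-; rewrite exprMn mulrA.
split; first by rewrite mulf_neq0.
have k1 : u * v * wa1 E3 = u * (wa1 E2 + 2 * s') by rewrite -g1 mulrA.
rewrite k1 (f _ _ _ _ g2) (f _ _ _ _ g3) (f _ _ _ _ g4) (f _ _ _ _ g6) e6 e4 e3 e2 e1.
by split; [|split; [|split; [|split]]]; ring.
Qed.

Definition wc6 (E : wmodel) : rat := - wb2 E ^+ 3 + 36 * wb2 E * wb4 E - 216 * wb6 E.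

Lemma wc4_wc6 E : wc4 E ^+ 3 - wc6 E ^+ 2 = 1728 * wdisc E.
Proof. by rewrite /wc4 /wc6 /wdisc /wb8 /wb6 /wb4 /wb2; ring. Qed.

(** Completing the square and the cube; u = 1/6 clears the denominators this creates. *)
Lemma wiso_short E : wiso E (shortW (- 27 * wc4 E) (- 54 * wc6 E)).
Proof.
exists (1 / 6), (- wb2 E / 12), (- wa1 E / 2), (- (wa1 E * (- wb2 E / 12) + wa3 E) / 2).
split=> //=; rewrite /wc4 /wc6 /wb6 /wb4 /wb2.
by split; [|split; [|split; [|split]]]; field.
Qed.

Lemma wdisc_short a b : wdisc (shortW a b) = - 16 * (4 * a ^+ 3 + 27 * b ^+ 2).
Proof. by rewrite /wdisc /wb8 /wb6 /wb4 /wb2 /=; ring. Qed.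

Lemma wdisc_short_c E : wdisc (shortW (- 27 * wc4 E) (- 54 * wc6 E)) = 6 ^+ 12 * wdisc E.
Proof.
rewrite wdisc_short; have := wc4_wc6 E; move: (wc4 E) (wc6 E) (wdisc E) => x y z h.
have -> : z = (x ^+ 3 - y ^+ 2) / 1728 by rewrite h; field.
by field.
Qed.

Lemma wj_short_c E : wj (shortW (- 27 * wc4 E) (- 54 * wc6 E)) = wj E.
Proof.
rewrite /wj wdisc_short_c.
have -> : wc4 (shortW (- 27 * wc4 E) (- 54 * wc6 E)) = 6 ^+ 4 * wc4 E.
  by rewrite {1}/wc4 /wb4 /wb2 /=; ring.
have gen (c x z : rat) : c != 0 -> (c ^+ 4 * x) ^+ 3 / (c ^+ 12 * z) = x ^+ 3 / z.
  by move=> c0; rewrite exprMn invfM mulrACA -exprM divff ?mul1r // expf_neq0.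
exact: gen.
Qed.

Lemma wiso_disc E E' : wiso E E' -> elliptic E -> elliptic E'.
Proof.
case=> u [r [s [t [u0 [h1 [h2 [h3 [h4 h6]]]]]]]]; rewrite /elliptic.
have e1 : wa1 E = u * wa1 E' - 2 * s by rewrite h1; ring.
have e2 : wa2 E = u ^+ 2 * wa2 E' + s * wa1 E - 3 * r + s ^+ 2 by rewrite h2; ring.
have e3 : wa3 E = u ^+ 3 * wa3 E' - r * wa1 E - 2 * t by rewrite h3; ring.
have e4 : wa4 E = u ^+ 4 * wa4 E' + s * wa3 E - 2 * r * wa2 E + (t + r * s) * wa1 E - 3 * r ^+ 2 + 2 * s * t.
  by rewrite h4; ring.
have e6 : wa6 E = u ^+ 6 * wa6 E' - r * wa4 E - r ^+ 2 * wa2 E - r ^+ 3 + t * wa3 E + t ^+ 2 + r * t * wa1 E.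
  by rewrite h6; ring.
suff -> : wdisc E = u ^+ 12 * wdisc E' by rewrite mulf_eq0 negb_or => /andP[].
rewrite /wdisc /wb8 /wb6 /wb4 /wb2 e6 e4 e3 e2 e1; ring.
Qed.

Definition padd_x E (lam x1 x2 : rat) := lam ^+ 2 + wa1 E * lam - wa2 E - x1 - x2.

(** Chord and tangent are treated alike through the slope: the intercept in [padd] equals y1 - lam
    x1, in the tangent case by the curve equation. *)
Lemma padd_slope E x1 y1 x2 y2 (lam : rat) : on_curve E (Some (x1, y1)) -> 
  (x1 == x2) && (y1 + y2 + wa1 E * x2 + wa3 E == 0) = false ->
  (if x1 != x2 then lam * (x2 - x1) = y2 - y1 else 2 * y1 + wa1 E * x1 + wa3 E != 0 /\
    lam * (2 * y1 + wa1 E * x1 + wa3 E) = 3 * x1 ^+ 2 + 2 * wa2 E * x1 + wa4 E - wa1 E * y1) ->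
  padd E (Some (x1, y1)) (Some (x2, y2)) = Some (padd_x E lam x1 x2,
    - (lam + wa1 E) * padd_x E lam x1 x2 - (y1 - lam * x1) - wa3 E).
Proof.
move=> /= hon hneg hlam; rewrite hneg /padd_x.
case: ifP hlam => [ne hl|_ [d0 hl]].
  have d0 : x2 - x1 != 0 by rewrite subr_eq0 eq_sym.
  have -> : (y2 - y1) / (x2 - x1) = lam by rewrite -hl mulfK.
  suff -> : (y1 * x2 - y2 * x1) / (x2 - x1) = y1 - lam * x1 by [].
  apply: (mulIf d0); rewrite mulfVK // mulrBl mulrAC hl; ring.
set d := 2 * y1 + wa1 E * x1 + wa3 E in d0 hl *.
have -> : (3 * x1 ^+ 2 + 2 * wa2 E * x1 + wa4 E - wa1 E * y1) / d = lam by rewrite -hl mulfK.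
suff -> : (- x1 ^+ 3 + wa4 E * x1 + 2 * wa6 E - wa3 E * y1) / d = y1 - lam * x1 by [].
apply: (mulIf d0); rewrite mulfVK // mulrBl mulrAC hl.
have -> : wa6 E = y1 ^+ 2 + wa1 E * x1 * y1 + wa3 E * y1 - x1 ^+ 3 - wa2 E * x1 ^+ 2 - wa4 E * x1.
  by rewrite hon; ring.
by rewrite /d; ring.
Qed.

Section ShortModelTransfer.
Variables (E : wmodel) (a b u r s t : rat).
Hypothesis u0 : u != 0.
Hypothesis e1 : wa1 E = - 2 * s.
Hypothesis e2 : wa2 E = - s ^+ 2 - 3 * r.
Hypothesis e3 : wa3 E = 2 * r * s - 2 * t.
Hypothesis e4 : wa4 E = u ^+ 4 * a + 2 * r * s ^+ 2 - 2 * s * t + 3 * r ^+ 2.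
Hypothesis e6 : wa6 E = u ^+ 6 * b - u ^+ 4 * a * r - r ^+ 3 - r ^+ 2 * s ^+ 2 + 2 * r * s * t - t ^+ 2.
Local Notation Es := (shortW a b).

Definition from_short (P : point) : point :=
  if P is Some (x, y) then Some (u ^+ 2 * x + r, u ^+ 3 * y + s * u ^+ 2 * x + t) else None.

Lemma on_from_short P : on_curve E (from_short P) <-> on_curve Es P.
Proof.
case: P => [[x y]|] //; rewrite on_shortE [on_curve E _]/= /cubic.
set Y := (_ + t); set X := (_ + r).
have e : Y ^+ 2 + wa1 E * X * Y + wa3 E * Y - (X ^+ 3 + wa2 E * X ^+ 2 + wa4 E * X + wa6 E) =
  u ^+ 6 * (y ^+ 2 - (x ^+ 3 + a * x + b)) by rewrite e1 e2 e3 e4 e6 /X /Y; ring.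
split=> h.
  apply/eqP; rewrite -subr_eq0; move/eqP: e; rewrite h subrr eq_sym mulf_eq0 expf_eq0 (negPf u0).
  by [].
by apply/eqP; rewrite -subr_eq0 e h subrr mulr0.
Qed.

Lemma pneg_from_short P : pneg E (from_short P) = from_short (pneg Es P).
Proof.
by case: P => [[x y]|] //; rewrite pneg_shortE /=; congr Some; congr pair; rewrite e1 e3; ring.
Qed.

Lemma padd_from_short P Q : on_curve Es P -> on_curve Es Q ->
  padd E (from_short P) (from_short Q) = from_short (padd Es P Q).
Proof.
case: P Q => [[x1 y1]|] [[x2 y2]|] // oP oQ.
have hP := (on_from_short _).2 oP; have hp := (on_shortE _ _ _ _).1 oP; have hq := (on_shortE _ _ _ _).1 oQ.
have u2 : u ^+ 2 != 0 by rewrite expf_neq0.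
have u3 : u ^+ 3 != 0 by rewrite expf_neq0.
have ex : (u ^+ 2 * x1 + r == u ^+ 2 * x2 + r) = (x1 == x2).
  by rewrite (inj_eq (addIr r)) (inj_eq (mulfI u2)).
have ey : x1 = x2 -> (u ^+ 3 * y1 + s * u ^+ 2 * x1 + t + (u ^+ 3 * y2 + s * u ^+ 2 * x2 + t) +
    wa1 E * (u ^+ 2 * x2 + r) + wa3 E == 0) = (y1 + y2 == 0).
  move=> ->; rewrite e1 e3.
  have -> : u ^+ 3 * y1 + s * u ^+ 2 * x2 + t + (u ^+ 3 * y2 + s * u ^+ 2 * x2 + t) +
    - 2 * s * (u ^+ 2 * x2 + r) + (2 * r * s - 2 * t) = u ^+ 3 * (y1 + y2) by ring.
  by rewrite mulf_eq0 (negPf u3).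
case hneg : ((x1 == x2) && (y1 + y2 == 0)).
  have /andP[/eqP ex12 hy] := hneg; rewrite /= ex ex12 eqxx.
  by rewrite -{1}ex12 ey // hy !mul0r !addr0 hy.
have [lam hlam] : exists lam, if x1 != x2 then lam * (x2 - x1) = y2 - y1 else
    y1 != 0 /\ lam * (2 * y1) = 3 * x1 ^+ 2 + a.
  case: eqP hneg => [e|ne] /= hneg; last first.
    by exists ((y2 - y1) / (x2 - x1)); rewrite mulfVK // subr_eq0 eq_sym; apply/eqP.
  have y12 : y1 = y2.
    have : (y1 - y2) * (y1 + y2) = 0.
      have -> : (y1 - y2) * (y1 + y2) = y1 ^+ 2 - y2 ^+ 2 by ring.
      by rewrite hp hq e subrr.
    by move/eqP; rewrite mulf_eq0 hneg orbF subr_eq0 => /eqP.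
  have y0 : y1 != 0 by apply/negP => /eqP y0; move: hneg; rewrite -y12 y0 addr0 eqxx.
  by exists ((3 * x1 ^+ 2 + a) / (2 * y1)); rewrite mulfVK // mulf_neq0.
rewrite (@padd_slope Es x1 y1 x2 y2 lam oP); last 2 first.
- by rewrite /= !mul0r !addr0.
- move: hlam; case: ifP => // _ [y0 hl] /=.
  by rewrite ?(mul0r, mulr0, addr0, subr0) hl; split => //; rewrite mulf_neq0.
rewrite [from_short (Some (x1, y1))]/= [from_short (Some (x2, y2))]/=.
rewrite (@padd_slope E _ _ _ _ (u * lam + s) hP); last 2 first.
- by rewrite ex; move: hneg; case: eqP => // /ey ->.
- rewrite ex; move: hlam; case: eqP => [_ [y0 hl]|_ hl] /=; last first.
    have -> : (u * lam + s) * (u ^+ 2 * x2 + r - (u ^+ 2 * x1 + r)) =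
      u ^+ 3 * (lam * (x2 - x1)) + s * u ^+ 2 * (x2 - x1) by ring.
    by rewrite hl; ring.
  have ed : 2 * (u ^+ 3 * y1 + s * u ^+ 2 * x1 + t) + wa1 E * (u ^+ 2 * x1 + r) + wa3 E = u ^+ 3 * (2 * y1).
    by rewrite e1 e3; ring.
  rewrite ed; split; first by rewrite !mulf_neq0.
  have -> : (u * lam + s) * (u ^+ 3 * (2 * y1)) = u ^+ 4 * (lam * (2 * y1)) + s * u ^+ 3 * 2 * y1 by ring.
  by rewrite hl e1 e2 e4; ring.
by rewrite /padd_x /=; congr Some; congr pair; rewrite e1 e2 ?e3; ring.
Qed.

Hypothesis ns : 4 * a ^+ 3 + 27 * b ^+ 2 != 0.
Local Notation G := (ecpt ns).
Let psi (P : G) : point := from_short (ecval P).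

Lemma psiD P Q : padd E (psi P) (psi Q) = psi (P + Q).
Proof. by rewrite /psi padd_from_short ?ecvalD //; exact: ec_on. Qed.

Lemma psi_pzmul P z : pzmul E z (psi P) = psi (P *~ z).
Proof.
have hn n : pmul E n (psi P) = psi (P *+ n).
  by elim: n => [|n IH]; rewrite ?mulr0n // mulrS -psiD -IH.
by case: z => n; rewrite /pzmul hn // /psi pneg_from_short -ecvalN.
Qed.

(** Without such a relation the images under [psi] would be k + 1 independent points of E. The
    iterated [padd E] is matched with the sum in the group term by term. *)
Lemma short_rank k : has_rank E k -> forall f : 'I_k.+1 -> G, exists n : 'I_k.+1 -> int,
  (exists i, n i <> 0) /\ \sum_(i < k.+1) f i *~ n i = 0.
Proof.
case=> _ hmax f; apply: NNPP => hno; apply: hmax; exists (fun i => psi (f i)); split.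
  by move=> i; apply/on_from_short; exact: ec_on.
move=> n hsum i; apply: NNPP => hni; apply: hno; exists n; split; first by exists i.
apply: ecval_inj; have : psi (\sum_(i < k.+1) f i *~ n i) = None.
  rewrite -hsum; apply: (big_ind2 (fun (g : G) P => psi g = P)) => //.
    by move=> x1 P1 x2 P2 <- <-; rewrite psiD.
  by move=> j _; rewrite psi_pzmul.
by rewrite /psi; case: (ecval _) => [[]|].
Qed.

Lemma short_progression N Ps : x_arith_prog E N Ps -> exists al de, de != 0 /\
  forall i, (i < N)%nt -> exists y, y ^+ 2 = cubic a b (al + i%:R * de).
Proof.
case=> hon [al [de [de0 hP]]]; exists ((al - r) / u ^+ 2), (de / u ^+ 2).
split; first by rewrite mulf_neq0 // invr_eq0 expf_neq0.
move=> i hi; have [y ey] := hP i hi; have := hon i hi; rewrite ey.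
pose x := (al - r) / u ^+ 2 + i%:R * (de / u ^+ 2); pose y' := (y - s * (u ^+ 2 * x) - t) / u ^+ 3.
have -> : Some (al + i%:R * de, y) = from_short (Some (x, y')).
  by rewrite /from_short; congr Some; congr pair; rewrite /y' /x; field.
by move=> /on_from_short/on_shortE h; exists y'.
Qed.
End ShortModelTransfer.

(** * Minimal models and the size of their invariants *)

Lemma nat_min (P : nat -> Prop) : (exists n, P n) -> exists n, P n /\ forall k, P k -> (n <= k)%nt.
Proof.
move=> [n0 h0]; apply: NNPP => hno.
suff all_not n : forall k, (k < n)%nt -> ~ P k by exact: (all_not n0.+1 n0 (ltnSn _) h0).
elim: n => // n IH k; rewrite ltnS leq_eqVlt => /orP[/eqP -> hn|]; last exact: IH.
by apply: hno; exists n; split=> // j hj; rewrite leqNgt; apply/negP => /IH.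
Qed.

Lemma denq_scale (x : rat) (d m : int) (k : nat) : d = denq x * m -> denq (d%:~R ^+ k.+1 * x) = 1.
Proof.
move=> ->; have -> : (denq x * m)%:~R ^+ k.+1 * x = ((denq x * m) ^+ k * m * numq x)%:~R.
  by rewrite exprS 2![in RHS]intrM -rat_num_den intrM rmorphXn /= intrM; ring.
exact: denq_int.
Qed.

Lemma integral_model_exists E : exists E', integral_model E' /\ wiso E E'.
Proof.
pose d : int := denq (wa1 E) * denq (wa2 E) * denq (wa3 E) * denq (wa4 E) * denq (wa6 E).
have d0 : (d%:~R : rat) != 0 by rewrite intr_eq0 !mulf_neq0 ?denq_neq0.
have scal x k m := @denq_scale x d m k.
exists (WModel (d%:~R ^+ 1 * wa1 E) (d%:~R ^+ 2 * wa2 E) (d%:~R ^+ 3 * wa3 E) (d%:~R ^+ 4 * wa4 E) (d%:~R ^+ 6 * wa6 E)).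
split.
  split=> /=.
  - apply: (scal _ _ (denq (wa2 E) * denq (wa3 E) * denq (wa4 E) * denq (wa6 E))); rewrite /d; ring.
  - apply: (scal _ _ (denq (wa1 E) * denq (wa3 E) * denq (wa4 E) * denq (wa6 E))); rewrite /d; ring.
  - apply: (scal _ _ (denq (wa1 E) * denq (wa2 E) * denq (wa4 E) * denq (wa6 E))); rewrite /d; ring.
  - apply: (scal _ _ (denq (wa1 E) * denq (wa2 E) * denq (wa3 E) * denq (wa6 E))); rewrite /d; ring.
  - apply: (scal _ _ (denq (wa1 E) * denq (wa2 E) * denq (wa3 E) * denq (wa4 E))); rewrite /d; ring.
exists (d%:~R^-1), 0, 0, 0; split; first by rewrite invr_eq0.
by rewrite /=; split; [|split; [|split; [|split]]]; field.
Qed.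

(** Minimality ranges over the isomorphism class, so D serves for every model F in it, in particular
    for the short model, whose own discriminant is larger by 6^12. *)
Lemma minimal_model_exists E : exists E' D, [/\ integral_model E', wiso E E',
  absz (numq (wdisc E')) = D & forall F, wiso E' F -> is_abs_min_disc F D].
Proof.
have [E0 [i0 w0]] := integral_model_exists E.
have [D [[E' [iE wE eD]] hmin]] := @nat_min (fun D => exists E', [/\ integral_model E', wiso E E' &
  absz (numq (wdisc E')) = D]) ltac:(by exists (absz (numq (wdisc E0))), E0).
exists E', D; split=> // F wF; split.
  by exists E'; split=> //; split=> //; exact: wiso_sym.
move=> F' iF wF'; apply: hmin; exists F'; split => //.
exact: wiso_trans (wiso_trans wE wF) wF'.
Qed.

Ltac int_closed := repeat lazymatch goal with
  | |- is_true (in_mem (Algebra.add _ _) _) => apply: rpredD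
  | |- is_true (in_mem (Algebra.opp _) _) => rewrite rpredN
  | |- is_true (in_mem (GRing.mul _ _) _) => apply: rpredM
  | |- is_true (in_mem (GRing.exp _ _) _) => apply: rpredX
  | |- is_true (in_mem (Algebra.natmul _ _) _) => exact: rpred_nat
  | |- _ => assumption
  end.

Lemma integral_invariants E : integral_model E -> exists C4 C6 Dl : int,
  [/\ wc4 E = C4%:~R, wc6 E = C6%:~R & wdisc E = Dl%:~R].
Proof.
have isint x : denq x = 1 -> x \is a Num.int by move=> h; rewrite Qint_def h.
case=> /isint h1 /isint h2 /isint h3 /isint h4 /isint h6.
have b2 : wb2 E \is a Num.int by rewrite /wb2; int_closed.
have b4 : wb4 E \is a Num.int by rewrite /wb4; int_closed.
have b6 : wb6 E \is a Num.int by rewrite /wb6; int_closed.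
have b8 : wb8 E \is a Num.int by rewrite /wb8; int_closed.
have /intrP[C4 e4] : wc4 E \is a Num.int by rewrite /wc4; int_closed.
have /intrP[C6 e6] : wc6 E \is a Num.int by rewrite /wc6; int_closed.
have /intrP[Dl eD] : wdisc E \is a Num.int by rewrite /wdisc; int_closed.
by exists C4, C6, Dl.
Qed.

Lemma between_squares (z c : int) (n : nat) : Posz (n * n)%nt < c -> c < Posz (n.+1 * n.+1)%nt ->
  z * z = c -> False.
Proof.
move=> h1 h2 h; have hn : Posz (absz z * absz z)%nt = c by rewrite PoszM abszE -expr2 real_normK ?num_real // expr2 h.
have [h3|h3] := leqP (absz z) n; have := leq_mul h3 h3.
  by move: h1; rewrite -hn ltz_nat ltnNge => /negP.
by move: h2; rewrite -hn ltz_nat ltnNge => /negP.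
Qed.

Section InvariantHeights.
Variables (C4 C6 Dl : int) (j : rat).
Hypothesis Dl0 : Dl != 0.
Hypothesis rel : C4 ^+ 3 - C6 ^+ 2 = 1728 * Dl.
Hypothesis ej : j * Dl%:~R = C4%:~R ^+ 3.
Let D := absz Dl.
Let M : R := Rmax (hQ j) (ln (INR D)).

Lemma j_num_den : C4 ^+ 3 * denq j = numq j * Dl.
Proof.
have e3 : (C4 ^+ 3)%:~R = j * Dl%:~R by rewrite ej rmorphXn.
by apply: (@intr_inj rat); rewrite intrM e3 intrM -rat_num_den; ring.
Qed.

Lemma D_gt0 : (0 < D)%nt. Proof. by rewrite absz_gt0. Qed.

Lemma absz_le_cube (z : int) : (absz z <= absz (z ^+ 3)%ri)%nt.
Proof. by rewrite abszX; case: (absz z) => // n; rewrite expnS leq_pmulr // expn_gt0. Qed.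

Lemma cube_C4_le : (absz (C4 ^+ 3)%ri <= ht j * D)%nt.
Proof.
apply: (@leq_trans (absz (C4 ^+ 3 * denq j)%ri)).
  by rewrite abszM leq_pmulr // absz_gt0 denq_neq0.
by rewrite j_num_den abszM leq_mul // ht_num.
Qed.

(** Otherwise D = 1 and the absolute value of C4^3 is at most 1, so C6^2 = C4^3 - 1728 Dl would be
    negative or lie strictly between 41^2 = 1681 and 42^2 = 1764. *)
Lemma invariant_max_ge : (lnN 2 <= M)%R.
Proof.
apply: Rnot_lt_le => hM.
have h1 : (ht j < 2)%nt.
  rewrite ltnNge; apply/negP => h; have := lnN_le (isT : (0 < 2)%nt) h.
  by have := Rmax_l (hQ j) (ln (INR D)); rewrite -/M hQE; lra.
have h2 : (D < 2)%nt.
  rewrite ltnNge; apply/negP => h; have := lnN_le (isT : (0 < 2)%nt) h.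
  by have := Rmax_r (hQ j) (ln (INR D)); rewrite -/M /lnN in hM *; lra.
have hC := cube_C4_le; have hC1 : (absz (C4 ^+ 3)%ri <= 1)%nt.
  by apply: leq_trans hC _; rewrite (@leq_mul _ _ 1 1).
have hsq : C6 * C6 = C4 ^+ 3 - 1728 * Dl by rewrite -rel; ring.
clear rel.
have D1 := D_gt0; rewrite /D in h2 D1.
have [eD|eD] : Dl = 1 \/ Dl = - 1 by clear hsq hC1; lia.
  have : C6 * C6 <= - 1; last by rewrite leNgt -expr2 (lt_le_trans _ (sqr_ge0 _)).
  rewrite hsq eD mulr1 lerBlDr; apply: (@le_trans _ _ 1) => //.
  by clear hsq; move: hC1; move: (C4 ^+ 3) => w; lia.
apply: (@between_squares C6 _ 41 _ _ hsq); rewrite eD mulrN1 opprK.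
  apply: (@lt_le_trans _ _ (- 1 + 1728)) => //; rewrite lerD2r.
  by clear hsq; move: hC1; move: (C4 ^+ 3) => w; lia.
apply: (@le_lt_trans _ _ (1 + 1728)) => //; rewrite lerD2r.
by clear hsq; move: hC1; move: (C4 ^+ 3) => w; lia.
Qed.

Definition coefT : nat := maxn (maxn (absz (- 27 * C4)%ri) (absz (- 54 * C6)%ri)) 1.

(** The 19 is 6 + 11 + 2: the factors 54 and 1729 are at most 2^6 and 2^11, and the height of j and
    log D contribute M each. *)
Lemma lnN_coefT : (lnN coefT <= 19 * M)%R.
Proof.
have D1 := D_gt0; pose X := (ht j * D)%nt.
have X0 : (0 < X)%nt by rewrite muln_gt0 ht_gt0.
have h4 : (absz C4 <= X)%nt by apply: leq_trans (absz_le_cube _) cube_C4_le.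
have hD : (D <= X)%nt by rewrite leq_pmull ?ht_gt0.
have h6 : (absz C6 <= 1729 * X)%nt.
  apply: (@leq_trans (absz (C6 * C6)%ri)); first by rewrite abszM; case: (absz C6) => // n; rewrite leq_pmulr.
  have -> : C6 * C6 = C4 ^+ 3 + - (1728 * Dl) by rewrite -rel; ring.
  apply: leq_trans (leq_abszD _ _) _; rewrite abszN abszM -/D.
  have hc := cube_C4_le; rewrite -/X in hc; rewrite mulSn.
  by apply: leq_add hc _; apply: leq_mul hD.
have hT : (coefT <= expn 2 6 * expn 2 11 * X)%nt.
  rewrite /coefT !geq_max !abszM; apply/andP; split; last by apply: leq_trans X0 _; rewrite leq_pmull // muln_gt0 !expn_gt0.
  apply/andP; split; rewrite -mulnA.
    by apply: leq_mul; [by [] | apply: leq_trans h4 _; rewrite leq_pmull // expn_gt0].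
  apply: leq_mul; first by [].
  apply: leq_trans h6 _; rewrite leq_mul2r; apply/orP; right.
  by [].
have T0 : (0 < coefT)%nt by rewrite /coefT leq_max orbT.
have := lnN_le T0 hT; rewrite lnN_prod3 ?expn_gt0 // lnN_exp // /X lnN_mul ?ht_gt0 //.
have := Rmax_l (hQ j) (ln (INR D)); have := Rmax_r (hQ j) (ln (INR D)); rewrite -/M hQE -/(lnN D).
have i6 : INR 6 = 6%R by rewrite /=; lra.
have i11 : INR 11 = 11%R by rewrite /=; lra.
by have := invariant_max_ge; rewrite i6 i11; move: (lnN 2) (lnN coefT) => *; lra.
Qed.
End InvariantHeights.

Lemma short_of_wiso E a b : wiso E (shortW a b) -> exists u r s t : rat, [/\ u != 0, wa1 E = - 2 * s,
  wa2 E = - s ^+ 2 - 3 * r, wa3 E = 2 * r * s - 2 * t &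
  wa4 E = u ^+ 4 * a + 2 * r * s ^+ 2 - 2 * s * t + 3 * r ^+ 2 /\
  wa6 E = u ^+ 6 * b - u ^+ 4 * a * r - r ^+ 3 - r ^+ 2 * s ^+ 2 + 2 * r * s * t - t ^+ 2].
Proof.
case=> u [r [s [t [u0 [h1 [h2 [h3 [h4 h6]]]]]]]]; rewrite /= in h1 h2 h3 h4 h6.
have e1 : wa1 E = - 2 * s by rewrite -[LHS](addrK (2 * s)) -h1; ring.
have e2 : wa2 E = - s ^+ 2 - 3 * r.
  have -> : wa2 E = (u ^+ 2 * 0) + s * wa1 E - 3 * r + s ^+ 2 by rewrite h2; ring.
  by rewrite e1; ring.
have e3 : wa3 E = 2 * r * s - 2 * t.
  have -> : wa3 E = (u ^+ 3 * 0) - r * wa1 E - 2 * t by rewrite h3; ring.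
  by rewrite e1; ring.
have e4 : wa4 E = u ^+ 4 * a + 2 * r * s ^+ 2 - 2 * s * t + 3 * r ^+ 2.
  have -> : wa4 E = u ^+ 4 * a + s * wa3 E - 2 * r * wa2 E + (t + r * s) * wa1 E - 3 * r ^+ 2 + 2 * s * t.
    by rewrite h4; ring.
  by rewrite e1 e2 e3; ring.
exists u, r, s, t; split => //; split => //.
have -> : wa6 E = u ^+ 6 * b - r * wa4 E - r ^+ 2 * wa2 E - r ^+ 3 + t * wa3 E + t ^+ 2 + r * t * wa1 E.
  by rewrite h6; ring.
by rewrite e1 e2 e3 e4; ring.
Qed.

Lemma int_cube_square (k : nat) (x y z : int) :
  x%:~R ^+ 3 - y%:~R ^+ 2 = k%:R * z%:~R :> rat -> x ^+ 3 - y ^+ 2 = k%:R * z.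
Proof.
by move=> h; apply: (@intr_inj rat); rewrite intrB !rmorphXn [LHS]h intrM rmorph_nat.
Qed.

Lemma minimal_short_model E : elliptic E -> exists (C4 C6 Dl : int) (j : rat),
  let Es := shortW (- 27 * C4)%:~R (- 54 * C6)%:~R in
  [/\ wiso E Es, Dl != 0, C4 ^+ 3 - C6 ^+ 2 = 1728 * Dl, j * Dl%:~R = C4%:~R ^+ 3 &
   [/\ wj Es = j, is_abs_min_disc Es (absz Dl) & 4 * ((- 27 * C4)%:~R : rat) ^+ 3 + 27 * ((- 54 * C6)%:~R : rat) ^+ 2 != 0]].
Proof.
move=> hE; have [E' [D [iE wE eD hmin]]] := minimal_model_exists E.
have hE' := wiso_disc wE hE; have [C4 [C6 [Dl [e4 e6 eDl]]]] := integral_invariants iE.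
have ws := wiso_short E'.
have eA : (- 27 * C4)%:~R = - 27 * wc4 E' by rewrite e4 intrM.
have eB : (- 54 * C6)%:~R = - 54 * wc6 E' by rewrite e6 intrM.
exists C4, C6, Dl, (wj E'); rewrite /= eA eB.
have D0 : (Dl%:~R : rat) != 0 by rewrite -eDl.
split.
- exact: wiso_trans wE ws.
- by move: D0; rewrite intr_eq0.
- by have := wc4_wc6 E'; rewrite e4 e6 eDl; exact: int_cube_square.
- by rewrite /wj e4 eDl mulfVK.
split; first exact: wj_short_c.
  by have -> : absz Dl = D; [rewrite -eD eDl numq_int | exact: hmin].
by have := wiso_disc ws hE'; rewrite /elliptic wdisc_short mulf_eq0 negb_or => /andP[].
Qed.

Lemma pow4_large (x : R) : exists t, (x < 4 ^ t)%R.
Proof.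
have [t ht] := Pow_x_infinity 4 ltac:(rewrite Rabs_right; lra) (x + 1)%R; exists t.
have := ht t (le_n _); have p : (0 < 4 ^ t)%R by apply: pow_lt; lra.
by rewrite Rabs_right; lra.
Qed.

(** Each of the three terms is at most 2^(E0 (r + 1)), where W <= 2^(r t + 2) explains the t + 2;
    the factor 32 covers their multiplicities and the restriction to a class modulo 4. *)
Lemma count_exponent (t t2 e r n N : nat) (W := ((expn 2 (r * t)).*2).+1) (E0 := (t2 + (t + 2) * e + (t + 2))%nt) :
  (n <= expn 2 (r * t2) + 2 * expn W e + 2 * W)%nt -> (N < 4 * n.+1)%nt ->
  (N <= expn 2 (E0 + 5) * expn (expn 2 (E0 + 1)) r)%nt.
Proof.
move=> hn hN; pose Z := expn 2 (E0 * r.+1).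
have Z0 : (0 < Z)%nt by rewrite expn_gt0.
have hW : (W <= expn 2 (r * t + 2))%nt.
  rewrite /W expnD -addnn; have : (0 < expn 2 (r * t))%nt by rewrite expn_gt0.
  by rewrite (_ : expn 2 2 = 4) //; lia.
have b1 : (expn 2 (r * t2) <= Z)%nt by rewrite leq_exp2l // /E0; nia.
have b2 : (W <= Z)%nt by apply: leq_trans hW _; rewrite leq_exp2l // /E0; nia.
have b3 : (expn W e <= Z)%nt.
  have [->|e0] := posnP e; first by rewrite expn0.
  apply: (@leq_trans (expn (expn 2 (r * t + 2)) e)); first by rewrite leq_exp2r.
  by rewrite -expnM leq_exp2l // /E0; nia.
have aux p w v z : (n <= p + 2 * w + 2 * v)%nt -> (p <= z)%nt -> (v <= z)%nt -> (w <= z)%nt ->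
  (0 < z)%nt -> (N <= 32 * z)%nt by clear -hN; lia.
have hN' := aux _ _ _ _ hn b1 b2 b3 Z0.
apply: leq_trans hN' _.
have -> : (expn 2 (E0 + 5) * expn (expn 2 (E0 + 1)) r = 32 * (Z * expn 2 r))%nt.
  have -> : expn 2 (E0 + 5) = (32 * expn 2 E0)%nt by rewrite addnC expnD.
  by rewrite -expnM -mulnA /Z -!expnD; congr (_ * expn _ _)%nt; rewrite mulnDl mul1n mulnS; lia.
by rewrite leq_mul2l /= leq_pmulr // expn_gt0.
Qed.

Theorem theorem1p5 :
  lang_conjecture ->
  exists A C : R, (1 < A)%R /\ (0 < C)%R /\
    forall (E : wmodel), elliptic E ->
    forall r : nat, has_rank E r ->
    forall (N : nat) (Ps : nat -> point), x_arith_prog E N Ps ->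
      (INR N <= C * A ^ r)%R.
Proof.
case=> cL [cL0 lang]; have [K [K1 HK]] := triple_bound_exists.
(* The constant of [lnN_coefT]. *)
have c11 : (1 <= 19)%R by lra.
have [t ht] := pow4_large (2048 * K2 K + 16).
have [t2 ht2] := pow4_large (16 * (8 * K3 19 K + 2 * c2 19) / cL).
have [e he] : exists e, (8 * K3 19 K <= INR e)%R.
  have [e he] := pow4_large (8 * K3 19 K); exists (expn 4 e).
  by rewrite INR_expn (_ : INR 4 = 4%R); [lra | rewrite /=; lra].
have t2K : (16 * (8 * K3 19 K + 2 * c2 19) < 4 ^ t2 * cL)%R.
  have := Rmult_lt_compat_r _ _ _ cL0 ht2.
  by have -> : (16 * (8 * K3 19 K + 2 * c2 19) / cL * cL = 16 * (8 * K3 19 K + 2 * c2 19))%R by Rfield; lra.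
pose E0 := (t2 + (t + 2) * e + (t + 2))%nt.
exists (INR (expn 2 (E0 + 1))), (INR (expn 2 (E0 + 5))).
split; first by rewrite -[1%R]/(INR 1); apply/lt_INR/ssrnat.ltP; rewrite addn1 -{1}(expn0 2) ltn_exp2l.
split; first by apply: INR_gt0; rewrite expn_gt0.
move=> E hE r hr N Ps hPs.
rewrite -INR_expn -INR_muln; apply: INR_le.
have [C4 [C6 [Dl [j [wE Dl0 rel ej [hj hD ns]]]]]] := minimal_short_model hE.
set A : int := - 27 * C4 in wE hj hD ns; set B : int := - 54 * C6 in wE hj hD ns.
pose M := Rmax (hQ j) (ln (INR (absz Dl))).
have M2 : (lnN 2 <= M)%R := invariant_max_ge Dl0 rel ej.
have TM : (lnN (coefT C4 C6) <= 19 * M)%R := lnN_coefT Dl0 rel ej.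
have T1 : (0 < coefT C4 C6)%nt by rewrite /coefT leq_max orbT.
have TA : (absz A <= coefT C4 C6)%nt by rewrite /coefT !leq_max leqnn.
have TB : (absz B <= coefT C4 C6)%nt by rewrite /coefT !leq_max leqnn orbT.
have [u [x0 [s [y0 [u0 e1 e2 e3 [e4 e6]]]]]] := short_of_wiso wE.
have q_rank := short_rank u0 e1 e2 e3 e4 e6 (ns := ns) hr.
have [al [de [de0 hprog]]] := short_progression u0 e1 e2 e3 e4 e6 hPs.
have [c hc [Q [xQ sepQ]]] := progression_subsequence ns de0 hprog.
have [q [qcv q_ge0 q_hp q_par]] := canonical_height_exists (fun P : ecpt ns => hpt_ge0 (ecval P))
  (hp_par T1 TA TB (ns := ns)) (hp0 ns).
have q_gap (P : ecpt ns) : (forall k, (0 < k)%nt -> P *+ k <> 0) -> (cL * M <= q P)%R.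
  move=> hP; have hEs : elliptic (shortW A%:~R B%:~R) by rewrite /elliptic wdisc_short mulf_neq0.
  (* Lang's bound is applied to the short model itself, whose j-invariant and minimal discriminant
     are those of E and whose height sequence is [tateseq]. *)
  rewrite /M -hj; apply: (lang _ hEs (ecval P)) => //.
  - exact: ec_on.
  - by move=> k hk h; apply: (hP k hk); apply: ecval_inj; rewrite ecvalMn.
  - move=> eps heps; have [n0 hn0] := qcv P eps heps; exists n0 => n hn.
    by have := hn0 n hn; rewrite /tateseq /hp ecvalMn.
(* Whatever the residue c < 4, the indices c + 4 k with k < N / 4 stay below N; the extracted
   progression has common difference 4 [de]. *)
pose n := (N %/ 4)%nt.
have in_range k : (k < n)%nt -> (c + 4 * k < N)%nt by have := leq_trunc_div N 4; rewrite /n; lia.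
have de4 : 4 * de != 0 by rewrite mulf_neq0.
have xQ' k : (k < n)%nt -> exists y, ecval (Q k) = Some ((al + c%:R * de) + k%:R * (4 * de), y).
  move=> hk; have [y ->] := xQ k (in_range k hk); exists y; congr Some; congr pair.
  by rewrite natrD natrM; ring.
have sepQ' k l i : (k < n)%nt -> (l < n)%nt -> k != l -> (0 < i)%nt -> (Q k - Q l) *+ i <> 0.
  by move=> hk hl; apply: sepQ; exact: in_range.
have hcount := progression_count cL0 c11 K1 HK T1 TA TB M2 TM q_ge0 q_par q_rank q_hp q_gap de4 xQ' sepQ'
  (Rlt_le _ _ ht) (erefl _) t2K he.
apply: count_exponent hcount _.
by rewrite /n; have := ltn_ceil N (isT : (0 < 4)%nt); lia.
Qed.
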